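(* Let $n\ge 2$ and $N\ge 1$ be integers, let $\Sigma_{2N}=\bigcup_{l=0}^{2N-1}\{te^{\frac{i\pi l}{2N}}: t\in\mathbb R\}\subset\mathbb C$, and let $S_n=\mathbb C^{n-1}\times\Sigma_{2N}\subset\mathbb C^n$. Let $f\in L^p(\mathbb C^n)$ with $1\le p\le 2$. Suppose that $f\times\mu_r(z)=0$ for all $r>0$ and all $z\in S_n$. Then $f=0$ almost everywhere on $\mathbb C^n$.
   Context: For $r>0$, $\mu_r$ denotes the normalized surface measure on the sphere $\{w\in\mathbb C^n:|w|=r\}$. The twisted spherical mean of a function $f$ on $\mathbb C^n$ is $$f\times\mu_r(z)=\int_{|w|=r}f(z-w)\,e^{\frac{i}{2}\operatorname{Im}(z\cdot\bar w)}\,d\mu_r(w),\qquad z\in\mathbb C^n,$$ where $z\cdot\bar w=\sum_{j=1}^n z_j\bar w_j$. *)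

(* Defs.v *)
From HB Require Import structures.
From mathcomp Require Import all_boot all_order all_algebra.
From mathcomp Require Import all_classical all_reals all_analysis.
From mathcomp Require Import measurable_realfun complex.

Set Implicit Arguments.
Unset Strict Implicit.
Unset Printing Implicit Defensive.

Import Order.TTheory GRing.Theory Num.Theory.
Import numFieldNormedType.Exports.

Local Open Scope classical_set_scope.
Local Open Scope ring_scope.
Local Open Scope complex_scope.

Notation normc := ComplexField.Normc.normc.

Definition measure_complex_display : measure_display -> measure_display.
Proof. exact. Qed.

(* The Borel sigma-algebra of C, generated by the real and imaginary parts. *)
Section measurable_complex.
Variable R : realType.
HB.instance Definition _ := Pointed.copy R[i] R[i]^o.

Let B : set (set R[i]) := g_sigma_preimageU (@complex.Re R) (@complex.Im R).

Let B0 : B set0. Proof. exact: sigma_algebra0. Qed.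

Let BC A : B A -> B (~` A). Proof. exact: sigma_algebraC. Qed.

Let B_bigcup (F : _^nat) : (forall i, B (F i)) -> B (\bigcup_i (F i)).
Proof. exact: sigma_algebra_bigcup. Qed.

HB.instance Definition _ :=
  @isMeasurable.Build (measure_complex_display default_measure_display)
    R[i] B B0 BC B_bigcup.

Lemma measurable_Re : measurable_fun [set: R[i]] (@complex.Re R).
Proof.
by move=> _ A mA; rewrite setTI; apply: sub_sigma_algebra; left;
  exists A => //; rewrite setTI.
Qed.

Lemma measurable_Im : measurable_fun [set: R[i]] (@complex.Im R).
Proof.
by move=> _ A mA; rewrite setTI; apply: sub_sigma_algebra; right;
  exists A => //; rewrite setTI.
Qed.

Lemma measurable_fun_complexP d (T : measurableType d) (f : T -> R[i]) :
  measurable_fun [set: T] f <->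
  measurable_fun [set: T] (fun x => complex.Re (f x)) /\
  measurable_fun [set: T] (fun x => complex.Im (f x)).
Proof.
split=> [mf|[mr mi]].
  by split; [exact: (measurableT_comp measurable_Re)
            |exact: (measurableT_comp measurable_Im)].
move=> _ A mA; rewrite setTI.
suff : preimage_set_system [set: T] f B `<=` measurable.
  by apply; exists A => //; rewrite setTI.
rewrite -(@g_sigma_preimageU_comp _ _ _ _ _ (@complex.Re R) (@complex.Im R) _ f).
apply: smallest_sub; first exact: sigma_algebra_measurable.
by move=> _ [[C mC <-]|[C mC <-]]; [exact: mr|exact: mi].
Qed.

End measurable_complex.

Definition measure_row_display : measure_display -> measure_display.
Proof. exact. Qed.

(* The product sigma-algebra on row vectors, generated by the coordinates. *)
Section measurable_row.
Context d (T : measurableType d) (n : nat).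

HB.instance Definition _ := isPointed.Build 'rV[T]_n (const_mx point).

Let coord (i : 'I_n) (v : 'rV[T]_n) : T := v ord0 i.

Let row0 : g_sigma_preimage coord set0.
Proof. exact: sigma_algebra0. Qed.

Let rowC A : g_sigma_preimage coord A -> g_sigma_preimage coord (~` A).
Proof. exact: sigma_algebraC. Qed.

Let row_bigcup (F : _^nat) : (forall i, g_sigma_preimage coord (F i)) ->
  g_sigma_preimage coord (\bigcup_i (F i)).
Proof. exact: sigma_algebra_bigcup. Qed.

HB.instance Definition _ := @isMeasurable.Build (measure_row_display d)
  'rV[T]_n (g_sigma_preimage coord) row0 rowC row_bigcup.

Lemma measurable_coord (i : 'I_n) :
  measurable_fun [set: 'rV[T]_n] (fun v => v ord0 i).
Proof.
move=> _ Y mY; rewrite setTI; apply: sub_sigma_algebra => /=.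
rewrite -bigcup_seq/=; exists i => /=; first by rewrite mem_index_enum.
by exists Y => //; rewrite setTI.
Qed.

Lemma measurable_fun_rowP d' (T' : measurableType d') (f : T' -> 'rV[T]_n) :
  measurable_fun [set: T'] f <->
  forall i, measurable_fun [set: T'] (fun x => f x ord0 i).
Proof.
split=> [mf i|mf]; first exact: (measurableT_comp (measurable_coord i)).
move=> _ A mA; rewrite setTI.
suff : preimage_set_system [set: T'] f (g_sigma_preimage coord) `<=` measurable.
  by apply; exists A => //; rewrite setTI.
rewrite -(g_sigma_preimage_comp coord f).
apply: smallest_sub; first exact: sigma_algebra_measurable.
move=> C; rewrite -bigcup_seq => -[i _ [B mB <-]].
exact: mf.
Qed.

End measurable_row.

(* The library proves this, but its [SigmaFiniteMeasure] instance on
   [m1 \x m2] is only found when [m1] and [m2] are subprobabilities. *)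
Lemma sigma_finite_product d1 d2 (T1 : measurableType d1)
    (T2 : measurableType d2) (R : realType)
    (m1 : {sigma_finite_measure set T1 -> \bar R})
    (m2 : {sigma_finite_measure set T2 -> \bar R}) :
  sigma_finite setT (m1 \x m2)%E.
Proof.
have /sigma_finiteP[F [TF ndF Foo]] := sigma_finiteT m1.
have /sigma_finiteP[G [TG ndG Goo]] := sigma_finiteT m2.
exists (fun n => F n `*` G n).
  rewrite -setXTT TF TG predeqE => -[x y]; split.
    move=> [/= [n _ Fnx] [k _ Gky]]; exists (maxn n k) => //; split.
    - by move: x Fnx; exact/subsetPset/ndF/leq_maxl.
    - by move: y Gky; exact/subsetPset/ndG/leq_maxr.
  by move=> [n _ []/= ? ?]; split; exists n.
move=> k; have [? ?] := Foo k; have [? ?] := Goo k.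
split; first exact: measurableX.
by rewrite product_measure1E// lte_mul_pinfty// ge0_fin_numE.
Qed.

(* [pushforward m f] as a sigma-finite measure, when [f] is an embedding. *)
Section sigma_finite_image.
Local Open Scope ereal_scope.
Context d1 d2 (T1 : measurableType d1) (T2 : measurableType d2) (R : realType).
Variables (m : {measure set T1 -> \bar R}).
Hypothesis msf : sigma_finite setT m.
Variables (f : T1 -> T2) (g : T2 -> T1).
Hypothesis mf : measurable_fun [set: T1] f.
Hypothesis mg : measurable_fun [set: T2] g.
Hypothesis fK : cancel f g.

Let mu : set T2 -> \bar R := pushforward m f.

Let mu0 : mu set0 = 0.
Proof. by rewrite /mu /pushforward preimage_set0 measure0. Qed.

Let mu_ge0 A : 0 <= mu A. Proof. exact: measure_ge0. Qed.

Let mu_sigma_additive : semi_sigma_additive mu.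
Proof. exact: measure_semi_sigma_additive. Qed.

HB.instance Definition _ := isMeasure.Build _ _ _ mu
  mu0 mu_ge0 mu_sigma_additive.

Let mu_sigma_finite : sigma_finite setT mu.
Proof.
have [F FT Foo] := msf.
exists (fun n => g @^-1` F n); first by rewrite -preimage_bigcup -FT.
move=> n; have [mF Fn] := Foo n; split.
  by rewrite -[X in measurable X]setTI; exact: mg.
rewrite /mu /pushforward -comp_preimage.
by rewrite (_ : g \o f = id)//; apply/funext => x /=; rewrite fK.
Qed.

HB.instance Definition _ := Measure_isSigmaFinite.Build _ _ _ mu
  mu_sigma_finite.

Definition sigma_finite_image : {sigma_finite_measure set T2 -> \bar R} := mu.

Lemma sigma_finite_imageE A : sigma_finite_image A = m (f @^-1` A).
Proof. by []. Qed.

End sigma_finite_image.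

Section lebesgue_Cn.
Local Open Scope ereal_scope.
Variable R : realType.

Local Notation RxR := (measurableTypeR R * measurableTypeR R)%type.

Definition pair_complex (p : RxR) : R[i] :=
  (p.1 +i* p.2)%C.

Definition complex_pair (x : R[i]) : RxR :=
  (complex.Re x, complex.Im x).

Lemma pair_complexK : cancel pair_complex complex_pair. Proof. by case. Qed.

Lemma measurable_pair_complex : measurable_fun setT pair_complex.
Proof.
apply/measurable_fun_complexP.
by split; [exact: measurable_fst|exact: measurable_snd].
Qed.

Lemma measurable_complex_pair : measurable_fun setT complex_pair.
Proof.
apply: measurable_fun_pair; [exact: measurable_Re|exact: measurable_Im].
Qed.

(* dx dy on C *)
Definition lebesgue_complex : {sigma_finite_measure set R[i] -> \bar R} :=
  sigma_finite_image (sigma_finite_product lebesgue_measure lebesgue_measure)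
    measurable_pair_complex measurable_complex_pair pair_complexK.

Definition row_cons n (p : R[i] * 'rV[R[i]]_n) : 'rV[R[i]]_n.+1 :=
  row_mx (const_mx p.1 : 'rV_1) p.2.

Definition row_uncons n (v : 'rV[R[i]]_n.+1) : R[i] * 'rV[R[i]]_n :=
  (v ord0 ord0, rsubmx (v : 'rV_(1 + n))).

Lemma row_consK n : cancel (@row_cons n) (@row_uncons n).
Proof.
move=> [x v]; rewrite /row_cons /row_uncons row_mxKr; congr pair.
rewrite mxE; case: splitP => // j _; by rewrite mxE.
Qed.

Lemma measurable_row_cons n : measurable_fun setT (@row_cons n).
Proof.
apply/measurable_fun_rowP => i; rewrite /row_cons.
rewrite (_ : (fun=> _) = fun p : R[i] * 'rV[R[i]]_n =>
  match fintype.split (i : 'I_(1 + n)) with inl j => p.1 | inr j => p.2 ord0 j end).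
  case: (fintype.split _) => j; first exact: measurable_fst.
  exact: (measurableT_comp (measurable_coord j)).
by apply/funext => p; rewrite mxE; case: fintype.split => // j; rewrite mxE.
Qed.

Lemma measurable_row_uncons n : measurable_fun setT (@row_uncons n).
Proof.
apply: measurable_fun_pair; first exact: measurable_coord.
apply/measurable_fun_rowP => i.
rewrite [X in measurable_fun _ X](_ : _ = fun v : 'rV[R[i]]_(1 + n) => v ord0 (rshift 1 i)).
  exact: measurable_coord.
by apply/funext => v; rewrite mxE.
Qed.

(* The n-fold product of [lebesgue_complex]; C^0 carries the point mass. *)
Fixpoint lebesgue_Cn n : {sigma_finite_measure set 'rV[R[i]]_n -> \bar R} :=
  if n is n'.+1 then
    sigma_finite_image (sigma_finite_product lebesgue_complex (lebesgue_Cn n'))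
      (@measurable_row_cons n') (@measurable_row_uncons n') (@row_consK n')
  else \d_ (0%R : 'rV[R[i]]_0).

End lebesgue_Cn.

Section sphere.
Variables (R : realType) (n : nat).
Local Notation Cn := 'rV[R[i]]_n.

(* The library's norm on row vectors is the sup norm; this is the Euclidean
   one. *)
Definition enorm (z : Cn) : R :=
  Num.sqrt (\sum_(j < n) normc (z ord0 j) ^+ 2).

Lemma enormE z : enorm z =
  (\sum_(j < n) (complex.Re (z ord0 j) ^+ 2 + complex.Im (z ord0 j) ^+ 2))
    `^ 2^-1.
Proof.
rewrite powR12_sqrt; last by apply: sumr_ge0 => j _; rewrite addr_ge0 ?sqr_ge0.
congr Num.sqrt; apply: eq_bigr => j _; case: (z ord0 j) => a b /=.
by rewrite sqr_sqrtr // addr_ge0 ?sqr_ge0.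
Qed.

Lemma measurable_enorm : measurable_fun setT enorm.
Proof.
rewrite (funext enormE).
apply: (measurableT_comp (measurable_powR _)).
apply: measurable_sum => j; apply: measurable_funD; apply: measurable_funX.
  exact: (measurableT_comp (@measurable_Re R) (measurable_coord j)).
exact: (measurableT_comp (@measurable_Im R) (measurable_coord j)).
Qed.

Definition unit_ball : set Cn := [set w | enorm w < 1].

Lemma measurable_unit_ball : measurable unit_ball.
Proof.
rewrite (_ : unit_ball = setT `&` enorm @^-1` `]-oo, 1[%classic).
  exact: measurable_enorm.
by rewrite setTI; apply/seteqP; split => w /=; rewrite in_itv.
Qed.

Definition sphere (r : R) : set Cn := [set w | enorm w = r].

Definition radial_proj (r : R) (w : Cn) : Cn := (r / enorm w)%:C *: w.

Lemma measurable_radial_proj r : measurable_fun setT (radial_proj r).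
Proof.
have mV : measurable_fun setT (fun w : Cn => r / enorm w).
  rewrite (_ : (fun _ => _) = fun w => r * enorm w `^ (-1)).
    apply: measurable_funM => //.
    exact: (measurableT_comp (measurable_powR _) measurable_enorm).
  by apply/funext => w; rewrite powR_inv1 // sqrtr_ge0.
apply/measurable_fun_rowP => i; apply/measurable_fun_complexP; split.
  rewrite (_ : (fun _ => _) =
    fun w => r / enorm w * complex.Re (w ord0 i)).
    apply: measurable_funM => //.
    exact: (measurableT_comp (@measurable_Re R) (measurable_coord i)).
  by apply/funext => w; rewrite mxE; case: (w ord0 i) => a b /=; rewrite mul0r subr0.
rewrite (_ : (fun _ => _) = fun w => r / enorm w * complex.Im (w ord0 i)).
  apply: measurable_funM => //.
  exact: (measurableT_comp (@measurable_Im R) (measurable_coord i)).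
by apply/funext => w; rewrite mxE; case: (w ord0 i) => a b /=; rewrite mul0r addr0.
Qed.

Lemma ball_volV_ge0 : 0 <= (fine (lebesgue_Cn R n unit_ball))^-1.
Proof. by rewrite invr_ge0 fine_ge0 // measure_ge0. Qed.

(* Normalized surface measure on the sphere of radius r: the measure of A is
   |{w in B : r w/|w| in A}| / |B| with B the unit ball, i.e. the normalized
   Lebesgue measure of the solid cone over A (polar coordinates). *)
Definition sphere_measure (r : R) : {measure set Cn -> \bar R} :=
  let normalized_ball :=
    mscale (NngNum ball_volV_ge0)
      (mrestr (lebesgue_Cn R n) measurable_unit_ball) in
  @measure_function_pushforward__canonical__measure_function_Measure
    _ _ _ _ _ normalized_ball _ (measurable_radial_proj r).

Lemma sphere_measureE r A : sphere_measure r A =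
  (((fine (lebesgue_Cn R n unit_ball))^-1)%:E *
   lebesgue_Cn R n (radial_proj r @^-1` A `&` unit_ball))%E.
Proof. by []. Qed.

End sphere.

Section twisted_spherical_mean.
Variables (R : realType) (n : nat).
Local Notation Cn := 'rV[R[i]]_n.

(* As for the library's [Rintegral], the value where a component has no finite
   integral is conventional (0 for that component). *)
Definition cintegral d (T : measurableType d) (mu : {measure set T -> \bar R})
    (D : set T) (f : T -> R[i]) : R[i] :=
  (\int[mu]_(x in D) complex.Re (f x)) +i* (\int[mu]_(x in D) complex.Im (f x)).

(* e^{it} *)
Definition expi (t : R) : R[i] := cos t +i* sin t.

Definition hermdot (z w : Cn) : R[i] := \sum_(j < n) z ord0 j * conjc (w ord0 j).

Definition twisted_spherical_mean (f : Cn -> R[i]) (r : R) (z : Cn) : R[i] :=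
  cintegral (sphere_measure n r) (sphere r)
    (fun w => f (z - w) * expi (complex.Im (hermdot z w) / 2)).

Definition in_Lp (p : R) (f : Cn -> R[i]) : Prop :=
  measurable_fun [set: Cn] f /\
  (Lnorm (lebesgue_Cn R n) p%:E (fun z => (normc (f z))%:E) < +oo)%E.

End twisted_spherical_mean.

(* The union of the m lines through 0 at angles pi l / m, 0 <= l < m. *)
Definition Coxeter_lines (R : realType) (m : nat) : set R[i] :=
  \bigcup_(l in `I_m)
    [set t%:C * expi (pi * l%:R / m%:R) | t in [set: R]].

(* C^(n-1) x A, as a subset of C^n: the last coordinate lies in A. *)
Definition last_coord_in (R : realType) (n : nat) (A : set R[i]) :
    set 'rV[R[i]]_n :=
  [set z | forall j : 'I_n, j.+1 = n -> A (z ord0 j)].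

(* Main.v *)
(* Two of the lines, R and iR, suffice.  For z in C^(n-1) x wR, integrating the
   spherical means over r against a Gaussian gives, with v = z - w,
     int f(v) e^(-s|v|^2) exp((s - 1/4) <z, v> + (s + 1/4) conj <z, v>) dv = 0
   for all s > 1/4.  Differentiating in the free coordinates of z at z = 0 yields
   all monomials q in these coordinates and their conjugates, and in the last
   coordinate only the powers of (s - 1/4) w conj(v_n) + (s + 1/4) conj(w) v_n.
   Differentiating in s gives relations involving |v_n|^2 as well; for the two
   orthogonal directions w = 1 and w = i these force, by induction on the degree,
   every moment of f(v) e^(-s|v|^2) to vanish.  Summing the exponential series,
   int f(v) e^(-s|v|^2 + 2 Re <a, v>) dv = 0 for all a and all s > 1/4.  Hence the
   integral of f(v) e^(-s|v|^2) times any polynomial in a Gaussian centred at any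
   point vanishes; such polynomials approximate indicators of balls, balls exhaust
   half-spaces, and half-spaces generate the Borel sets. *)

Require Import Defs.
From mathcomp Require Import all_boot all_order all_algebra.
From mathcomp Require Import all_classical all_reals all_analysis.
From mathcomp Require Import measurable_realfun complex ring lra zify.

Set Implicit Arguments.
Unset Strict Implicit.
Unset Printing Implicit Defensive.

Import Order.TTheory GRing.Theory Num.Theory.
Import numFieldNormedType.Exports ComplexField.Normc.

Local Open Scope classical_set_scope.
Local Open Scope ring_scope.

(** * Affine changes of variables and Gaussian integrals on C^n *)

(** The constant 1/4 comes from splitting the twist: with [h = <z, v>],
    [-(i/2) Im h = -h/4 + conj h/4]. For [s > 1/4] both coefficients of the exponent are nonzero, so
    the directions [e_j] and [i e_j] separate [v_j] from its conjugate. The obstacle is the last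
    coordinate, where each line offers a single real direction: in degree [d], once the mixed
    moments are gone, a line gives one equation for the two pure moments, those of [conj(v_n)^d] and
    [v_n^d]. The missing equation comes from [s], which ranges over an open half-line: the
    derivative in [s] introduces moments with an extra [|v_n|^2], and these are eliminated by
    comparing the two lines in degree [d + 2], where passing from 1 to i changes the relative sign
    of pure and mixed moments. An arbitrary monomial [q] in the other coordinates is carried along
    because the derivative in [s] produces [|v_j|^2] for every [j]. *)

Section affine_change_of_variables.
Variable R : realType.
Local Open Scope ereal_scope.

Let mu := @lebesgue_measure R.

Let measurable_affine (a c : R) :
  measurable_fun [set: measurableTypeR R]
    (fun x : measurableTypeR R => (a + c * x)%R : measurableTypeR R).
Proof. by apply: measurable_funD => //; apply: measurable_funM. Qed.

(** Both sides are measures in [A] that agree on half-open intervals, and these determine Lebesgue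
    measure. *)
Lemma lebesgue_measure_affine (a c : R) (A : set (measurableTypeR R)) :
  c != 0%R -> measurable A ->
  mu A = `|c|%:E * mu ((fun x : R => a + c * x)%R @^-1` A).
Proof.
move=> c0 mA.
have /(_ (measurable_affine a c)) H := @lebesgue_measure_unique R
  (mscale (NngNum (normr_ge0 c)) (pushforward mu
  (fun x : measurableTypeR R => (a + c * x)%R : measurableTypeR R))).
apply: H => // _ [[u v]] _ <- /=.
rewrite /mscale /= /pushforward.
have [cp|cn|/eqP] := ltgtP c 0%R; last by rewrite (negbTE c0).
- rewrite (_ : _ @^-1` _ = `[((v - a) / c)%R, ((u - a) / c)%R[%classic); last first.
    apply/seteqP; split => x /=; rewrite !in_itv /=.
      by rewrite ler_ndivrMr // ltr_ndivlMr //; lra.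
    by rewrite ler_ndivrMr // ltr_ndivlMr //; lra.
  rewrite /mu !lebesgue_measure_itv /= !lte_fin ltr_ndivrMr //.
  rewrite divfK ?lt_eqF// ltrD2r; case: ifPn => uv; last by rewrite mule0.
  rewrite -!EFinB -EFinM ltr0_norm //; congr (_%:E); by field.
- rewrite (_ : _ @^-1` _ = `]((u - a) / c)%R, ((v - a) / c)%R]%classic); last first.
    apply/seteqP; split => x /=; rewrite !in_itv /=.
      by rewrite ler_pdivlMr // ltr_pdivrMr //; lra.
    by rewrite ler_pdivlMr // ltr_pdivrMr //; lra.
  rewrite /mu !lebesgue_measure_itv /= !lte_fin ltr_pdivrMr //.
  rewrite divfK ?gt_eqF// ltrD2r; case: ifPn => uv; last by rewrite mule0.
  by rewrite -!EFinB -EFinM gtr0_norm //; congr (_%:E); field; rewrite gt_eqF.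
Qed.

Lemma ge0_integral_affine (a c : R) (F : R -> \bar R) : c != 0%R ->
  measurable_fun [set: measurableTypeR R] F -> (forall x, 0 <= F x) ->
  \int[mu]_x F x = `|c|%:E * \int[mu]_x F (a + c * x)%R.
Proof.
move=> c0 mF F0.
pose nu : {measure set (measurableTypeR R) -> \bar R} :=
  @measure_function_pushforward__canonical__measure_function_Measure
    _ _ _ _ _ mu _ (measurable_affine a c).
transitivity (\int[mscale (NngNum (normr_ge0 c)) nu]_x F x).
  apply: eq_measure_integral => A mA _.
  exact: (lebesgue_measure_affine a c0 mA).
rewrite ge0_integral_mscale//=; congr (_ * _).
by rewrite ge0_integral_pushforward.
Qed.

End affine_change_of_variables.

Section integral_Cn.
Variable R : realType.
Local Open Scope ereal_scope.

Local Notation mu := (@lebesgue_measure R).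
Local Notation RxR := (measurableTypeR R * measurableTypeR R)%type.

Lemma ge0_integral_complex (F : R[i] -> \bar R) :
  measurable_fun [set: R[i]] F -> (forall x, 0 <= F x) ->
  \int[lebesgue_complex R]_x F x = \int[mu]_a \int[mu]_b F (a +i* b)%C.
Proof.
move=> mF F0; transitivity
  (\int[(mu \x mu)]_p (F \o @pair_complex R) p).
  apply: ge0_integral_pushforward => //; exact: measurable_pair_complex.
rewrite fubini_tonelli1//=.
exact: (measurableT_comp mF (@measurable_pair_complex R)).
Qed.

Lemma ge0_integral_Cn_cons n (F : 'rV[R[i]]_n.+1 -> \bar R) :
  measurable_fun setT F -> (forall x, 0 <= F x) ->
  \int[lebesgue_Cn R n.+1]_v F v =
  \int[lebesgue_complex R]_x \int[lebesgue_Cn R n]_v F (row_cons (x, v)).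
Proof.
move=> mF F0; transitivity
  (\int[(lebesgue_complex R \x lebesgue_Cn R n)]_p (F \o @row_cons R n) p).
  apply: ge0_integral_pushforward => //; exact: measurable_row_cons.
rewrite fubini_tonelli1//=.
exact: (measurableT_comp mF (@measurable_row_cons R n)).
Qed.

End integral_Cn.

Local Open Scope complex_scope.

(** * Measurability of complex-valued functions *)

Section measurable_complex_functions.
Variables (R : realType) (d : measure_display) (T : measurableType d).
Implicit Types f g : T -> R[i].

Lemma complex_ReM (x y : R[i]) : complex.Re (x * y) =
  complex.Re x * complex.Re y - complex.Im x * complex.Im y.
Proof. by case: x => a b; case: y. Qed.

Lemma complex_ImM (x y : R[i]) : complex.Im (x * y) =
  complex.Re x * complex.Im y + complex.Im x * complex.Re y.
Proof. by case: x => a b; case: y. Qed.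

Lemma complex_ReD (x y : R[i]) :
  complex.Re (x + y) = complex.Re x + complex.Re y.
Proof. by case: x => a b; case: y. Qed.

Lemma complex_ImD (x y : R[i]) :
  complex.Im (x + y) = complex.Im x + complex.Im y.
Proof. by case: x => a b; case: y. Qed.

Lemma complex_ReN (x : R[i]) : complex.Re (- x) = - complex.Re x.
Proof. by case: x. Qed.

Lemma complex_ImN (x : R[i]) : complex.Im (- x) = - complex.Im x.
Proof. by case: x. Qed.

Lemma complex_ReJ (x : R[i]) : complex.Re x^* = complex.Re x.
Proof. by case: x. Qed.

Lemma complex_ImJ (x : R[i]) : complex.Im x^* = - complex.Im x.
Proof. by case: x. Qed.

Lemma complex_ReZ (a : R) (x : R[i]) :
  complex.Re (a%:C * x) = a * complex.Re x.
Proof. by case: x => u v /=; rewrite mul0r subr0. Qed.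

Lemma complex_ImZ (a : R) (x : R[i]) :
  complex.Im (a%:C * x) = a * complex.Im x.
Proof. by case: x => u v /=; rewrite mul0r addr0. Qed.

Lemma eq_complexP (x y : R[i]) :
  complex.Re x = complex.Re y -> complex.Im x = complex.Im y -> x = y.
Proof. by case: x => a b; case: y => c e /= -> ->. Qed.

Lemma measurable_fun_Re f :
  measurable_fun setT f -> measurable_fun setT (fun x => complex.Re (f x)).
Proof. by case/measurable_fun_complexP. Qed.

Lemma measurable_fun_Im f :
  measurable_fun setT f -> measurable_fun setT (fun x => complex.Im (f x)).
Proof. by case/measurable_fun_complexP. Qed.

Lemma measurable_funDC f g : measurable_fun setT f -> measurable_fun setT g ->
  measurable_fun setT (fun x => f x + g x).
Proof.
move=> /measurable_fun_complexP[fr fi] /measurable_fun_complexP[gr gi].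
apply/measurable_fun_complexP; split.
  by under eq_fun do rewrite complex_ReD; apply: measurable_funD.
by under eq_fun do rewrite complex_ImD; apply: measurable_funD.
Qed.

Lemma measurable_funMC f g : measurable_fun setT f -> measurable_fun setT g ->
  measurable_fun setT (fun x => f x * g x).
Proof.
move=> /measurable_fun_complexP[fr fi] /measurable_fun_complexP[gr gi].
apply/measurable_fun_complexP; split.
  under eq_fun do rewrite complex_ReM.
  by apply: measurable_funB; apply: measurable_funM.
under eq_fun do rewrite complex_ImM.
by apply: measurable_funD; apply: measurable_funM.
Qed.

Lemma measurable_fun_conjc f : measurable_fun setT f ->
  measurable_fun setT (fun x => conjc (f x)).
Proof.
move=> /measurable_fun_complexP[fr fi]; apply/measurable_fun_complexP; split.
  by under eq_fun do rewrite complex_ReJ.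
by under eq_fun do rewrite complex_ImJ; apply: measurableT_comp.
Qed.

Lemma measurable_fun_real_complex (f : T -> R) : measurable_fun setT f ->
  measurable_fun setT (fun x => (f x)%:C).
Proof. by move=> mf; apply/measurable_fun_complexP. Qed.

Lemma normc_sqrt (x : R[i]) :
  normc x = Num.sqrt (complex.Re x ^+ 2 + complex.Im x ^+ 2).
Proof. by case: x. Qed.

Lemma measurable_fun_normc f : measurable_fun setT f ->
  measurable_fun setT (fun x => normc (f x)).
Proof.
move=> /measurable_fun_complexP[fr fi].
under eq_fun do rewrite normc_sqrt -powR12_sqrt ?addr_ge0 ?sqr_ge0//.
apply: (measurableT_comp (measurable_powR _)).
by apply: measurable_funD; apply: measurable_funX.
Qed.

End measurable_complex_functions.

(** * Euclidean norm and affine substitutions on C^n *)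

Section geometry_Cn.
Variable R : realType.

Definition sqnorm n (v : 'rV[R[i]]_n) : R := \sum_(j < n) normc (v ord0 j) ^+ 2.

Lemma sqnorm_ge0 n (v : 'rV[R[i]]_n) : 0 <= sqnorm v.
Proof. by apply: sumr_ge0 => j _; rewrite sqr_ge0. Qed.

Lemma normc_ge0 (x : R[i]) : 0 <= normc x.
Proof. by rewrite normc_sqrt sqrtr_ge0. Qed.

Lemma normc_sqrE (x : R[i]) :
  normc x ^+ 2 = complex.Re x ^+ 2 + complex.Im x ^+ 2.
Proof. by rewrite normc_sqrt sqr_sqrtr // addr_ge0 ?sqr_ge0. Qed.

Lemma normc_real (a : R) : normc a%:C = `|a|.
Proof. by rewrite normc_sqrt /= expr0n addr0 sqrtr_sqr. Qed.

Lemma row_cons0 n (x : R[i]) (v : 'rV_n) : row_cons (x, v) ord0 ord0 = x.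
Proof. by have := row_consK (x, v); rewrite /row_uncons => -[]. Qed.

Lemma row_consS n (x : R[i]) (v : 'rV_n) (i : 'I_n) :
  row_cons (x, v) ord0 (lift ord0 i) = v ord0 i.
Proof.
rewrite /row_cons (_ : lift ord0 i = rshift 1 i); last exact/val_inj.
exact: (row_mxEr (const_mx x : 'rV_1) v).
Qed.

Lemma row_cons_eta n (v : 'rV[R[i]]_n.+1) :
  v = row_cons (v ord0 ord0, \row_j v ord0 (lift ord0 j)).
Proof.
apply/rowP => j; have [->|[k ->]] : j = ord0 \/ exists k, j = lift ord0 k.
- case: (unliftP ord0 j) => [k ->|->]; [by right; exists k|by left].
- by rewrite row_cons0.
- by rewrite row_consS mxE.
Qed.

Lemma sqnorm_cons n (x : R[i]) (v : 'rV_n) :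
  sqnorm (row_cons (x, v)) = normc x ^+ 2 + sqnorm v.
Proof.
rewrite /sqnorm big_ord_recl row_cons0; congr (_ + _).
by apply: eq_bigr => j _; rewrite row_consS.
Qed.

Lemma row_cons_affine n (z : 'rV[R[i]]_n.+1) (c : R) (x : R[i]) (v : 'rV_n) :
  z + c%:C *: row_cons (x, v) = row_cons
   (z ord0 ord0 + c%:C * x, \row_j z ord0 (lift ord0 j) + c%:C *: v).
Proof.
rewrite [LHS]row_cons_eta mxE [X in _ + X]mxE row_cons0.
congr (row_cons (_, _)).
by apply/rowP => j; rewrite mxE mxE [X in _ + X = _]mxE row_consS !mxE.
Qed.

Lemma measurable_sqnorm n : measurable_fun setT (@sqnorm n).
Proof.
apply: measurable_sum => j; apply: measurable_funX.
apply: measurable_fun_normc; exact: measurable_coord.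
Qed.

Lemma measurable_Cn_affine n (z : 'rV[R[i]]_n) (c : R) :
  measurable_fun setT (fun v : 'rV[R[i]]_n => z + c%:C *: v).
Proof.
apply/measurable_fun_rowP => i.
under eq_fun do rewrite !mxE.
apply: measurable_funDC; first exact: measurable_cst.
apply: measurable_funMC; first exact: measurable_cst.
exact: measurable_coord.
Qed.

Local Open Scope ereal_scope.

Lemma ge0_integral_complex_affine (z : R[i]) (c : R) (F : R[i] -> \bar R) :
  c != 0%R -> measurable_fun setT F -> (forall x, 0 <= F x) ->
  \int[lebesgue_complex R]_x F x =
  (`|c| ^+ 2)%:E * \int[lebesgue_complex R]_x F (z + c%:C * x)%R.
Proof.
move=> c0 mF F0.
have maff : measurable_fun [set: R[i]] (fun x => z + c%:C * x)%R.
  apply: measurable_funDC; first exact: measurable_cst.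
  by apply: measurable_funMC => //; exact: measurable_cst.
rewrite !ge0_integral_complex//; last exact: (measurableT_comp mF).
have mFp : measurable_fun setT (F \o @pair_complex R).
  by apply: (measurableT_comp mF); exact: measurable_pair_complex.
have mFpa a : measurable_fun setT
    (fun b : measurableTypeR R => F (a +i* b)%C).
  exact: (measurableT_comp mFp (pair1_measurable a)).
have -> : (fun a => \int[lebesgue_measure]_b F (a +i* b)%C) = (fun a =>
    `|c|%:E * \int[lebesgue_measure]_b F (a +i* (complex.Im z + c * b)%R)%C).
  apply/funext => a.
  by rewrite (ge0_integral_affine (complex.Im z) c0).
pose G (p : measurableTypeR R * measurableTypeR R) :=
  F (p.1 +i* (complex.Im z + c * p.2)%R)%C.
have mG : measurable_fun setT G.
  apply: (measurableT_comp mF); apply/measurable_fun_complexP; split => /=.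
    exact: measurable_fst.
  apply: measurable_funD => //; apply: measurable_funM => //.
have mG1 := measurable_fun_fubini_tonelli_F (m2 := @lebesgue_measure R) G
   mG (fun=> F0 _).
rewrite ge0_integralZl//; last by move=> x _; apply: integral_ge0.
rewrite [X in _ * X = _](ge0_integral_affine (complex.Re z) c0)//; last first.
  by move=> x; apply: integral_ge0.
rewrite muleA -EFinM -expr2; congr (_ * _).
apply: eq_integral => a _; apply: eq_integral => b _; congr F.
by apply: eq_complexP; rewrite (complex_ReD, complex_ImD) (complex_ReZ, complex_ImZ).
Qed.

(** Tonelli peels off one coordinate at a time. The lemma serves the dilations of polar coordinates
    ([c = e^t]), the dilation by 2 that shows the origin to be null, and the reflection [v -> z - v]
    ([c = -1]). *)
Lemma ge0_integral_Cn_affine n (z : 'rV[R[i]]_n) (c : R)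
    (F : 'rV[R[i]]_n -> \bar R) :
  c != 0%R -> measurable_fun setT F -> (forall x, 0 <= F x) ->
  \int[lebesgue_Cn R n]_x F x =
  (`|c| ^+ (2 * n))%:E * \int[lebesgue_Cn R n]_x F (z + c%:C *: x)%R.
Proof.
move=> c0; elim: n z F => [|n ih] z F mF F0.
  rewrite muln0 expr0 mul1e; apply: eq_integral => x _; congr F.
  by apply/rowP => -[].
have mFz : measurable_fun setT (fun x : 'rV[R[i]]_n.+1 => F (z + c%:C *: x)%R).
  exact: (measurableT_comp mF (measurable_Cn_affine z c)).
rewrite !ge0_integral_Cn_cons//.
pose z' := (\row_j z ord0 (lift ord0 j))%R : 'rV_n.
have mFc : measurable_fun setT (F \o @row_cons R n).
  by apply: (measurableT_comp mF); exact: measurable_row_cons.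
have -> : (fun x => \int[lebesgue_Cn R n]_v F (row_cons (x, v))) = (fun x =>
  (`|c| ^+ (2 * n))%:E * \int[lebesgue_Cn R n]_v F (row_cons (x, z' + c%:C *: v))%R).
  apply/funext => x; rewrite (ih z')//.
  exact: (measurableT_comp mFc (pair1_measurable x)).
pose G (p : R[i] * 'rV[R[i]]_n) := F (row_cons (p.1, z' + c%:C *: p.2)%R).
have mG : measurable_fun setT G.
  apply: (measurableT_comp mFc); apply: measurable_fun_pair.
    exact: measurable_fst.
  exact: (measurableT_comp (measurable_Cn_affine z' c) measurable_snd).
have mG1 := measurable_fun_fubini_tonelli_F (m2 := lebesgue_Cn R n) G
   mG (fun=> F0 _).
rewrite ge0_integralZl//; last by move=> x _; apply: integral_ge0.
rewrite [X in _ * X = _](ge0_integral_complex_affine (z ord0 ord0) c0)//; last first.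
  by move=> x; apply: integral_ge0.
rewrite muleA -EFinM -exprD mulnS addnC; congr (_ * _).
apply: eq_integral => a _; apply: eq_integral => b _.
by rewrite row_cons_affine.
Qed.
End geometry_Cn.

(** * Finiteness of Gaussian integrals *)

Section gaussian_integral.
Variable R : realType.
Local Open Scope ereal_scope.

Local Notation mu := (@lebesgue_measure R).

Lemma integral_prod_lty d1 d2 (T1 : measurableType d1) (T2 : measurableType d2)
    (m1 : {measure set T1 -> \bar R}) (m2 : {measure set T2 -> \bar R})
    (g : T1 -> R) (h : T2 -> R) :
  measurable_fun setT g -> measurable_fun setT h ->
  (forall x, 0 <= g x)%R -> (forall x, 0 <= h x)%R ->
  \int[m1]_x (g x)%:E < +oo -> \int[m2]_x (h x)%:E < +oo ->
  \int[m1]_x \int[m2]_y (g x * h y)%:E < +oo.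
Proof.
move=> mg mh g0 h0 goo hoo.
under eq_integral => x _.
  under eq_integral do rewrite EFinM.
  rewrite ge0_integralZl//; last 3 first.
  - exact/measurable_EFinP.
  - by move=> y _; rewrite lee_fin.
  - by rewrite lee_fin.
  over.
rewrite ge0_integralZr//; last 3 first.
- exact/measurable_EFinP.
- by move=> y _; rewrite lee_fin.
- by apply: integral_ge0 => y _; rewrite lee_fin.
by rewrite lte_mul_pinfty// ?ge0_fin_numE//; apply: integral_ge0 => y _;
  rewrite lee_fin.
Qed.

Lemma gauss_integral_lty (s : R) : (0 < s)%R ->
  \int[mu]_x (expR (- s * x ^+ 2))%:E < +oo.
Proof.
move=> s0; have q0 : Num.sqrt s != 0%R by rewrite gt_eqF// sqrtr_gt0.
(* This is the case [s = 1]; the substitution by the factor [sqrt s] carries finiteness over to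
   every [s > 0]. *)
have /integrableP[mg] := @integrableT_gauss R.
set I := (X in X < _); suff -> : I = `|Num.sqrt s|%:E *
    \int[mu]_x (expR (- s * x ^+ 2))%:E.
  apply: contraTlt; rewrite leye_eq => /eqP ->.
  by rewrite gt0_muley ?ltxx// lte_fin normr_gt0.
rewrite /I [LHS](ge0_integral_affine 0 q0)//; last exact: measurableT_comp.
congr (_ * _); apply: eq_integral => x _ /=.
rewrite add0r ger0_norm ?gauss_fun_ge0// /gauss_fun.
by rewrite exprMn sqr_sqrtr ?(ltW s0)// mulNr.
Qed.

Lemma gauss_complex_lty (s : R) : (0 < s)%R ->
  \int[lebesgue_complex R]_x (expR (- s * normc x ^+ 2))%:E < +oo.
Proof.
move=> s0; rewrite ge0_integral_complex//; last 1 first.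
- apply/measurable_EFinP; apply: measurableT_comp => //.
  apply: measurable_funM => //; apply: measurable_funX.
  exact: measurable_fun_normc.
under eq_integral => x _.
  under eq_integral do rewrite normc_sqrE /= mulrDr expRD.
  over.
apply: integral_prod_lty; try exact: gauss_integral_lty;
  try (by move=> ?; exact: expR_ge0);
  by apply: measurableT_comp => //; apply: measurable_funM => //;
     apply: measurable_funX.
Qed.

Lemma measurable_gauss_Cn n (s : R) :
  measurable_fun setT (fun v : 'rV[R[i]]_n => expR (- s * sqnorm v)).
Proof.
apply: measurableT_comp => //; apply: measurable_funM => //.
exact: measurable_sqnorm.
Qed.

Lemma gauss_Cn_lty n (s : R) : (0 < s)%R ->
  \int[lebesgue_Cn R n]_x (expR (- s * sqnorm x))%:E < +oo.
Proof.
move=> s0; elim: n => [|n ih].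
  rewrite /= integral_dirac//; last first.
    by apply/measurable_EFinP; exact: measurable_gauss_Cn.
  by rewrite diracT mul1e ltry.
rewrite ge0_integral_Cn_cons//; last first.
  by apply/measurable_EFinP; exact: measurable_gauss_Cn.
under eq_integral => x _.
  under eq_integral do rewrite sqnorm_cons mulrDr expRD.
  over.
apply: integral_prod_lty; try (by move=> ?; exact: expR_ge0) => //.
- apply: measurableT_comp => //; apply: measurable_funM => //.
  by apply: measurable_funX; exact: measurable_fun_normc.
- exact: measurable_gauss_Cn.
- exact: gauss_complex_lty.
- exact: ih.
Qed.

(** On the ball [1 <= e * e^(-|x|^2)], so the Gaussian integral gives finiteness without any
    computation of volumes. *)
Lemma unit_ball_lty n : lebesgue_Cn R n (unit_ball (n := n)) < +oo.
Proof.
rewrite -(setIT (@unit_ball R n)) -integral_indic//; last exact: measurable_unit_ball.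
apply: le_lt_trans (_ : \int[lebesgue_Cn R n]_x
  ((expR 1)%:E * (expR (- 1 * sqnorm x))%:E) < +oo).
  apply: ge0_le_integral => //.
  - apply/measurable_EFinP; apply: measurable_indic.
    exact: measurable_unit_ball.
  - apply/measurable_EFinP; apply: measurable_funM => //.
    exact: measurable_gauss_Cn.
  - move=> x _; rewrite -EFinM -expRD lee_fin indicE.
    case: (boolP (x \in _)); rewrite ?expR_ge0// inE => xB.
    rewrite -[leLHS]expR0 ler_expR.
    have : (enorm x ^+ 2 <= 1)%R.
      by rewrite expr_le1// ?sqrtr_ge0//; exact: ltW.
    by rewrite /enorm sqr_sqrtr ?sqnorm_ge0// /sqnorm; lra.
rewrite ge0_integralZl//; last first.
  by apply/measurable_EFinP; exact: measurable_gauss_Cn.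
rewrite lte_mul_pinfty ?lee_fin ?expR_ge0// gauss_Cn_lty//.
Qed.

End gaussian_integral.

(** * Polar coordinates *)

Section polar_coordinates.
Variables (R : realType) (n : nat).
Local Open Scope ereal_scope.

Local Notation mu := (@lebesgue_measure R).
Local Notation Cn := 'rV[R[i]]_n.
Local Notation k := ((2 * n)%:R : R).

Definition pos_indic (x : R) : R := \1_(`]0%R, +oo[%classic : set R) x.

(* The indicator of 0 < |u| < e^t; the first factor discards u = 0, where ln is
   conventionally 0. *)
Definition punctured_ball_indic (t : R) (u : Cn) : R :=
  (pos_indic (enorm u) * pos_indic (t - ln (enorm u)))%R.

Lemma pos_indicE (x : R) : pos_indic x = (0 < x)%R%:R.
Proof. by rewrite /pos_indic indicE mem_setE in_itv/= andbT. Qed.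

Lemma measurable_pos_indic : measurable_fun setT pos_indic.
Proof. by apply: measurable_indic; exact: measurable_itv. Qed.

Lemma enormZ (c : R) (u : Cn) : enorm (c%:C *: u) = (`|c| * enorm u)%R.
Proof.
rewrite /enorm -sqrtr_sqr -sqrtrM ?sqr_ge0// mulr_sumr; congr Num.sqrt.
apply: eq_bigr => j _; rewrite !mxE !normc_sqrE complex_ReZ complex_ImZ.
by ring.
Qed.

Lemma punctured_ball_indicZ (t : R) (w : Cn) :
  punctured_ball_indic t ((expR t)%:C *: w) = punctured_ball_indic 0 w.
Proof.
rewrite /punctured_ball_indic enormZ ger0_norm ?expR_ge0// !pos_indicE.
rewrite pmulr_rgt0 ?expR_gt0//; case: ltP => [w0|]; last by rewrite !mul0r.
by rewrite lnM ?posrE ?expR_gt0// expRK opprD addrA subrr.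
Qed.

Lemma punctured_ball_indic0 (t : R) (u : Cn) :
  enorm u = 0%R -> punctured_ball_indic t u = 0%R.
Proof.
by move=> u0; rewrite /punctured_ball_indic u0 pos_indicE ltxx mul0r.
Qed.

Lemma punctured_ball_indic_ge0 (t : R) (u : Cn) :
  (0 <= punctured_ball_indic t u)%R.
Proof. by rewrite mulr_ge0// pos_indicE. Qed.

Section measurability.
Context d (T : measurableType d).
Variables (t : T -> R) (w : T -> Cn).
Hypothesis mt : measurable_fun setT t.
Hypothesis mw : measurable_fun setT w.

Lemma measurable_ln_enorm : measurable_fun setT (fun x => ln (enorm (w x))).
Proof.
by apply: measurableT_comp => //; exact: (measurableT_comp (@measurable_enorm R n)).
Qed.

Lemma measurable_punctured_ball_indic :
  measurable_fun setT (fun x => punctured_ball_indic (t x) (w x)).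
Proof.
apply: measurable_funM; apply: (measurableT_comp measurable_pos_indic).
  exact: (measurableT_comp (@measurable_enorm R n)).
by apply: measurable_funB => //; exact: measurable_ln_enorm.
Qed.

Lemma measurable_Cn_scale :
  measurable_fun setT (fun x => (t x)%:C *: w x : Cn).
Proof.
apply/measurable_fun_rowP => i; under eq_fun do rewrite mxE.
apply: measurable_funMC; first exact: measurable_fun_real_complex.
exact: (measurableT_comp (measurable_coord i)).
Qed.

End measurability.

Lemma measurable_radial_proj_fun d (T : measurableType d) (t : T -> R)
    (w : T -> Cn) : measurable_fun setT t -> measurable_fun setT w ->
  measurable_fun setT (fun x => radial_proj (t x) (w x)).
Proof.
move=> mt mw; apply: measurable_Cn_scale => //; apply: measurable_funM => //.
under eq_fun do rewrite -powR_inv1 ?sqrtr_ge0//.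
apply: (measurableT_comp (measurable_powR _)).
exact: (measurableT_comp (@measurable_enorm R n)).
Qed.

(** For [n > 0] this is [1 / (2n)]. It cancels from both sides later, so only its being positive and
    finite matters. *)
Definition polar_const : \bar R :=
  \int[mu]_t (expR (- k * t) * pos_indic t)%:E.

Lemma integral_expR_tail (a : R) :
  \int[mu]_t (expR (- k * t) * pos_indic (t - a))%:E =
  (expR (- k * a))%:E * polar_const.
Proof.
rewrite (ge0_integral_affine a (oner_neq0 R))//; last 2 first.
- apply/measurable_EFinP; apply: measurable_funM.
    by apply: measurableT_comp => //; apply: measurable_funM.
  apply: (measurableT_comp measurable_pos_indic).
  exact: measurable_funB.
- by move=> t; rewrite lee_fin mulr_ge0 ?expR_ge0// pos_indicE.
rewrite normr1 mul1e -ge0_integralZl//; last 2 first.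
- apply/measurable_EFinP; apply: measurable_funM.
    by apply: measurableT_comp => //; apply: measurable_funM.
  exact: measurable_pos_indic.
- by move=> t _; rewrite lee_fin mulr_ge0 ?expR_ge0// pos_indicE.
apply: eq_integral => t _; rewrite mul1r -EFinM addrAC subrr add0r.
by rewrite mulrDr expRD mulrA.
Qed.

Let measurable_expR_tail : measurable_fun [set: measurableTypeR R]
  (fun t => (expR (- k * t) * pos_indic t)%:E).
Proof.
apply/measurable_EFinP; apply: measurable_funM; last exact: measurable_pos_indic.
by apply: measurableT_comp => //; apply: measurable_funM.
Qed.

Lemma polar_const_gt0 : 0 < polar_const.
Proof.
apply: lt_le_trans (_ : \int[mu]_t ((expR (- k))%:E *
    (\1_(`]0%R, 1%R]%classic : set R) t)%:E) <= _)%E.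
  rewrite ge0_integralZl//; last first.
    by apply/measurable_EFinP; apply: measurable_indic; exact: measurable_itv.
  rewrite integral_indic//= setIT lebesgue_measure_itv/= lte_fin ltr01.
  by rewrite oppr0 adde0 mule1 lte_fin expR_gt0.
apply: ge0_le_integral => //.
  apply/measurable_EFinP; apply: measurable_funM => //.
move=> t _; rewrite -EFinM lee_fin pos_indicE indicE mem_setE in_itv/=.
case: ltP => t0 /=; last by rewrite mulr0.
case: (boolP (t <= 1)%R) => t1; last by rewrite mulr0 mulr1 expR_ge0.
by rewrite !mulr1 ler_expR mulNr lerN2 ler_piMr.
Qed.

Lemma polar_const_lty : (0 < n)%N -> polar_const < +oo.
Proof.
move=> n0; have k0 : (0 < k)%R by rewrite ltr0n muln_gt0.
apply: le_lt_trans (_ : \int[mu]_t ((k^-1)%:E * (exponential_pdf k t)%:E) < _).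
  apply: ge0_le_integral => //.
  - by move=> t _; rewrite lee_fin mulr_ge0 ?expR_ge0// pos_indicE.
  - apply/measurable_EFinP; apply: measurable_funM => //.
    exact: measurable_exponential_pdf.
  move=> t _; rewrite -EFinM lee_fin pos_indicE.
  case: ltP => t0; last by rewrite mulr0 mulr_ge0 ?invr_ge0 ?exponential_pdf_ge0// ltW.
  by rewrite exponential_pdfE ?(ltW t0)// mulrA mulVf ?gt_eqF// mul1r mulr1.
rewrite ge0_integralZl//.
- by rewrite integral_exponential_pdf// mule1 ltry.
- by apply/measurable_EFinP; exact: measurable_exponential_pdf.
- by move=> t _; rewrite lee_fin exponential_pdf_ge0// ltW.
Qed.

(* Writing u = e^t w/|w|: translate t by ln|w|, rescale w by e^t, and integrate
   t out; each step is Tonelli plus an affine change of variables. *)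
Lemma polar_integral (F : Cn -> \bar R) :
  measurable_fun setT F -> (forall x, 0 <= F x) ->
  \int[mu]_t ((expR (k * t))%:E * \int[lebesgue_Cn R n]_w
    ((punctured_ball_indic 0 w)%:E * F (radial_proj (expR t) w))) =
  polar_const * \int[lebesgue_Cn R n]_u ((pos_indic (enorm u))%:E * F u).
Proof.
move=> mF F0.
set lam := lebesgue_Cn R n.
have chi0 := punctured_ball_indic_ge0.
have mscale : measurable_fun [set: measurableTypeR R * Cn]
    (fun p => (expR p.1)%:C *: p.2).
  by apply: measurable_Cn_scale => //; apply: measurableT_comp.
have mfst : measurable_fun [set: measurableTypeR R * Cn] fst by [].
have msnd : measurable_fun [set: measurableTypeR R * Cn] snd by [].
pose H1 (p : measurableTypeR R * Cn) := (expR (k * p.1) *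
   punctured_ball_indic 0 p.2)%:E * F (radial_proj (expR p.1) p.2).
have H10 p : 0 <= H1 p by rewrite mule_ge0// lee_fin mulr_ge0 ?expR_ge0.
have mH1 : measurable_fun setT H1.
  apply: emeasurable_funM.
    apply/measurable_EFinP; apply: measurable_funM.
      by apply: measurableT_comp => //; apply: measurable_funM.
    exact: measurable_punctured_ball_indic.
  apply: (measurableT_comp mF); apply: measurable_radial_proj_fun => //.
  exact: measurableT_comp.
pose H2 (p : measurableTypeR R * Cn) := (expR (k * (ln (enorm p.2) + p.1)) *
   punctured_ball_indic 0 p.2)%:E * F ((expR p.1)%:C *: p.2).
have H20 p : 0 <= H2 p by rewrite mule_ge0// lee_fin mulr_ge0 ?expR_ge0.
have mH2 : measurable_fun setT H2.
  apply: emeasurable_funM; last exact: (measurableT_comp mF).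
  apply/measurable_EFinP; apply: measurable_funM.
    apply: measurableT_comp => //; apply: measurable_funM => //.
    by apply: measurable_funD => //; exact: measurable_ln_enorm.
  exact: measurable_punctured_ball_indic.
pose G (t : R) (u : Cn) :=
  (expR (k * ln (enorm u)) * punctured_ball_indic t u)%:E * F u.
have G0 t u : 0 <= G t u by rewrite mule_ge0// lee_fin mulr_ge0 ?expR_ge0.
have mG : measurable_fun [set: measurableTypeR R * Cn] (fun p => G p.1 p.2).
  apply: emeasurable_funM; last exact: (measurableT_comp mF).
  apply/measurable_EFinP; apply: measurable_funM.
    apply: measurableT_comp => //; apply: measurable_funM => //.
    exact: measurable_ln_enorm.
  exact: measurable_punctured_ball_indic.
have mGt t : measurable_fun setT (G t).
  exact: (measurableT_comp mG (pair1_measurable (t : measurableTypeR R))).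
pose H3 (p : measurableTypeR R * Cn) := (expR (- k * p.1))%:E * G p.1 p.2.
have H30 p : 0 <= H3 p by rewrite mule_ge0// lee_fin expR_ge0.
have mH3 : measurable_fun setT H3.
  apply: emeasurable_funM => //; apply/measurable_EFinP.
  by apply: measurableT_comp => //; apply: measurable_funM.
transitivity (\int[mu]_t \int[lam]_w H1 (t, w)).
  apply: eq_integral => t _; rewrite -ge0_integralZl//.
  - by apply: eq_integral => w _; rewrite /H1 /= EFinM muleA.
  - apply: emeasurable_funM.
      by apply/measurable_EFinP; exact: measurable_punctured_ball_indic.
    exact: (measurableT_comp mF (measurable_radial_proj _)).
  - by move=> w _; rewrite mule_ge0// lee_fin.
rewrite fubini_tonelli//.
transitivity (\int[lam]_w \int[mu]_t H2 (t, w)).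
  apply: eq_integral => w _.
  rewrite [LHS](ge0_integral_affine (ln (enorm w)) (oner_neq0 R))//; last first.
    exact: (measurableT_comp mH1 (pair2_measurable w)).
  rewrite normr1 mul1e; apply: eq_integral => t _; rewrite /H1 /H2 /= mul1r.
  have [w0|w0] := eqVneq (enorm w) 0%R.
    by rewrite punctured_ball_indic0// mulr0 !mul0e.
  rewrite /radial_proj expRD lnK; last by rewrite posrE lt0r w0 sqrtr_ge0.
  by rewrite mulrAC divff// mul1r.
rewrite -fubini_tonelli//.
(* Substitute [u = e^t w]: the Jacobian [e^(2nt)] cancels the factor [e^(-2nt)] in [H3], and the
   punctured ball of radius [e^t] becomes the punctured unit ball. *)
transitivity (\int[mu]_t \int[lam]_u H3 (t, u)).
  apply: eq_integral => t _; rewrite /H3 /= [RHS]ge0_integralZl//.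
  rewrite [X in _ = _ * X](ge0_integral_Cn_affine 0 (c := expR t))//;
    last by rewrite gt_eqF ?expR_gt0.
  rewrite muleA -EFinM ger0_norm ?expR_ge0// -expRM_natl -expRD mulNr addNr.
  rewrite expR0 mul1e; apply: eq_integral => w _.
  rewrite add0r /G /H2 /= punctured_ball_indicZ.
  have [w0|w0] := eqVneq (enorm w) 0%R.
    by rewrite punctured_ball_indic0// !mulr0 !mul0e.
  rewrite enormZ ger0_norm ?expR_ge0// lnM ?posrE ?expR_gt0// ?lt0r ?w0 ?sqrtr_ge0//.
  by rewrite expRK addrC.
have mpos : measurable_fun setT (fun u : Cn => (pos_indic (enorm u))%:E * F u).
  apply: emeasurable_funM => //; apply/measurable_EFinP.
  exact: (measurableT_comp measurable_pos_indic (@measurable_enorm R n)).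
have pos0 (u : Cn) : 0 <= (pos_indic (enorm u))%:E * F u.
  by rewrite mule_ge0// lee_fin pos_indicE.
rewrite fubini_tonelli// -ge0_integralZl//; last exact: ltW polar_const_gt0.
apply: eq_integral => u _.
transitivity (\int[mu]_t ((expR (k * ln (enorm u)))%:E *
   ((pos_indic (enorm u))%:E * F u) *
   (expR (- k * t) * pos_indic (t - ln (enorm u)))%:E)).
  apply: eq_integral => t _; rewrite /H3 /G /punctured_ball_indic /=.
  rewrite (muleA _ _ (F u)) -EFinM (muleA _ _ (F u)) -EFinM muleAC -EFinM.
  by congr (_%:E * _); ring.
have mtail : measurable_fun [set: measurableTypeR R] (fun t : measurableTypeR R =>
    (expR (- k * t) * pos_indic (t - ln (enorm u)))%:E).
  apply/measurable_EFinP; apply: measurable_funM.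
    by apply: measurableT_comp => //; apply: measurable_funM.
  by apply: (measurableT_comp measurable_pos_indic); exact: measurable_funB.
rewrite ge0_integralZl//; last 2 first.
- by move=> t _; rewrite lee_fin mulr_ge0 ?expR_ge0// pos_indicE.
- by rewrite mule_ge0// lee_fin expR_ge0.
(* Integrating [e^(-2nt)] over [t > ln|u|] yields [e^(-2n ln|u|)] times the constant, which cancels
   the density [e^(2n ln|u|)]. *)
rewrite integral_expR_tail.
rewrite muleC -!muleA (muleCA polar_const) !muleA -EFinM -expRD mulNr addNr.
by rewrite expR0 mul1e -muleA muleC.
Qed.

End polar_coordinates.

Lemma ge0_integral_mrestr d (T : measurableType d) (R : realType)
    (m : {measure set T -> \bar R}) (B D : set T) (mB : measurable B)
    (h : T -> \bar R) :
  measurable D -> measurable_fun D h -> (forall x, D x -> (0 <= h x)%E) ->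
  (\int[mrestr m mB]_(x in D) h x = \int[m]_(x in D `&` B) h x)%E.
Proof.
move=> mD mh h0; rewrite [LHS](ge0_negligible_integral (measurableC mB))//.
  rewrite setDE setCK; apply: eq_measure_integral => A mA AD.
  by rewrite /= /mrestr setIidl// => x /AD[].
by rewrite /= /mrestr setICl measure0.
Qed.

(** * From spherical integrals to Gaussian integrals *)

Section sphere_to_space.
Variables (R : realType) (n : nat).
Local Open Scope ereal_scope.

Local Notation mu := (@lebesgue_measure R).
Local Notation Cn := 'rV[R[i]]_n.
Local Notation lam := (lebesgue_Cn R n).

Lemma enorm_sqr (w : Cn) : (enorm w ^+ 2 = sqnorm w)%R.
Proof. by rewrite /enorm sqr_sqrtr ?sqnorm_ge0. Qed.

Lemma enorm_radial_proj (r : R) (w : Cn) :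
  (0 < r)%R -> enorm (radial_proj r w) = if enorm w == 0%R then 0%R else r.
Proof.
move=> r0; rewrite /radial_proj enormZ normrM (gtr0_norm r0).
rewrite ger0_norm ?invr_ge0 ?sqrtr_ge0//; case: eqP => [->|/eqP w0].
  by rewrite mulr0.
by rewrite divfK.
Qed.

(** This set is invariant under dilation by 2, so its measure [x] satisfies [x = 2^(2n) x]; it lies
    in the unit ball, so [x] is finite and hence 0. *)
Lemma negligible_enorm0 : (0 < n)%N -> lam [set w : Cn | enorm w = 0%R] = 0.
Proof.
move=> n0; set Z := [set w | _].
have mZ : measurable Z.
  rewrite (_ : Z = setT `&` @enorm R n @^-1` [set 0%R]).
    by apply: measurable_enorm.
  by rewrite setTI.
have Zoo : lam Z < +oo.
  apply: le_lt_trans (unit_ball_lty R n); apply: le_measure; rewrite ?inE//.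
    exact: measurable_unit_ball.
  by move=> w; rewrite /Z /unit_ball /= => ->.
have : \int[lam]_w (\1_Z w)%:E = (2 ^+ (2 * n))%:E * \int[lam]_w (\1_Z w)%:E.
  rewrite [LHS](ge0_integral_Cn_affine 0 (c := 2))//; last first.
    by apply/measurable_EFinP; exact: measurable_indic.
  rewrite ger0_norm//; congr (_ * _); apply: eq_integral => w _.
  rewrite add0r !indicE; congr ((nat_of_bool _)%:R%:E).
  apply/idP/idP; rewrite !inE /Z /= enormZ ger0_norm//; last by move=> ->; rewrite mulr0.
  by move/eqP; rewrite mulf_eq0 pnatr_eq0/= => /eqP.
rewrite integral_indic// setIT.
suff H (x : \bar R) : 0 <= x -> x < +oo -> x = (2 ^+ (2 * n))%:E * x -> x = 0.
  exact: H.
case: x => [x _ _|//|//].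
rewrite -EFinM => -[] /eqP.
rewrite -subr_eq0 -{1}(mul1r x) -mulrBl mulf_eq0 => /orP[|/eqP ->//].
rewrite subr_eq0 eq_sym pexprn_eq1 ?muln_eq0 ?gtn_eqF//=.
by rewrite -[1%R]/(1%:R)%R eqr_nat.
Qed.

Lemma pos_indic_integral (F : Cn -> \bar R) : (0 < n)%N ->
  measurable_fun setT F -> (forall x, 0 <= F x) ->
  \int[lam]_u ((pos_indic (enorm u))%:E * F u) = \int[lam]_u F u.
Proof.
move=> n0 mF F0; apply: ge0_ae_eq_integral => //.
- apply: emeasurable_funM => //; apply/measurable_EFinP.
  exact: (measurableT_comp (@measurable_pos_indic R) (@measurable_enorm R n)).
- by move=> u _; rewrite mule_ge0// lee_fin pos_indicE.
apply: (@negligibleS _ _ _ _ [set w : Cn | enorm w = 0%R]); last first.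
  apply/negligibleP; last exact: negligible_enorm0.
  rewrite (_ : [set w | _] = setT `&` @enorm R n @^-1` [set 0%R]).
    by apply: measurable_enorm.
  by rewrite setTI.
move=> u /= /not_implyP[_]; rewrite pos_indicE.
have := sqrtr_ge0 (\sum_(j < n) normc (u ord0 j) ^+ 2)%R.
rewrite -/(enorm u) le_eqVlt => /orP[/eqP ->//|->].
by rewrite mul1e.
Qed.

(** Unfolds the cone definition of the sphere measure. Projection sends every nonzero [w] to the
    sphere but 0 to 0, which is off the sphere because [r > 0]; hence the punctured ball. *)
Lemma sphere_integralE (r : R) (h : Cn -> \bar R) : (0 < r)%R ->
  measurable_fun setT h -> (forall w, 0 <= h w) ->
  \int[sphere_measure n r]_(w in sphere r) h w =
  ((fine (lam (unit_ball (n := n))))^-1)%:E *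
  \int[lam]_w ((punctured_ball_indic 0 w)%:E * h (radial_proj r w)).
Proof.
move=> r0 mh h0.
have msph : measurable (sphere r : set Cn).
  rewrite (_ : sphere r = setT `&` @enorm R n @^-1` [set r]).
    by apply: measurable_enorm.
  by rewrite setTI.
have mproj := @measurable_radial_proj R n r.
have mhp : measurable_fun setT (h \o @radial_proj R n r).
  exact: measurableT_comp.
have mD : measurable (@radial_proj R n r @^-1` sphere r).
  by rewrite -[X in measurable X]setTI; exact: mproj.
rewrite ge0_integral_pushforward//; last exact: measurable_funTS.
rewrite ge0_integral_mscale//; last 2 first.
- exact: measurable_funTS.
- by move=> w _; exact: h0.
congr (_ * _).
rewrite ge0_integral_mrestr//; last 2 first.
- exact: measurable_funTS.
- by move=> w _; exact: h0.
rewrite integral_mkcond; apply: eq_integral => w _ /=.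
rewrite patchE /punctured_ball_indic !pos_indicE sub0r oppr_gt0.
have := sqrtr_ge0 (\sum_(j < n) normc (w ord0 j) ^+ 2)%R.
rewrite -/(enorm w) le_eqVlt => /orP[/eqP w0|w0].
  rewrite -w0 ltxx mul0r mul0e memNset// => -[].
  rewrite /sphere /= enorm_radial_proj// -w0 eqxx => r00.
  by rewrite r00 ltxx in r0.
rewrite w0 mul1r; have -> : (w \in @radial_proj R n r @^-1` sphere r `&`
    unit_ball (n := n)) = (enorm w < 1)%R.
  apply/idP/idP; first by rewrite inE => -[].
  by rewrite inE => w1; split => //; rewrite /sphere /= enorm_radial_proj// gt_eqF.
have -> : (ln (enorm w) < 0)%R = (enorm w < 1)%R.
  by rewrite -ln1 ltr_ln ?posrE.
by case: ifP; rewrite ?mul1e ?mul0e.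
Qed.

(* The Gaussian weight is constant on each sphere, so the polar formula turns
   the vanishing of all spherical integrals into the vanishing of the Gaussian
   integral; positive and negative parts are handled by Tonelli, the integrals
   over almost every sphere being finite. *)
Lemma gauss_integral_eq0 (s : R) (g : Cn -> R) : (0 < n)%N ->
  measurable_fun setT g ->
  \int[lam]_w (`|g w| * expR (- s * sqnorm w))%:E < +oo ->
  (forall r, 0 < r -> \int[sphere_measure n r]_(w in sphere r) g w = 0)%R ->
  \int[lam]_w (g w * expR (- s * sqnorm w))%:E = 0.
Proof.
move=> n0 mg goo g0.
pose E (w : Cn) := expR (- s * sqnorm w).
have E0 w : 0 <= (E w)%:E by rewrite lee_fin expR_ge0.
have mE : measurable_fun setT (fun w => (E w)%:E).
  apply/measurable_EFinP; exact: measurable_gauss_Cn.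
pose h := EFin \o g.
have mh : measurable_fun setT h by exact/measurable_EFinP.
pose J (h : Cn -> \bar R) (t : R) := \int[lam]_w
    ((punctured_ball_indic 0 w)%:E * h (radial_proj (expR t) w)).
have mJ (k : Cn -> \bar R) (t : R) : measurable_fun setT k ->
    measurable_fun setT
      (fun w : Cn => (punctured_ball_indic 0 w)%:E * k (radial_proj (expR t) w)).
  move=> mk; apply: emeasurable_funM.
    by apply/measurable_EFinP; exact: measurable_punctured_ball_indic.
  exact: (measurableT_comp mk (measurable_radial_proj _)).
have J0 (k : Cn -> \bar R) t : (forall w, 0 <= k w) -> 0 <= J k t.
  move=> k0; apply: integral_ge0 => w _.
  by rewrite mule_ge0// lee_fin punctured_ball_indic_ge0.
have polarJ (k : Cn -> \bar R) : measurable_fun setT k -> (forall w, 0 <= k w) ->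
    \int[mu]_t ((expR ((2 * n)%:R * t) * expR (- s * expR t ^+ 2))%:E * J k t) =
    polar_const R n * \int[lam]_w (k w * (E w)%:E).
  move=> mk k0.
  have mkE : measurable_fun setT (fun w => k w * (E w)%:E).
    exact: emeasurable_funM.
  have kE0 w : 0 <= k w * (E w)%:E by rewrite mule_ge0.
  rewrite -pos_indic_integral// -polar_integral//.
  apply: eq_integral => t _; rewrite EFinM -muleA; congr (_ * _).
  rewrite /J -ge0_integralZl//; last 2 first.
  - exact: mJ.
  - by move=> w _; rewrite mule_ge0// lee_fin punctured_ball_indic_ge0.
  apply: eq_integral => w _; rewrite muleCA.
  have [w0|w0] := eqVneq (enorm w) 0%R.
    by rewrite punctured_ball_indic0// !mul0e.
  congr (_ * _); rewrite muleC /E -enorm_sqr enorm_radial_proj ?expR_gt0//.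
  by rewrite (negbTE w0).
have mJt (k : Cn -> \bar R) : measurable_fun setT k -> (forall w, 0 <= k w) ->
    measurable_fun [set: measurableTypeR R] (J k).
  move=> mk k0; pose H (p : measurableTypeR R * Cn) :=
    (punctured_ball_indic 0 p.2)%:E * k (radial_proj (expR p.1) p.2).
  apply: (measurable_fun_fubini_tonelli_F (m2 := lam) H).
    apply: emeasurable_funM.
      apply/measurable_EFinP.
      exact: (measurable_punctured_ball_indic (measurable_cst _) measurable_snd).
    apply: (measurableT_comp mk); apply: measurable_radial_proj_fun => //.
    exact: measurableT_comp.
  by move=> p; rewrite /H mule_ge0// lee_fin punctured_ball_indic_ge0.
have mp : measurable_fun setT h^\+ by exact: measurable_funepos.
have mm : measurable_fun setT h^\- by exact: measurable_funeneg.
(* The hypothesis [g0] concerns [fine] of the integral, which is also 0 at infinite values; it is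
   informative only where both parts are finite. *)
have Jeq t : J h^\+ t < +oo -> J h^\- t < +oo -> J h^\+ t = J h^\- t.
  move=> p1 m1.
  have : fine (\int[sphere_measure n (expR t)]_(w in sphere (expR t)) h w) = 0%R.
    by apply: g0; exact: expR_gt0.
  rewrite integralE !sphere_integralE ?expR_gt0//.
  rewrite -/(J _ t) -/(J _ t).
  (* If the ball were null, the normalizing factor would be [0^-1 = 0] and [g0] would say nothing;
     but then both integrals [J] vanish, so positivity of the volume need not be proved. *)
  have [B0|B0] := eqVneq (lam (unit_ball (n := n))) 0.
    have JB0 (k : Cn -> \bar R) : measurable_fun setT k -> (forall w, 0 <= k w) ->
      J k t = 0.
      move=> mk k0; rewrite /J.
      rewrite (ge0_negligible_integral (@measurable_unit_ball R n))//; last 2 first.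
      - exact: mJ.
      - by move=> w _; rewrite mule_ge0// lee_fin punctured_ball_indic_ge0.
      apply: integral0_eq => w [_ /negP wB]; rewrite /punctured_ball_indic.
      rewrite !pos_indicE sub0r oppr_gt0.
      case: ltP => w0; last by rewrite mul0r mul0e.
      by rewrite -ln1 ltr_ln ?posrE// (negbTE wB) mulr0 mul0e.
    by rewrite !JB0.
  have Bgt0 : (0 < fine (lam (unit_ball (n := n))))%R.
    by rewrite fine_gt0// lt0e B0 measure_ge0 unit_ball_lty.
  have := J0 h^\+ t (funepos_ge0 h).
  have := J0 h^\- t (funeneg_ge0 h).
  move: p1 m1; case: (J h^\+ t) => [p _|//|//]; case: (J h^\- t) => [m _ _ _|//|//].
  rewrite -EFinM -EFinB /= -mulrBr => /eqP; rewrite mulf_eq0 invr_eq0 gt_eqF//=.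
  by rewrite subr_eq0 => /eqP ->.
have kE_lty (k : Cn -> \bar R) : measurable_fun setT k -> (forall w, 0 <= k w) ->
    (forall w, k w <= `|g w|%:E) -> \int[lam]_w (k w * (E w)%:E) < +oo.
  move=> mk k0 kg; apply: le_lt_trans goo; apply: ge0_le_integral => //.
  - by move=> w _; rewrite mule_ge0.
  - exact: emeasurable_funM.
  - apply/measurable_EFinP; apply: measurable_funM.
      exact: measurableT_comp.
    exact: measurable_gauss_Cn.
  - by move=> w _; rewrite EFinM lee_wpmul2r.
have hpE : \int[lam]_w (h^\+ w * (E w)%:E) < +oo.
  apply: kE_lty => // w; rewrite funeposE /h /= -EFin_max lee_fin.
  by rewrite ge_max ler_norm normr_ge0.
have hmE : \int[lam]_w (h^\- w * (E w)%:E) < +oo.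
  apply: kE_lty => // w; rewrite funenegE /h /= -EFin_max lee_fin.
  by rewrite ge_max -normrN ler_norm normr_ge0.
pose Q (k : Cn -> \bar R) (t : measurableTypeR R) :=
  (expR ((2 * n)%:R * t) * expR (- s * expR t ^+ 2))%:E * J k t.
have mQ k : measurable_fun setT k -> (forall w, 0 <= k w) -> measurable_fun setT (Q k).
  move=> mk k0; apply: emeasurable_funM; last exact: mJt.
  apply/measurable_EFinP; apply: measurable_funM.
    by apply: measurableT_comp => //; apply: measurable_funM.
  apply: measurableT_comp => //; apply: measurable_funM => //.
  by apply: (@measurable_funX _ _ _ _ expR); exact: measurable_expR.
have Q0 k t : (forall w, 0 <= k w) -> 0 <= Q k t.
  by move=> k0; rewrite mule_ge0 ?J0// lee_fin mulr_ge0 ?expR_ge0.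
have QJ k t : (forall w, 0 <= k w) -> Q k t \is a fin_num -> J k t < +oo.
  move=> k0; rewrite /Q; have := J0 k t k0; case: (J k t) => [x _ _|_|//].
    by rewrite ltry.
  by rewrite gt0_muley// lte_fin mulr_gt0 ?expR_gt0.
have Qfin k : measurable_fun setT k -> (forall w, 0 <= k w) ->
   \int[lam]_w (k w * (E w)%:E) < +oo -> {ae mu, forall t, Q k t \is a fin_num}.
  move=> mk k0 kE.
  have /integrable_ae : mu.-integrable setT (Q k).
    apply/integrableP; split; first exact: mQ.
    under eq_integral do rewrite gee0_abs ?Q0//.
    rewrite polarJ// lte_mul_pinfty ?(ltW (polar_const_gt0 _ _))//.
    by rewrite ge0_fin_numE ?polar_const_lty// ltW// polar_const_gt0.
  by move=> /(_ measurableT); apply: filterS => t; exact.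
have Qeq : \int[mu]_t Q h^\+ t = \int[mu]_t Q h^\- t.
  apply: ge0_ae_eq_integral => //; try exact: mQ; try by move=> *; exact: Q0.
  have := Qfin _ mm (funeneg_ge0 h) hmE.
  have := Qfin _ mp (funepos_ge0 h) hpE.
  apply: filterS2 => t pf mf _; congr (_ * _).
  by apply: Jeq; exact: QJ.
have IE : \int[lam]_w (h^\+ w * (E w)%:E) = \int[lam]_w (h^\- w * (E w)%:E).
  move: Qeq; rewrite !polarJ//.
  have := polar_const_gt0 R n; have := polar_const_lty R n0.
  have : 0 <= \int[lam]_w (h^\+ w * (E w)%:E).
    by apply: integral_ge0 => w _; rewrite mule_ge0.
  have : 0 <= \int[lam]_w (h^\- w * (E w)%:E).
    by apply: integral_ge0 => w _; rewrite mule_ge0.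
  move: hpE hmE; case: (integral _ _ _) => [p _|//|//].
  case: (integral _ _ _) => [m _ _ _|//|//].
  case: (polar_const R n) => [k _|//|//]; rewrite lte_fin => k0.
  rewrite -!EFinM => -[] /eqP; rewrite -subr_eq0 -mulrBr mulf_eq0 gt_eqF//=.
  by rewrite subr_eq0 => /eqP ->.
rewrite integralE.
rewrite [X in X - _](_ : _ = \int[lam]_w (h^\+ w * (E w)%:E)); last first.
  apply: eq_integral => w _; rewrite !funeposE /h /E /= -!EFin_max -EFinM.
  by rewrite maxr_pMl ?expR_ge0// mul0r.
rewrite [X in _ - X](_ : _ = \int[lam]_w (h^\- w * (E w)%:E)); last first.
  apply: eq_integral => w _; rewrite !funenegE /h /E /= -!EFin_max -EFinM.
  by rewrite maxr_pMl ?expR_ge0// mul0r (mulNr (g w)).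
rewrite IE subee// ge0_fin_numE//.
by apply: integral_ge0 => w _; rewrite mule_ge0.
Qed.

End sphere_to_space.

(** * Integrals against the Gaussian weight *)

Section complex_integral.
Variable R : realType.

Lemma normc_triangle (x y : R[i]) : normc (x + y) <= normc x + normc y.
Proof. by rewrite -lecR rmorphD /=; exact: (@ler_normD _ R[i]). Qed.

Lemma normc_opp (x : R[i]) : normc (- x) = normc x.
Proof. by rewrite !normc_sqrt complex_ReN complex_ImN !sqrrN. Qed.

Lemma normcX (x : R[i]) k : normc (x ^+ k) = normc x ^+ k.
Proof.
elim: k => [|k ih]; last by rewrite !exprS normcM ih.
by rewrite !expr0 (normc_real 1) normr1.
Qed.

Lemma normc_conjc (x : R[i]) : normc x^* = normc x.
Proof. by rewrite !normc_sqrt complex_ReJ complex_ImJ sqrrN. Qed.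

Lemma normc_Re (x : R[i]) : `|complex.Re x| <= normc x.
Proof.
by rewrite normc_sqrt -sqrtr_sqr ler_sqrt ?addr_ge0 ?sqr_ge0// lerDl sqr_ge0.
Qed.

Lemma normc_Im (x : R[i]) : `|complex.Im x| <= normc x.
Proof.
by rewrite normc_sqrt -sqrtr_sqr ler_sqrt ?addr_ge0 ?sqr_ge0// lerDr sqr_ge0.
Qed.

Lemma normc_le_ReIm (x : R[i]) : normc x <= `|complex.Re x| + `|complex.Im x|.
Proof.
rewrite normc_sqrt -[leRHS]ger0_norm ?addr_ge0// -sqrtr_sqr ler_sqrt ?sqr_ge0//.
rewrite sqrrD !real_normK ?num_real// lerD2r lerDl.
by rewrite mulrn_wge0// mulr_ge0.
Qed.

Context d (T : measurableType d) (mu : {measure set T -> \bar R}).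
Implicit Types f g : T -> R[i].

Definition cintegrable f := measurable_fun setT f /\
  (\int[mu]_x (normc (f x))%:E < +oo)%E.

Local Notation I f := (cintegral mu setT f).

Lemma cintegrable_le f (g : T -> R) : measurable_fun setT f ->
  measurable_fun setT g -> (\int[mu]_x (g x)%:E < +oo)%E ->
  (forall x, normc (f x) <= g x) -> cintegrable f.
Proof.
move=> mf mg goo fg; split => //; apply: le_lt_trans goo.
apply: ge0_le_integral => //.
- by move=> x _; rewrite lee_fin normc_ge0.
- by apply/measurable_EFinP; exact: measurable_fun_normc.
- exact/measurable_EFinP.
- by move=> x _; rewrite lee_fin.
Qed.

Lemma integrable_le (f : T -> R) (g : T -> R) : measurable_fun setT f ->
  measurable_fun setT g -> (\int[mu]_x (g x)%:E < +oo)%E ->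
  (forall x, `|f x| <= g x) -> mu.-integrable setT (EFin \o f).
Proof.
move=> mf mg goo fg; apply/integrableP; split; first exact/measurable_EFinP.
apply: le_lt_trans goo; apply: ge0_le_integral => //.
- by apply/measurable_EFinP; exact: measurableT_comp.
- exact/measurable_EFinP.
- by move=> x _; rewrite lee_fin.
Qed.

Lemma cintegrable_Re f : cintegrable f ->
  mu.-integrable setT (EFin \o (fun x => complex.Re (f x))).
Proof.
move=> [mf foo]; apply: integrable_le foo _; first exact: measurable_fun_Re.
  exact: measurable_fun_normc.
by move=> x; exact: normc_Re.
Qed.

Lemma cintegrable_Im f : cintegrable f ->
  mu.-integrable setT (EFin \o (fun x => complex.Im (f x))).
Proof.
move=> [mf foo]; apply: integrable_le foo _; first exact: measurable_fun_Im.
  exact: measurable_fun_normc.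
by move=> x; exact: normc_Im.
Qed.

Lemma cintegrable_norm f : cintegrable f ->
  mu.-integrable setT (EFin \o (fun x => normc (f x))).
Proof.
move=> [mf foo]; have mn := measurable_fun_normc mf.
by apply: integrable_le foo _ => // x; rewrite ger0_norm ?normc_ge0.
Qed.

Lemma cintegrableZ f (c : R[i]) : cintegrable f ->
  cintegrable (fun x => c * f x).
Proof.
move=> [mf foo]; split.
  by apply: measurable_funMC => //; exact: measurable_cst.
under eq_integral do rewrite normcM EFinM.
rewrite ge0_integralZl ?lte_mul_pinfty ?lee_fin ?normc_ge0//.
- by apply/measurable_EFinP; exact: measurable_fun_normc.
- by move=> x _; rewrite lee_fin normc_ge0.
Qed.

Lemma cintegralD f g : cintegrable f -> cintegrable g ->
  I (fun x => f x + g x) = I f + I g.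
Proof.
move=> fi gi; apply: eq_complexP => /=.
  under eq_Rintegral do rewrite complex_ReD.
  by apply: RintegralD => //; exact: cintegrable_Re.
under eq_Rintegral do rewrite complex_ImD.
by apply: RintegralD => //; exact: cintegrable_Im.
Qed.

Lemma cintegralZ f (c : R[i]) : cintegrable f ->
  I (fun x => c * f x) = c * I f.
Proof.
move=> fi; have fr := cintegrable_Re fi; have fm := cintegrable_Im fi.
have Zi (a : R) (h : T -> R) : mu.-integrable setT (EFin \o h) ->
    mu.-integrable setT (EFin \o (fun x => a * h x)).
  by move=> hi; rewrite (_ : _ \o _ = fun x => a%:E * (h x)%:E)%E;
    [exact: integrableZl|apply/funext => x /=; rewrite EFinM].
apply: eq_complexP; rewrite ?complex_ReM ?complex_ImM /cintegral /=.
  under eq_Rintegral do rewrite complex_ReM.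
  by rewrite RintegralB ?RintegralZl//; exact: Zi.
under eq_Rintegral do rewrite complex_ImM.
by rewrite RintegralD ?RintegralZl//; exact: Zi.
Qed.

(** Real and imaginary part are bounded separately, whence the factor 2; a sharp constant is of no
    interest here. *)
Lemma normc_cintegral_le f : cintegrable f ->
  normc (I f) <= 2 * \int[mu]_x normc (f x).
Proof.
move=> fi; have fr := cintegrable_Re fi; have fm := cintegrable_Im fi.
have fn := cintegrable_norm fi.
have H (h : T -> R) : mu.-integrable setT (EFin \o h) ->
    (forall x, `|h x| <= normc (f x)) ->
    `|\int[mu]_x h x| <= \int[mu]_x normc (f x).
  move=> hi hf; apply: le_trans (le_normr_Rintegral _ _) _ => //.
  apply: le_Rintegral => //.
  by have := integrable_norm hi.
apply: le_trans (normc_le_ReIm _) _.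
rewrite mulrDl mul1r; apply: lerD; apply: H => // x.
- exact: normc_Re.
- exact: normc_Im.
Qed.

Lemma cintegral_lim_eq0 (u : nat -> T -> R[i]) f (g : T -> R) :
  (forall k, measurable_fun setT (u k)) -> measurable_fun setT f ->
  measurable_fun setT g -> (\int[mu]_x (g x)%:E < +oo)%E ->
  (forall k x, normc (u k x) <= g x) ->
  (forall x, (fun k => normc (u k x - f x)) @ \oo --> 0) ->
  (forall k, I (u k) = 0) -> I f = 0.
Proof.
move=> mu_ mf mg goo ug uf u0.
have gi : mu.-integrable setT (EFin \o g).
  apply: integrable_le goo _ => // x; rewrite ger0_norm//.
  by apply: le_trans (ug 0%N x); exact: normc_ge0.
have H (r : R[i] -> R) :
   (forall h : T -> R[i], measurable_fun setT h -> measurable_fun setT (r \o h)) ->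
   (forall x y, r (x + y) = r x + r y) -> (forall x, r (- x) = - r x) ->
   (forall x, `|r x| <= normc x) ->
   (forall k, \int[mu]_x r (u k x) = 0) -> \int[mu]_x r (f x) = 0.
  move=> mr rD rN rn ru0.
  have mEr (h : T -> R[i]) : measurable_fun setT h ->
      measurable_fun setT (fun x => (r (h x))%:E).
    by move=> mh; apply/measurable_EFinP; exact: mr.
  have := @dominated_convergence _ _ _ mu setT measurableT
    (fun k x => (r (u k x))%:E) (fun x => (r (f x))%:E) (EFin \o g)
    (fun k => mEr _ (mu_ k)) (mEr _ mf).
  case=> //.
  - apply: aeW => x _; apply/fine_cvgP; split; first exact: nearW.
    apply/cvgrPdist_lt => e e0; move/cvgrPdist_lt : (uf x) => /(_ e e0).
    apply: filterS => k; rewrite sub0r normrN ger0_norm ?normc_ge0//.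
    apply: le_lt_trans; rewrite distrC /= -rN -rD.
    exact: rn.
  - by apply: aeW => x k _ /=; rewrite lee_fin; apply: le_trans (ug k x).
  move=> _ _ H; rewrite /Rintegral.
  have E0 : (fun k => \int[mu]_x (r (u k x))%:E)%E = cst (0%R)%:E.
    apply/funext => k; rewrite /cst -(ru0 k) /Rintegral.
    rewrite fineK//; apply: integrable_fin_num => //.
    by apply: integrable_le goo _ => // [|x]; [exact: mr|exact: le_trans (ug k x)].
  move: H; rewrite E0 => /cvg_lim <-//.
  by rewrite lim_cst.
apply: eq_complexP.
- apply: (H (@complex.Re R)) => //.
  + by move=> h mh; exact: measurable_fun_Re.
  + exact: complex_ReD.
  + exact: complex_ReN.
  + exact: normc_Re.
  + by move=> k; have := congr1 (@complex.Re R) (u0 k).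
- apply: (H (@complex.Im R)) => //.
  + by move=> h mh; exact: measurable_fun_Im.
  + exact: complex_ImD.
  + exact: complex_ImN.
  + exact: normc_Im.
  + by move=> k; have := congr1 (@complex.Im R) (u0 k).
Qed.

End complex_integral.

(** * Multipliers integrable against the Gaussian weight *)

Section subgaussian.
Variables (R : realType) (n : nat).
Local Notation Cn := 'rV[R[i]]_n.
Local Notation lam := (lebesgue_Cn R n).
Implicit Types q : Cn -> R[i].

(** The class of multipliers against [f(v) e^(-s|v|^2)]. Asking for every [e > 0] makes it an
    algebra ([e] is halved in a product), with integrability for all [s > 0]; it contains
    polynomials, exponentials of linear forms and Gaussians. *)
Definition subgaussian q := measurable_fun setT q /\
  forall e : R, 0 < e ->
    exists C, forall v, normc (q v) <= C * expR (e * sqnorm v).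

Lemma subgaussian_le q (C c : R) : measurable_fun setT q ->
  (forall v, normc (q v) <= C * expR (c * \sum_(j < n) normc (v ord0 j))) ->
  subgaussian q.
Proof.
move=> mq qC; split=> // e e0.
(* Completing the square in each of the [n] coordinates: [c x <= e x^2 + c^2 / (4 e)], used with
   room to spare. *)
exists (C * expR (n%:R * (c ^+ 2 / e))) => v.
have C0 : 0 <= C.
  have := le_trans (normc_ge0 _) (qC v).
  by rewrite pmulr_lge0// expR_gt0.
apply: le_trans (qC v) _; rewrite -mulrA ler_wpM2l// -expRD ler_expR.
rewrite mulr_sumr /sqnorm mulr_sumr.
rewrite -[n in n%:R]card_ord -sumr_const mulr_suml -big_split/=.
apply: ler_sum => j _; rewrite mul1r.
set x := normc _.
have H1 : 0 <= e * (x - c / (2 * e)) ^+ 2 by rewrite mulr_ge0 ?sqr_ge0// ltW.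
have H2 : 0 <= c ^+ 2 / e by rewrite divr_ge0 ?sqr_ge0// ltW.
have E : e * (x - c / (2 * e)) ^+ 2 = e * x ^+ 2 - c * x + c ^+ 2 / e / 4.
  by field; rewrite gt_eqF.
move: H1; rewrite E; move: (e * x ^+ 2) (c ^+ 2 / e) (c * x) H2 => ? ? ?; lra.
Qed.

Lemma subgaussian_bounded q (C : R) : measurable_fun setT q ->
  (forall v, normc (q v) <= C) -> subgaussian q.
Proof.
move=> mq qC; apply: (@subgaussian_le _ C 0) => // v.
by rewrite mul0r expR0 mulr1.
Qed.

Lemma subgaussian_cst (c : R[i]) : subgaussian (fun=> c).
Proof.
by apply: (@subgaussian_bounded _ (normc c)) => //; exact: measurable_cst.
Qed.

Lemma subgaussianD q1 q2 : subgaussian q1 -> subgaussian q2 ->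
  subgaussian (fun v => q1 v + q2 v).
Proof.
move=> [m1 h1] [m2 h2]; split; first exact: measurable_funDC.
move=> e e0; have [C1 H1] := h1 e e0; have [C2 H2] := h2 e e0.
exists (C1 + C2) => v; apply: le_trans (normc_triangle _ _) _.
by rewrite mulrDl lerD.
Qed.

Lemma subgaussianM q1 q2 : subgaussian q1 -> subgaussian q2 ->
  subgaussian (fun v => q1 v * q2 v).
Proof.
move=> [m1 h1] [m2 h2]; split; first exact: measurable_funMC.
move=> e e0; have e20 : 0 < e / 2 by rewrite divr_gt0.
have [C1 H1] := h1 _ e20; have [C2 H2] := h2 _ e20.
exists (C1 * C2) => v; rewrite normcM {1}(splitr e) mulrDl expRD mulrACA.
by rewrite ler_pM ?normc_ge0.
Qed.

Lemma subgaussianN q : subgaussian q -> subgaussian (fun v => - q v).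
Proof.
move=> hq; under eq_fun do rewrite -mulN1r.
by apply: subgaussianM => //; exact: subgaussian_cst.
Qed.

Lemma subgaussianJ q : subgaussian q -> subgaussian (fun v => (q v)^*).
Proof.
move=> [mq hq]; split; first exact: measurable_fun_conjc.
by move=> e /hq[C H]; exists C => v; rewrite normc_conjc.
Qed.

Lemma subgaussianX q k : subgaussian q -> subgaussian (fun v => q v ^+ k).
Proof.
move=> hq; elim: k => [|k ih]; first exact: subgaussian_cst.
by under eq_fun do rewrite exprS; exact: subgaussianM.
Qed.

Lemma subgaussian_coord (j : 'I_n) : subgaussian (fun v : Cn => v ord0 j).
Proof.
apply: (@subgaussian_le _ 1 1); first exact: measurable_coord.
move=> v; rewrite !mul1r; apply: le_trans (expR_ge1Dx _).
rewrite (bigD1 j)//= addrCA lerDl addr_ge0// sumr_ge0// => i _.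
exact: normc_ge0.
Qed.

Lemma subgaussian_sum (I : eqType) (s : seq I) (h : I -> Cn -> R[i]) :
  (forall i, i \in s -> subgaussian (h i)) ->
  subgaussian (fun v => \sum_(i <- s) h i v).
Proof.
elim: s => [|i s ih] hs.
  by under eq_fun do rewrite big_nil; exact: subgaussian_cst.
under eq_fun do rewrite big_cons; apply: subgaussianD.
  by apply: hs; rewrite mem_head.
by apply: ih => j js; apply: hs; rewrite inE js orbT.
Qed.

Lemma subgaussian_sqnorm : subgaussian (fun v : Cn => (sqnorm v)%:C).
Proof.
rewrite /sqnorm; under eq_fun do rewrite rmorph_sum/=.
apply: subgaussian_sum => j _; under eq_fun do rewrite rmorphXn/=.
apply: subgaussianX; split.
  by apply: measurable_fun_real_complex; apply: measurable_fun_normc;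
    exact: measurable_coord.
move=> e e0; have [_ /(_ _ e0)[C H]] := subgaussian_coord j.
by exists C => v; rewrite normc_real ger0_norm ?normc_ge0.
Qed.

Lemma subgaussian_gauss (s : R) : 0 <= s ->
  subgaussian (fun v : Cn => (expR (- s * sqnorm v))%:C).
Proof.
move=> s0; apply: (@subgaussian_bounded _ 1).
  by apply: measurable_fun_real_complex; exact: measurable_gauss_Cn.
move=> v; rewrite normc_real ger0_norm ?expR_ge0// -expR0 ler_expR.
by rewrite mulNr oppr_le0 mulr_ge0 ?sqnorm_ge0.
Qed.

Variables (p : R) (f : Cn -> R[i]).
Hypotheses (p1 : 1 <= p) (fp : in_Lp p f).

(** Instead of a Hoelder estimate: the integrand is at most [|f|^p] where [|f| > 1], and at most the
    Gaussian elsewhere. *)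
Lemma Lp_gauss_lty (s : R) : 0 < s ->
  (\int[lam]_v (normc (f v) * expR (- s * sqnorm v))%:E < +oo)%E.
Proof.
move=> s0; case: fp => mf; have p0 : 0 < p by exact: lt_le_trans p1.
move=> /(@poweR_lty _ _ p); rewrite poweR_Lnorm ?gt_eqF// => foo.
have mn := measurable_fun_normc mf.
have {}foo : (\int[lam]_v ((normc (f v)) `^ p)%:E < +oo)%E.
  apply: le_lt_trans foo; rewrite le_eqVlt; apply/orP; left; apply/eqP.
  apply: eq_integral => v _; rewrite -poweR_EFin; congr (_ `^ _)%E.
  by rewrite abse_EFin ger0_norm ?normc_ge0.
have mp : measurable_fun setT (fun v : Cn => ((normc (f v)) `^ p)%:E).
  apply/measurable_EFinP; apply: (measurableT_comp (measurable_powR _)) => //.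
have mg : measurable_fun setT (fun v : Cn => (expR (- s * sqnorm v))%:E).
  by apply/measurable_EFinP; exact: measurable_gauss_Cn.
apply: le_lt_trans (_ : \int[lam]_v
   (((normc (f v)) `^ p)%:E + (expR (- s * sqnorm v))%:E) < _)%E.
  apply: ge0_le_integral => //.
  - by move=> v _; rewrite lee_fin mulr_ge0 ?normc_ge0 ?expR_ge0.
  - apply/measurable_EFinP; apply: measurable_funM => //.
    exact: measurable_gauss_Cn.
  - exact: emeasurable_funD.
  move=> v _; rewrite -EFinD lee_fin.
  have E1 : expR (- s * sqnorm v) <= 1.
    by rewrite -expR0 ler_expR mulNr oppr_le0 mulr_ge0 ?sqnorm_ge0// ltW.
  have [f1|f1] := leP (normc (f v)) 1.
    rewrite -[leLHS]add0r lerD ?powR_ge0//.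
    by rewrite ler_piMl ?expR_ge0.
  rewrite -[leLHS]addr0 lerD ?expR_ge0//.
  apply: le_trans (_ : normc (f v) <= _).
    by rewrite ler_piMr ?normc_ge0.
  rewrite -{1}(powRr1 (normc_ge0 (f v))).
  by rewrite ler_powR// ltW.
rewrite ge0_integralD//.
- by rewrite lte_add_pinfty// gauss_Cn_lty.
- by move=> v _; rewrite lee_fin powR_ge0.
Qed.

Definition gauss_weight (s : R) (v : Cn) : R[i] :=
  f v * (expR (- s * sqnorm v))%:C.

Local Notation W := gauss_weight.

Lemma measurable_gauss_weight s : measurable_fun setT (W s).
Proof.
case: fp => mf _; apply: measurable_funMC => //.
by apply: measurable_fun_real_complex; exact: measurable_gauss_Cn.
Qed.

Lemma gauss_weightD (s t : R) v :
  W (s + t) v = W s v * (expR (- t * sqnorm v))%:C.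
Proof. by rewrite /W opprD mulrDl expRD rmorphM mulrA. Qed.

(** Half of the Gaussian absorbs the growth of [q], the other half makes [f] integrable. *)
Lemma cintegrable_weight (s : R) q : 0 < s -> subgaussian q ->
  cintegrable lam (fun v => W s v * q v).
Proof.
move=> s0 [mq hq]; have s20 : 0 < s / 2 by rewrite divr_gt0.
have [C H] := hq _ s20.
have foo := Lp_gauss_lty s20; case: fp => mf _.
have mn := measurable_fun_normc mf.
have C0 : 0 <= C.
  have := le_trans (normc_ge0 _) (H 0).
  by rewrite pmulr_lge0// expR_gt0.
apply: (@cintegrable_le _ _ _ _ _
  (fun v => C * (normc (f v) * expR (- (s / 2) * sqnorm v)))).
- by apply: measurable_funMC => //; exact: measurable_gauss_weight.
- apply: measurable_funM => //; apply: measurable_funM => //.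
  exact: measurable_gauss_Cn.
- under eq_integral do rewrite EFinM.
  rewrite ge0_integralZl//.
  + by rewrite lte_mul_pinfty.
  + apply/measurable_EFinP; apply: measurable_funM => //.
    exact: measurable_gauss_Cn.
  + by move=> v _; rewrite lee_fin mulr_ge0 ?normc_ge0 ?expR_ge0.
- move=> v; rewrite /W !normcM normc_real ger0_norm ?expR_ge0//.
  rewrite mulrCA -mulrA ler_wpM2l ?normc_ge0//.
  rewrite {1}(splitr s) opprD mulrDl expRD -mulrA mulrC ler_wpM2r ?expR_ge0//.
  apply: le_trans (ler_wpM2l (expR_ge0 _) (H v)) _.
  by rewrite mulrCA -expRD mulNr addNr expR0 mulr1.
Qed.

Definition weighted_integral (s : R) q : R[i] :=
  cintegral lam setT (fun v => W s v * q v).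

End subgaussian.

(** * The complex exponential and first-order expansions *)

Section complex_exponential.
Variable R : realType.

Lemma MVT_origin (f df : R -> R) (b : R) :
  (forall x : R, is_derive x 1 f (df x)) ->
  exists2 c : R, `|c| <= `|b| & f b - f 0 = df c * b.
Proof.
move=> fd; have fc : continuous f.
  by move=> x; apply: differentiable_continuous; apply/derivable1_diffP;
    have [] := fd x.
have [b0|/ltW b0] := leP 0 b.
  have [c + ->] := MVT_segment b0 (fun x _ => fd x)
    (continuous_subspaceT fc).
  rewrite in_itv/= => /andP[c0 cb]; exists c; last by rewrite subr0.
  by rewrite !ger0_norm.
have [c + E] := MVT_segment b0 (fun x _ => fd x) (continuous_subspaceT fc).
rewrite in_itv/= => /andP[c0 cb]; exists c.
  by rewrite !ler0_norm// lerN2.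
by rewrite -opprB E sub0r mulrN opprK.
Qed.

Lemma normr_sin_le (b : R) : `|sin b| <= `|b|.
Proof.
have [c _] := MVT_origin b (@is_derive_sin R).
rewrite sin0 subr0 => ->; rewrite normrM ler_piMl//; exact: cos_max.
Qed.

Lemma normr_cosB1_le (b : R) : `|cos b - 1| <= b ^+ 2.
Proof.
have [c cb] := MVT_origin b (@is_derive_cos R).
rewrite cos0 => ->; rewrite mulNr normrN normrM -(real_normK (num_real b)) expr2.
by rewrite ler_wpM2r// (le_trans (normr_sin_le c)).
Qed.

Lemma normr_sinB_le (b : R) : `|sin b - b| <= `|b| ^+ 3.
Proof.
have H (x : R) : is_derive x 1 (fun x : R => sin x - x) (cos x - 1).
  by apply: is_deriveB.
have [c cb] := MVT_origin b H.
rewrite sin0 subr0 subr0 => ->; rewrite normrM exprSr ler_wpM2r//.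
apply: le_trans (normr_cosB1_le c) _.
by rewrite -real_normK ?num_real// lerXn2r ?nnegrE.
Qed.

Lemma normr_expRB1_le (a : R) : `|expR a - 1| <= `|a| * expR `|a|.
Proof.
have [a0|a0] := leP 0 a.
  rewrite !ger0_norm//; last by rewrite subr_ge0 -expR0 ler_expR.
  have := expR_ge1Dx (- a); rewrite expRN => H.
  have e0 := expR_gt0 a.
  have : expR a * (1 - a) <= expR a * (expR a)^-1 by rewrite ler_wpM2l// ltW.
  by rewrite mulfV ?gt_eqF//; lra.
rewrite ltr0_norm; last by rewrite subr_lt0 -[ltRHS]expR0 ltr_expR.
rewrite ltr0_norm// opprB; apply: le_trans (_ : - a <= _).
  by have := expR_ge1Dx a; lra.
by rewrite ler_peMr ?oppr_ge0 ?ltW// -expR0 ltr_expR oppr_gt0.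
Qed.

Lemma normr_expRB1B_le (a : R) : `|expR a - 1 - a| <= a ^+ 2 * expR `|a|.
Proof.
have H1 : 0 <= expR a - 1 - a by have := expR_ge1Dx a; lra.
rewrite ger0_norm//.
have [c cb] := MVT_origin a (@is_derive_expR R).
rewrite expR0 => ->; rewrite -[X in _ - X]mul1r -mulrBl.
apply: le_trans (ler_norm _) _; rewrite normrM.
rewrite -real_normK ?num_real// expr2 -mulrA mulrC ler_wpM2l//.
apply: le_trans (normr_expRB1_le c) _.
by rewrite ler_pM// ?expR_ge0// ler_expR.
Qed.

Definition cexp (w : R[i]) : R[i] :=
  (expR (complex.Re w))%:C * expi (complex.Im w).

Lemma cexp_Re w : complex.Re (cexp w) =
  expR (complex.Re w) * cos (complex.Im w).
Proof. by rewrite complex_ReZ. Qed.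

Lemma cexp_Im w : complex.Im (cexp w) =
  expR (complex.Re w) * sin (complex.Im w).
Proof. by rewrite complex_ImZ. Qed.

Lemma cexp0 : cexp 0 = 1.
Proof.
by apply: eq_complexP; rewrite (cexp_Re, cexp_Im)/= expR0 ?cos0 ?sin0 mul1r.
Qed.

Lemma cexpD w z : cexp (w + z) = cexp w * cexp z.
Proof.
apply: eq_complexP.
  rewrite [RHS]complex_ReM !cexp_Re !cexp_Im complex_ReD complex_ImD.
  by rewrite expRD cosD; ring.
rewrite [RHS]complex_ImM !cexp_Re !cexp_Im complex_ReD complex_ImD.
by rewrite expRD sinD; ring.
Qed.

Lemma cexp_real (a : R) : cexp a%:C = (expR a)%:C.
Proof.
by apply: eq_complexP; rewrite (cexp_Re, cexp_Im)/= ?cos0 ?sin0 ?mulr1 ?mulr0.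
Qed.

Lemma normc_cexp w : normc (cexp w) = expR (complex.Re w).
Proof.
rewrite normc_sqrt cexp_Re cexp_Im !exprMn -mulrDr cos2Dsin2 mulr1 sqrtr_sqr.
by rewrite ger0_norm ?expR_ge0.
Qed.

(** Only the quadratic order of the remainder matters. The growth [e^(2|w|)] is harmless: in the
    application [w] is linear in [v], and the bound is subgaussian. *)
Lemma cexp_taylor2 w :
  normc (cexp w - 1 - w) <= 4 * (normc w ^+ 2 * expR (2 * normc w)).
Proof.
set r := normc w; set a := complex.Re w; set b := complex.Im w.
have r0 : 0 <= r := normc_ge0 w.
have ar : `|a| <= r := normc_Re w.
have br : `|b| <= r := normc_Im w.
have ea : expR a <= expR r by rewrite ler_expR (le_trans (ler_norm _)).
have eaa : expR `|a| <= expR r by rewrite ler_expR.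
have e1 : 1 <= expR r by rewrite -expR0 ler_expR.
have re : r <= expR r by have := expR_ge1Dx r; lra.
have ee : expR (2 * r) = expR r * expR r by rewrite -expRD mulrDl !mul1r.
have b2 : b ^+ 2 <= r ^+ 2 by rewrite -real_normK ?num_real// lerXn2r ?nnegrE.
have a2 : a ^+ 2 <= r ^+ 2 by rewrite -real_normK ?num_real// lerXn2r ?nnegrE.
apply: le_trans (normc_le_ReIm _) _.
rewrite !(complex_ReD, complex_ImD, complex_ReN, complex_ImN) cexp_Re cexp_Im.
rewrite -/a -/b /= subr0.
have U : `|cos b - 1| <= r ^+ 2 by exact: le_trans (normr_cosB1_le b) b2.
have V : `|expR a - 1 - a| <= r ^+ 2 * expR r.
  apply: le_trans (normr_expRB1B_le a) _.
  by rewrite ler_pM ?sqr_ge0 ?expR_ge0.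
have S : `|sin b - b| <= r ^+ 2 * expR r.
  apply: le_trans (normr_sinB_le b) _; rewrite exprSr ler_pM ?exprn_ge0//.
    by rewrite lerXn2r ?nnegrE.
  exact: le_trans br re.
have Z : `|expR a - 1| <= r * expR r.
  apply: le_trans (normr_expRB1_le a) _.
  by rewrite ler_pM ?expR_ge0.
have -> : expR a * cos b - 1 - a = expR a * (cos b - 1) + (expR a - 1 - a) by ring.
have -> : expR a * sin b - b = expR a * (sin b - b) + b * (expR a - 1) by ring.
have rE : r ^+ 2 * expR r <= r ^+ 2 * (expR r * expR r).
  by rewrite ler_wpM2l ?sqr_ge0// ler_peMr ?expR_ge0.
have H1 : `|expR a * (cos b - 1)| <= r ^+ 2 * expR r.
  by rewrite normrM mulrC ler_pM// ger0_norm ?expR_ge0.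
have H2 : `|expR a * (sin b - b)| <= r ^+ 2 * (expR r * expR r).
  by rewrite normrM mulrC mulrA ler_pM// ger0_norm ?expR_ge0.
have H3 : `|b * (expR a - 1)| <= r ^+ 2 * expR r.
  by rewrite normrM expr2 -mulrA ler_pM.
have := ler_normD (expR a * (cos b - 1)) (expR a - 1 - a).
have := ler_normD (expR a * (sin b - b)) (b * (expR a - 1)).
rewrite ee; lra.
Qed.

End complex_exponential.

Section first_order_expansion.
Variable R : realType.
Implicit Types (phi psi : R -> R[i]) (c e : R[i]).

(** A one-sided derivative at 0 with explicit remainder. One side identifies the coefficient [c1],
    and keeps [s + t] above 1/4 when [s] is the parameter that moves. *)
Definition expands1 phi c0 c1 := exists K : R, forall t, 0 < t <= 1 ->
  normc (phi t - c0 - t%:C * c1) <= K * t ^+ 2.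

Lemma expands1_cst c : expands1 (fun=> c) c 0.
Proof.
exists 0 => t _.
by rewrite subrr mulr0 subr0 mul0r (normc_real 0) normr0.
Qed.

Lemma expands1_shift (x : R) : expands1 (fun t => (x + t)%:C) x%:C 1.
Proof.
exists 0 => t _; have -> : (x + t)%:C - x%:C - t%:C * 1 = 0.
  by rewrite rmorphD /=; ring.
by rewrite (normc_real 0) normr0 mul0r.
Qed.

Lemma expands1D phi psi c0 c1 e0 e1 : expands1 phi c0 c1 ->
  expands1 psi e0 e1 -> expands1 (fun t => phi t + psi t) (c0 + e0) (c1 + e1).
Proof.
move=> [K HK] [L HL]; exists (K + L) => t t01.
have -> : phi t + psi t - (c0 + e0) - t%:C * (c1 + e1) =
  (phi t - c0 - t%:C * c1) + (psi t - e0 - t%:C * e1) by ring.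
by apply: le_trans (normc_triangle _ _) _; rewrite mulrDl lerD ?HK ?HL.
Qed.

Lemma expands1M phi psi c0 c1 e0 e1 : expands1 phi c0 c1 ->
  expands1 psi e0 e1 ->
  expands1 (fun t => phi t * psi t) (c0 * e0) (c0 * e1 + c1 * e0).
Proof.
move=> [K HK] [L HL].
exists (K * (L + normc e0 + normc e1) + (normc c0 + normc c1) * L +
        normc c1 * normc e1) => t t01.
have [t0 t1] := andP t01.
have t2 : t ^+ 2 <= 1 by rewrite expr_le1// ltW.
have nt : normc t%:C = t by rewrite normc_real gtr0_norm.
have K0 : 0 <= K.
  by have := le_trans (normc_ge0 _) (HK t t01); rewrite pmulr_lge0 ?exprn_gt0.
have L0 : 0 <= L.
  by have := le_trans (normc_ge0 _) (HL t t01); rewrite pmulr_lge0 ?exprn_gt0.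
have -> : phi t * psi t - c0 * e0 - t%:C * (c0 * e1 + c1 * e0) =
  ((phi t - c0 - t%:C * c1) * psi t +
   (c0 + t%:C * c1) * (psi t - e0 - t%:C * e1)) + t%:C ^+ 2 * (c1 * e1) by ring.
have psib : normc (psi t) <= L + normc e0 + normc e1.
  have -> : psi t = (psi t - e0 - t%:C * e1) + e0 + t%:C * e1 by ring.
  apply: le_trans (normc_triangle _ _) _; apply: lerD.
    apply: le_trans (normc_triangle _ _) _; rewrite lerD2r.
    by apply: le_trans (HL t t01) _; rewrite ler_piMr.
  by rewrite normcM nt ler_piMl ?normc_ge0.
have cb : normc (c0 + t%:C * c1) <= normc c0 + normc c1.
  apply: le_trans (normc_triangle _ _) _; rewrite lerD2l.
  by rewrite normcM nt ler_piMl ?normc_ge0.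
apply: le_trans (normc_triangle _ _) _; rewrite [leRHS]mulrDl; apply: lerD.
  apply: le_trans (normc_triangle _ _) _; rewrite [leRHS]mulrDl; apply: lerD.
    by rewrite normcM mulrAC ler_pM ?normc_ge0// HK.
  by rewrite normcM -mulrA ler_pM ?normc_ge0// HL.
by rewrite normcM normcX nt (normcM c1) mulrC.
Qed.

Lemma expands1X phi c0 c1 d : expands1 phi c0 c1 ->
  expands1 (fun t => phi t ^+ d) (c0 ^+ d) (d%:R * c0 ^+ d.-1 * c1).
Proof.
move=> H; elim: d => [|d ih].
  by rewrite mul0r mul0r; exact: expands1_cst.
have := expands1M H ih.
under eq_fun do rewrite -exprS.
suff -> : d.+1%:R * c0 ^+ d.+1.-1 * c1 =
    c0 * (d%:R * c0 ^+ d.-1 * c1) + c1 * c0 ^+ d by rewrite exprS.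
rewrite /=; case: d {ih} => [|d] /=; first by rewrite expr0; ring.
by rewrite exprS; ring.
Qed.

Lemma expands1_eq0 phi c : (forall t, 0 < t <= 1 -> phi t = 0) ->
  expands1 phi 0 c -> c = 0.
Proof.
move=> phi0 [K HK]; apply: eq0_normc; apply/eqP; rewrite eq_le normc_ge0 andbT.
apply/ler_addgt0Pr => e e0; rewrite add0r.
have KS t : 0 < t <= 1 -> normc c <= K * t.
  move=> t01; have := HK t t01; have [t0 _] := andP t01.
  rewrite phi0// subr0 add0r normc_opp normcM normc_real gtr0_norm//.
  by rewrite expr2 mulrA [leRHS]mulrC ler_pM2l.
have K0 : 0 <= K.
  have := KS 1; rewrite ltr01 lexx mulr1 => /(_ isT).
  by apply: le_trans; exact: normc_ge0.
pose t := Num.min 1 (e / (K + 1)).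
have t0 : 0 < t by rewrite lt_min ltr01 divr_gt0// ltr_wpDl.
apply: le_trans (KS t _) _; first by rewrite t0 ge_min lexx.
apply: le_trans (_ : K * (e / (K + 1)) <= _).
  by rewrite ler_wpM2l// ge_min lexx orbT.
by rewrite mulrCA ler_piMr ?(ltW e0)// ler_pdivrMr ?ltr_wpDl// mul1r lerDl.
Qed.

End first_order_expansion.

Section weighted_integrals.
Variables (R : realType) (n : nat).
Local Notation Cn := 'rV[R[i]]_n.
Local Notation lam := (lebesgue_Cn R n).
Variables (p : R) (f : Cn -> R[i]).
Hypotheses (p1 : 1 <= p) (fp : in_Lp p f).
Implicit Types q g h : Cn -> R[i].

Local Notation W := (gauss_weight f).
Local Notation J := (weighted_integral f).

Lemma weighted_integralD s g h : 0 < s -> subgaussian g -> subgaussian h ->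
  J s (fun v => g v + h v) = J s g + J s h.
Proof.
move=> s0 gs hs; rewrite /J -cintegralD; try exact: (cintegrable_weight p1 fp).
by congr cintegral; apply/funext => v; rewrite mulrDr.
Qed.

Lemma weighted_integralZ s (c : R[i]) g : 0 < s -> subgaussian g ->
  J s (fun v => c * g v) = c * J s g.
Proof.
move=> s0 gs; rewrite /J -cintegralZ; last exact: (cintegrable_weight p1 fp).
by congr cintegral; apply/funext => v; rewrite mulrCA.
Qed.

Lemma weighted_integralB s g h : 0 < s -> subgaussian g -> subgaussian h ->
  J s (fun v => g v - h v) = J s g - J s h.
Proof.
move=> s0 gs hs; rewrite weighted_integralD//; last exact: subgaussianN.
rewrite -[- J s h]mulN1r -weighted_integralZ//; congr (_ + J s _).
by apply/funext => v; rewrite mulN1r.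
Qed.

Lemma weighted_integral_le s (c : R) g h : 0 < s -> subgaussian g ->
  subgaussian h -> (forall v, normc (h v) <= c * normc (g v)) ->
  normc (J s h) <= 2 * (\int[lam]_v normc (W s v * g v)) * c.
Proof.
move=> s0 gs hs hg.
have gi := cintegrable_weight p1 fp s0 gs.
have hi := cintegrable_weight p1 fp s0 hs.
apply: le_trans (normc_cintegral_le hi) _.
rewrite -mulrA ler_pM2l// mulrC -RintegralZl//; last exact: cintegrable_norm.
apply: le_Rintegral => //.
- exact: cintegrable_norm.
- rewrite (_ : _ \o _ = (fun v => c%:E * (normc (W s v * g v))%:E)%E).
    by apply: integrableZl => //; exact: cintegrable_norm.
  by apply/funext => v /=; rewrite EFinM.
- move=> v _; rewrite !(normcM (W s v)) mulrCA.
  by rewrite ler_wpM2l ?normc_ge0.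
Qed.

(** Takes the place of differentiation under the integral sign: the pointwise remainder is [t^2]
    times a fixed subgaussian function, so it can simply be integrated. *)
Lemma weighted_integral_expands (s : R) (phi : R -> Cn -> R[i])
    (phi0 phi1 g : Cn -> R[i]) : 0 < s ->
  (forall t, 0 < t <= 1 -> subgaussian (phi t)) -> subgaussian phi0 ->
  subgaussian phi1 -> subgaussian g ->
  (forall t v, 0 < t <= 1 ->
     normc (phi t v - phi0 v - t%:C * phi1 v) <= t ^+ 2 * normc (g v)) ->
  expands1 (fun t => J s (phi t)) (J s phi0) (J s phi1).
Proof.
move=> s0 sphi sphi0 sphi1 sg H.
exists (2 * (\int[lam]_v normc (W s v * g v))) => t t01.
have sZ : subgaussian (fun v => t%:C * phi1 v).
  by apply: subgaussianM => //; exact: subgaussian_cst.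
have sB : subgaussian (fun v => phi t v - phi0 v).
  by apply: subgaussianD; [exact: sphi|exact: subgaussianN].
rewrite -weighted_integralZ// -weighted_integralB//; last exact: sphi.
rewrite -weighted_integralB//; apply: weighted_integral_le => //.
  by apply: subgaussianD => //; exact: subgaussianN.
by move=> v; exact: H.
Qed.

Lemma gauss_taylor (u : R) : 0 <= u -> `|expR (- u) - 1 + u| <= u ^+ 2.
Proof.
move=> u0; have H1 := expR_ge1Dx (- u); have H2 := expR_ge1Dx u.
have H3 : (1 + u) * expR (- u) <= 1.
  by rewrite expRN ler_pdivrMr ?expR_gt0// mul1r.
rewrite ger0_norm; last by lra.
nra.
Qed.

(** Moving [s] to [s + t] multiplies the integrand by [e^(-t|v|^2)], whose second-order remainder is
    at most [t^2 |v|^4]. *)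
Lemma weighted_integral_expands_param (s : R) g : 0 < s -> subgaussian g ->
  expands1 (fun t => J (s + t) g) (J s g)
    (- J s (fun v => (sqnorm v)%:C * g v)).
Proof.
move=> s0 sg; have sn := @subgaussian_sqnorm R n.
have -> : (fun t => J (s + t) g) =
    (fun t => J s (fun v => (expR (- t * sqnorm v))%:C * g v)).
  apply/funext => t; congr cintegral; apply/funext => v.
  by rewrite gauss_weightD mulrA.
rewrite -mulN1r -weighted_integralZ//; last exact: subgaussianM.
apply: (@weighted_integral_expands _ _ _ _
  (fun v => (sqnorm v)%:C ^+ 2 * g v)) => //.
- move=> t /andP[t0 _]; apply: subgaussianM => //.
  by apply: subgaussian_gauss; exact: ltW.
- by apply: subgaussianM; [exact: subgaussian_cst|exact: subgaussianM].
- by apply: subgaussianM => //; exact: subgaussianX.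
move=> t v /andP[t0 t1].
have -> : (expR (- t * sqnorm v))%:C * g v - g v -
    t%:C * (-1 * ((sqnorm v)%:C * g v)) =
  (expR (- (t * sqnorm v)) - 1 + t * sqnorm v)%:C * g v.
  rewrite (mulNr t); move: (expR _) => E.
  have -> : (E - 1 + t * sqnorm v)%:C = E%:C - 1 + t%:C * (sqnorm v)%:C.
    by rewrite rmorphD rmorphB rmorphM.
  by ring.
rewrite normcM (normcM (_ ^+ 2)) normcX mulrA ler_wpM2r ?normc_ge0//.
rewrite !normc_real.
rewrite real_normK ?num_real// -exprMn.
by apply: gauss_taylor; rewrite mulr_ge0 ?sqnorm_ge0// ltW.
Qed.

End weighted_integrals.

(** * Annihilated exponentials and their derivatives *)

Section linear_exponents.
Variables (R : realType) (n : nat).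
Local Notation Cn := 'rV[R[i]]_n.

(* Up to the factor e^(-s|z|^2), e^(-s|z-v|^2) times the twist in z, v is
   e^(-s|v|^2) times the exponential of this form with x = s - 1/4, y = s + 1/4
   (gauss_twisted_form). *)
Definition twisted_form (x y : R) (z v : Cn) : R[i] :=
  x%:C * hermdot z v + y%:C * conjc (hermdot z v).

Lemma hermdotDZ (z a v : Cn) (t : R[i]) :
  hermdot (z + t *: a) v = hermdot z v + t * hermdot a v.
Proof.
rewrite /hermdot mulr_sumr -big_split/=; apply: eq_bigr => j _.
by rewrite !mxE mulrDl mulrA.
Qed.

Lemma conjcDZ (t : R) (a b : R[i]) :
  conjc (a + t%:C * b) = conjc a + t%:C * conjc b.
Proof.
by apply: eq_complexP; rewrite !(complex_ReD, complex_ImD, complex_ReJ,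
  complex_ImJ, complex_ReZ, complex_ImZ) ?opprD ?mulrN.
Qed.

Lemma twisted_formDZ (x y t : R) (z a v : Cn) :
  twisted_form x y (z + t%:C *: a) v =
  twisted_form x y z v + t%:C * twisted_form x y a v.
Proof.
rewrite /twisted_form hermdotDZ.
rewrite conjcDZ; move: (conjc _) (conjc _) => u w; ring.
Qed.

Lemma subgaussian_hermdot (z : Cn) : subgaussian (hermdot z).
Proof.
apply: subgaussian_sum => j _; apply: subgaussianM.
  exact: subgaussian_cst.
by apply: subgaussianJ; exact: subgaussian_coord.
Qed.

Lemma subgaussian_twisted_form (x y : R) (z : Cn) :
  subgaussian (twisted_form x y z).
Proof.
have sh := subgaussian_hermdot z.
apply: subgaussianD; apply: subgaussianM; try exact: subgaussian_cst => //.
  by [].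
exact: subgaussianJ.
Qed.

Lemma normc_sum (I : eqType) (s : seq I) (h : I -> R[i]) :
  normc (\sum_(i <- s) h i) <= \sum_(i <- s) normc (h i).
Proof.
elim: s => [|i s ih]; first by rewrite !big_nil (normc_real 0) normr0.
by rewrite !big_cons; apply: le_trans (normc_triangle _ _) _; rewrite lerD2l.
Qed.

Lemma twisted_form_le (x y : R) (z : Cn) : exists c : R, forall v,
  normc (twisted_form x y z v) <= c * \sum_(j < n) normc (v ord0 j).
Proof.
exists ((`|x| + `|y|) * \sum_(j < n) normc (z ord0 j)) => v.
have H : normc (hermdot z v) <=
    (\sum_(j < n) normc (z ord0 j)) * \sum_(j < n) normc (v ord0 j).
  apply: le_trans (normc_sum _ _) _; rewrite mulr_suml; apply: ler_sum => j _.
  rewrite normcM normc_conjc ler_wpM2l ?normc_ge0// (bigD1 j)//= lerDl.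
  by apply: sumr_ge0 => i _; exact: normc_ge0.
apply: le_trans (normc_triangle _ _) _; rewrite !normcM !normc_real normc_conjc -mulrDl.
by rewrite -mulrA ler_wpM2l ?addr_ge0.
Qed.

Lemma measurable_cexp (h : Cn -> R[i]) : measurable_fun setT h ->
  measurable_fun setT (fun v => cexp (h v)).
Proof.
move=> mh; apply/measurable_fun_complexP; split.
  under eq_fun do rewrite cexp_Re; apply: measurable_funM.
    by apply: measurableT_comp => //; exact: measurable_fun_Re.
  apply: (measurableT_comp (continuous_measurable_fun (@continuous_cos R))).
  exact: measurable_fun_Im.
under eq_fun do rewrite cexp_Im; apply: measurable_funM.
  by apply: measurableT_comp => //; exact: measurable_fun_Re.
apply: (measurableT_comp (continuous_measurable_fun (@continuous_sin R))).
exact: measurable_fun_Im.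
Qed.

Lemma subgaussian_cexp (x y : R) (z : Cn) :
  subgaussian (fun v => cexp (twisted_form x y z v)).
Proof.
have [c hc] := twisted_form_le x y z.
apply: (@subgaussian_le _ _ _ 1 c).
  by apply: measurable_cexp; have [] := subgaussian_twisted_form x y z.
move=> v; rewrite normc_cexp mul1r ler_expR.
by apply: le_trans (hc v); apply: le_trans (ler_norm _) (normc_Re _).
Qed.

Variables (p : R) (f : Cn -> R[i]).
Hypotheses (p1 : 1 <= p) (fp : in_Lp p f).

Local Notation J := (weighted_integral f).

(** [V] collects the points [z] at which the relation is known, and [q] the factors brought down by
    the differentiations made so far. *)
Definition annihilates (s x y : R) (V : set Cn) (q : Cn -> R[i]) :=
  forall z, V z -> J s (fun v => q v * cexp (twisted_form x y z v)) = 0.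

(** The derivative of the relation in [z] along [a]; invariance of [V] under real multiples of [a]
    keeps the whole segment inside [V]. *)
Lemma annihilates_derive (s x y : R) (V : set Cn) (q : Cn -> R[i]) (a : Cn) :
  0 < s -> (forall z t, V z -> V (z + t%:C *: a)) -> subgaussian q ->
  annihilates s x y V q ->
  annihilates s x y V (fun v => q v * twisted_form x y a v).
Proof.
move=> s0 Va sq Kq z Vz; apply: (@expands1_eq0 _ (fun t => J s (fun v =>
    q v * cexp (twisted_form x y (z + t%:C *: a) v)))).
  by move=> t _; exact: Kq (Va z t Vz).
have sz := subgaussian_cexp x y z; have sa := subgaussian_twisted_form x y a.
have [c hc] := twisted_form_le x y a.
(* With [r] the modulus of the form, the Taylor bound [4 r^2 e^(2r)] is at most [4 e^(4r)] because
   [r <= e^r], and [r] is at most [c] times the sum of the moduli. *)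
pose B (v : Cn) : R[i] :=
  (4 * expR (4 * c * \sum_(j < n) normc (v ord0 j)))%:C.
have sB : subgaussian B.
  apply: (@subgaussian_le _ _ _ 4 (4 * c)).
    apply: measurable_fun_real_complex; apply: measurable_funM => //.
    apply: measurableT_comp => //; apply: measurable_funM => //.
    apply: measurable_sum => j; apply: measurable_fun_normc.
    exact: measurable_coord.
  by move=> v; rewrite normc_real ger0_norm// mulr_ge0// expR_ge0.
rewrite -(Kq _ Vz).
apply: (@weighted_integral_expands _ _ _ _ p1 fp _ _ _ _
  (fun v => q v * cexp (twisted_form x y z v) * B v)) => //.
- by move=> t _; apply: subgaussianM => //; exact: subgaussian_cexp.
- exact: subgaussianM.
- by apply: subgaussianM => //; exact: subgaussianM.
- by apply: subgaussianM => //; exact: subgaussianM.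
move=> t v /andP[t0 t1].
set l := twisted_form x y a v; set E := cexp (twisted_form x y z v).
have -> : q v * cexp (twisted_form x y (z + t%:C *: a) v) - q v * E -
    t%:C * (q v * l * E) = q v * E * (cexp (t%:C * l) - 1 - t%:C * l).
  by rewrite twisted_formDZ cexpD -/E -/l; ring.
rewrite (normcM (q v * E)) (normcM (q v * E)) [leRHS]mulrCA.
rewrite ler_wpM2l ?normc_ge0//.
apply: le_trans (cexp_taylor2 _) _.
have nt : normc t%:C = t by rewrite normc_real gtr0_norm.
rewrite normcM nt exprMn /B normc_real.
rewrite ger0_norm; last by rewrite mulr_ge0// expR_ge0.
rewrite [leRHS]mulrCA ler_pM2l// -(mulrA (t ^+ 2)) ler_wpM2l ?sqr_ge0//.
set r := normc l; have r0 : 0 <= r := normc_ge0 l.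
have rE : r <= expR r by have := expR_ge1Dx r; lra.
apply: le_trans (_ : (expR r) ^+ 2 * expR (2 * r) <= _).
  apply: ler_pM; rewrite ?sqr_ge0 ?expR_ge0//.
    by rewrite lerXn2r ?nnegrE ?expR_ge0.
  by rewrite ler_expR ler_pM2l// ler_piMl.
rewrite -expRM_natl -expRD ler_expR -mulrDl -mulrA.
by have := hc v; rewrite -/l -/r; lra.
Qed.

Lemma annihilatesD (s x y : R) (V : set Cn) (q1 q2 : Cn -> R[i]) :
  0 < s -> subgaussian q1 -> subgaussian q2 ->
  annihilates s x y V q1 -> annihilates s x y V q2 ->
  annihilates s x y V (fun v => q1 v + q2 v).
Proof.
move=> s0 h1 h2 K1 K2 z Vz; have sz := subgaussian_cexp x y z.
under [X in J _ X]eq_fun do rewrite mulrDl.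
by rewrite (weighted_integralD p1 fp)// ?K1 ?K2 ?addr0//; exact: subgaussianM.
Qed.

Lemma annihilatesZ (s x y : R) (V : set Cn) (c : R[i]) (q : Cn -> R[i]) :
  0 < s -> subgaussian q -> annihilates s x y V q ->
  annihilates s x y V (fun v => c * q v).
Proof.
move=> s0 h1 K1 z Vz; have sz := subgaussian_cexp x y z.
under [X in J _ X]eq_fun do rewrite -mulrA.
by rewrite (weighted_integralZ p1 fp)// ?K1 ?mulr0//; exact: subgaussianM.
Qed.

End linear_exponents.

(** * Differentiation along C^(n-1) x wR *)

Section moments.
Variables (R : realType) (n : nat) (l : 'I_n).
Local Notation Cn := 'rV[R[i]]_n.
Local Notation I := (0 +i* 1)%C.
Variables (p : R) (f : Cn -> R[i]).
Hypotheses (p1 : 1 <= p) (fp : in_Lp p f).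
Local Notation J := (weighted_integral f).

Inductive monomial_off (l : 'I_n) : (Cn -> R[i]) -> Prop :=
| Monomial1 : monomial_off l (fun=> 1)
| MonomialX j q : j != l -> monomial_off l q ->
    monomial_off l (fun v => q v * v ord0 j)
| MonomialXc j q : j != l -> monomial_off l q ->
    monomial_off l (fun v => q v * conjc (v ord0 j)).

Lemma subgaussian_conj_coord (j : 'I_n) :
  subgaussian (fun v : Cn => conjc (v ord0 j)).
Proof. by apply: subgaussianJ; exact: subgaussian_coord. Qed.

Lemma subgaussian_monomial q : monomial_off l q -> subgaussian q.
Proof.
elim=> [|j {}q _ _ ih|j {}q _ _ ih]; first exact: subgaussian_cst.
- by apply: subgaussianM => //; exact: subgaussian_coord.
- by apply: subgaussianM => //; exact: subgaussian_conj_coord.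
Qed.

Definition line_space (w : R[i]) : set Cn :=
  [set z | exists t : R, z ord0 l = t%:C * w].

Lemma line_spaceD w (a z : Cn) (t : R) : line_space w a -> line_space w z ->
  line_space w (z + t%:C *: a).
Proof.
move=> [u au] [r zr]; exists (r + t * u).
by rewrite !mxE au zr rmorphD rmorphM /= mulrDl mulrA.
Qed.

Definition unit_vec (j : 'I_n) (c : R[i]) : Cn :=
  \row_k (if k == j then c else 0).

Lemma hermdot_unit_vec j c v : hermdot (unit_vec j c) v = c * conjc (v ord0 j).
Proof.
rewrite /hermdot (bigD1 j)//= mxE eqxx big1 ?addr0// => k kj.
by rewrite mxE (negbTE kj) mul0r.
Qed.

Lemma line_space_unit_vec w j c : j != l -> line_space w (unit_vec j c).
Proof. by move=> jl; exists 0; rewrite mxE eq_sym (negbTE jl) mul0r. Qed.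

Lemma mulII : I * I = -1 :> R[i].
Proof. by apply: eq_complexP; rewrite ?complex_ReM ?complex_ImM /=; ring. Qed.

Lemma conjI : conjc I = - I :> R[i].
Proof. by apply: eq_complexP => /=; ring. Qed.

(** The value of [twisted_form x y] at [w e_l], up to real multiples the only direction within
    coordinate [l] along which the line can be differentiated. *)
Definition fock_form (x y : R) (w : R[i]) (v : Cn) : R[i] :=
  x%:C * w * conjc (v ord0 l) + y%:C * conjc w * v ord0 l.

Section fixed_parameter.
Variables (s x y : R) (w : R[i]).
Hypotheses (s0 : 0 < s) (x0 : x != 0) (y0 : y != 0).
Hypothesis H0 : annihilates f s x y (line_space w) (fun=> 1).

Let xC0 : x%:C != 0 :> R[i].
Proof. by rewrite (inj_eq (@complexI R)). Qed.

Let yC0 : y%:C != 0 :> R[i].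
Proof. by rewrite (inj_eq (@complexI R)). Qed.

Lemma twisted_form_unit_vec j c v : twisted_form x y (unit_vec j c) v =
  x%:C * c * conjc (v ord0 j) + y%:C * conjc c * v ord0 j.
Proof.
rewrite /twisted_form hermdot_unit_vec mulrA; congr (_ + _).
rewrite -mulrA; congr (_ * _).
by apply: eq_complexP; rewrite !(complex_ReJ, complex_ImJ, complex_ReM, complex_ImM);
  ring.
Qed.

(** The directions [e_j] and [i e_j] bring down [x conj(v_j) + y v_j] and [i (x conj(v_j) - y v_j)];
    the coefficients [c] and [- i d] then give arbitrary complex combinations. *)
Lemma annihilates_coord q j (c d : R[i]) : j != l -> subgaussian q ->
  annihilates f s x y (line_space w) q -> annihilates f s x y (line_space w)
    (fun v => q v * (c * (x%:C * conjc (v ord0 j) + y%:C * v ord0 j) +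
                     d * (x%:C * conjc (v ord0 j) - y%:C * v ord0 j))).
Proof.
move=> jl sq Kq; pose tf e := fun v : Cn => q v * twisted_form x y (unit_vec j e) v.
have V e z t : line_space w z -> line_space w (z + t%:C *: unit_vec j e).
  by move=> Vz; apply: line_spaceD => //; exact: line_space_unit_vec.
have stf e : subgaussian (tf e).
  by apply: subgaussianM => //; exact: subgaussian_twisted_form.
have Ktf e a : annihilates f s x y (line_space w) (fun v => a * tf e v).
  by apply: (annihilatesZ p1 fp) => //;
    exact: (annihilates_derive p1 fp s0 (V e) sq Kq).
have sZ e a : subgaussian (fun v => a * tf e v).
  by apply: subgaussianM => //; exact: subgaussian_cst.
suff -> : (fun v => q v * (c * (x%:C * conjc (v ord0 j) + y%:C * v ord0 j) +
    d * (x%:C * conjc (v ord0 j) - y%:C * v ord0 j))) =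
    (fun v => c * tf 1 v + - I * d * tf I v) by exact: (annihilatesD p1 fp).
apply/funext => v; rewrite /tf !twisted_form_unit_vec conjI conjc1.
have : I * I = -1 :> R[i] := mulII.
move: I => i ii; move: (conjc _) => u.
have -> : - i * d * (q v * (x%:C * i * u + y%:C * - i * v ord0 j)) =
    - (i * i) * d * (q v * (x%:C * u - y%:C * v ord0 j)) by ring.
by rewrite ii; ring.
Qed.

(** Solving the two combinations for [v_j] and its conjugate divides by [2 y] and [2 x]; this is
    where [x] and [y] must be nonzero. *)
Lemma annihilates_monomial q : monomial_off l q ->
  annihilates f s x y (line_space w) q.
Proof.
elim=> [//|j {}q jl mq ih|j {}q jl mq ih].
  rewrite (_ : (fun v => _) = (fun v => q v *
    ((2 * y%:C)^-1 * (x%:C * conjc (v ord0 j) + y%:C * v ord0 j) +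
    - (2 * y%:C)^-1 * (x%:C * conjc (v ord0 j) - y%:C * v ord0 j)))).
    by apply: annihilates_coord => //; exact: subgaussian_monomial.
  apply/funext => v; move: (conjc _) => u; congr (_ * _).
  by field; rewrite yC0.
rewrite (_ : (fun v => _) = (fun v => q v *
    ((2 * x%:C)^-1 * (x%:C * conjc (v ord0 j) + y%:C * v ord0 j) +
    (2 * x%:C)^-1 * (x%:C * conjc (v ord0 j) - y%:C * v ord0 j)))).
  by apply: annihilates_coord => //; exact: subgaussian_monomial.
apply/funext => v; move: (conjc _) => u; congr (_ * _).
by field; rewrite xC0.
Qed.

Lemma fock_form_integral q d : monomial_off l q ->
  J s (fun v => q v * fock_form x y w v ^+ d) = 0.
Proof.
move=> mq; have sq := subgaussian_monomial mq.
have Fe v : fock_form x y w v = twisted_form x y (unit_vec l w) v.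
  by rewrite twisted_form_unit_vec.
have V z t : line_space w z -> line_space w (z + t%:C *: unit_vec l w).
  by apply: line_spaceD; exists 1; rewrite mxE eqxx mul1r.
have sF := subgaussian_twisted_form x y (unit_vec l w).
rewrite (funext Fe).
have K : annihilates f s x y (line_space w)
    (fun v => q v * twisted_form x y (unit_vec l w) v ^+ d).
  elim: d => [|d ih].
    by under eq_fun do rewrite expr0 mulr1; exact: annihilates_monomial.
  under eq_fun do rewrite exprSr mulrA.
  apply: (annihilates_derive p1 fp s0 V) => //.
  by apply: subgaussianM => //; exact: subgaussianX.
(* At [z = 0] the exponential is 1 and only the polynomial factor remains. *)
have /K : line_space w 0 by exists 0; rewrite mxE mul0r.
under [X in J _ X]eq_fun => v.
  have -> : twisted_form x y 0 v = 0.
    rewrite /twisted_form (_ : hermdot 0 v = 0) ?conjc0 ?mulr0 ?addr0//.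
    by rewrite /hermdot big1// => j _; rewrite mxE mul0r.
  rewrite cexp0 mulr1; over.
by [].
Qed.

End fixed_parameter.
End moments.

(** * Vanishing of the moments *)

(* Here A, B stand for the moments of conj(v_n)^d and v_n^d, M1, M2 for these
   multiplied by |v_n|^2, and M3, M4 for the pure moments of degree d + 2.  The
   relations come from the directions 1 and i, in degrees d and d + 2, and (the
   third one) from differentiating in the Gaussian parameter. *)
Lemma orthogonal_lines_elim (K : numFieldType) (i a b A B M1 M2 M3 M4 : K)
    (d : nat) : (0 < d)%N -> i * i = -1 -> a != 0 -> b != 0 -> a - b != 0 ->
  a ^+ d * A + b ^+ d * B = 0 ->
  (a * i) ^+ d * A + (b * - i) ^+ d * B = 0 ->
  a ^+ d * M1 + b ^+ d * M2 = d%:R * (a ^+ d.-1 * A + b ^+ d.-1 * B) ->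
  a ^+ d.+2 * M3 + (a ^+ d.+1 * b * M1 + a * b ^+ d.+1 * M2) *+ d.+2 +
    b ^+ d.+2 * M4 = 0 ->
  (a * i) ^+ d.+2 * M3 + ((a * i) ^+ d.+1 * (b * - i) * M1 +
    a * i * (b * - i) ^+ d.+1 * M2) *+ d.+2 + (b * - i) ^+ d.+2 * M4 = 0 ->
  a ^+ d * A = 0.
Proof.
move=> d0 ii a0 b0 ab0 R1 RI D1 R3 RI3.
have i0 : i != 0.
  apply/eqP => i0; move: ii; rewrite i0 mul0r => /eqP.
  by rewrite eq_sym oppr_eq0 oner_eq0.
have id0 : i ^+ d != 0 by rewrite expf_eq0 (negbTE i0) andbF.
have {}RI : i ^+ d * (a ^+ d * A + (-1) ^+ d * (b ^+ d * B)) = 0.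
  rewrite -[RHS]RI !exprMn (exprNn i).
  by move: (a ^+ d) (b ^+ d) (i ^+ d) ((-1) ^+ d) => *; ring.
move/eqP: RI; rewrite mulf_eq0 (negbTE id0)/= => /eqP RI.
(* For odd [d] the direction i gives the difference where the direction 1 gives the sum of the same
   two terms, so both terms vanish. *)
have [dodd|deven] := boolP (odd d).
  move: RI; rewrite -signr_odd dodd expr1 mulN1r => /eqP.
  rewrite subr_eq0 => /eqP RI; move: R1; rewrite -RI -mulr2n => /eqP.
  by rewrite mulrn_eq0/= => /eqP.
have s1 : (-1) ^+ d = 1 :> K by rewrite -signr_odd (negbTE deven).
(* For even [d] the two relations of degree [d] coincide. In degree [d + 2], after division by
   [i^d], the pure terms change sign between the directions and [X] does not; adding the relations
   isolates [X]. *)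
have X0 : a ^+ d.+1 * b * M1 + a * b ^+ d.+1 * M2 = 0.
  move: R3 RI3; set X := a ^+ d.+1 * b * M1 + a * b ^+ d.+1 * M2 => R3 RI3.
  have {}RI3 : i ^+ d * (- (a ^+ d.+2 * M3) + X *+ d.+2 - b ^+ d.+2 * M4) = 0.
    have YX : (a * i) ^+ d.+1 * (b * - i) * M1 +
        a * i * (b * - i) ^+ d.+1 * M2 = i ^+ d * X.
      rewrite /X !exprMn (exprNn i) !exprS s1.
      transitivity (- (i * i) * (i ^+ d * (a * a ^+ d * b * M1 + a * (b * b ^+ d) * M2))).
        by move: (a ^+ d) (b ^+ d) (i ^+ d) => *; ring.
      by rewrite ii opprK mul1r.
    rewrite -[RHS]RI3 YX -mulrnAr !exprMn (exprNn i) !exprS s1.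
    rewrite (mulrA i i) ii; move: (a ^+ d) (b ^+ d) (i ^+ d) (X *+ _) => *.
    by ring.
  move/eqP: RI3; rewrite mulf_eq0 (negbTE id0)/= => /eqP RI3.
  have : (X *+ d.+2) *+ 2 = 0.
    rewrite mulr2n -[RHS](addr0 0) -{1}R3 -RI3; move: (X *+ _) => *; ring.
  by move=> /eqP; rewrite !mulrn_eq0/= => /eqP.
(* [X] is [a b] times the left side of [D1], which therefore vanishes too. *)
have Y0 : a ^+ d * M1 + b ^+ d * M2 = 0.
  have : a * b * (a ^+ d * M1 + b ^+ d * M2) = 0.
    by rewrite -[RHS]X0 !exprS; ring.
  by move=> /eqP; rewrite !mulf_eq0 (negbTE a0) (negbTE b0)/= => /eqP.
move: D1; rewrite Y0 => /esym/eqP; rewrite mulf_eq0 pnatr_eq0 gtn_eqF//= => /eqP D1.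
(* What is left of [D1] is the equation with exponents [d - 1]; together with [R1] it is a linear
   system whose determinant contains the factor [a - b]. *)
have : a ^+ d * A * (a - b) = 0.
  case: d d0 {id0 deven s1 RI RI3 X0 Y0 R3} R1 D1 => // d _ R1 D1.
  transitivity (a * (a ^+ d.+1 * A + b ^+ d.+1 * B) -
    a * b * (a ^+ d * A + b ^+ d * B)).
    by rewrite !exprS; move: (a ^+ d) (b ^+ d) => *; ring.
  by rewrite R1 D1 !mulr0 subr0.
by move=> /eqP; rewrite mulf_eq0 (negbTE ab0) orbF => /eqP.
Qed.

Section moment_induction.
Variables (R : realType) (n : nat) (l : 'I_n).
Local Notation Cn := 'rV[R[i]]_n.
Local Notation I := (0 +i* 1)%C.
Variables (p : R) (f : Cn -> R[i]).
Hypotheses (p1 : 1 <= p) (fp : in_Lp p f).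
Local Notation J := (weighted_integral f).
Local Notation mono := (monomial_off l).
Implicit Types (s : R) (q g h : Cn -> R[i]).

Local Notation al s := ((s - 4^-1)%:C : R[i]).
Local Notation be s := ((s + 4^-1)%:C : R[i]).

Lemma weighted_integral_sum (K : eqType) (r : seq K) (h : K -> Cn -> R[i]) s :
  0 < s -> (forall i, i \in r -> subgaussian (h i)) ->
  J s (fun v => \sum_(i <- r) h i v) = \sum_(i <- r) J s (h i).
Proof.
move=> s0; elim: r => [|i r ih] hs.
  rewrite big_nil; under [X in J _ X]eq_fun do rewrite big_nil -(mul0r 0).
  by rewrite (weighted_integralZ p1 fp) ?mul0r//; exact: subgaussian_cst.
have hi : subgaussian (h i) by apply: hs; rewrite mem_head.
have hr j : j \in r -> subgaussian (h j).
  by move=> jr; apply: hs; rewrite inE jr orbT.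
rewrite big_cons -ih//; under [X in J _ X]eq_fun do rewrite big_cons.
by rewrite (weighted_integralD p1 fp)//; exact: subgaussian_sum.
Qed.

Lemma weighted_integral0 s : 0 < s -> J s (fun=> 0) = 0.
Proof.
move=> s0; have := weighted_integralZ p1 fp 0 s0 (subgaussian_cst n 0).
by under [X in J _ X]eq_fun do rewrite mul0r; rewrite mul0r.
Qed.

Definition sqabs (v : Cn) : R[i] := conjc (v ord0 l) * v ord0 l.

Lemma subgaussian_sqabs : subgaussian sqabs.
Proof.
by apply: subgaussianM; [exact: subgaussian_conj_coord|exact: subgaussian_coord].
Qed.

Lemma sqnormE (v : Cn) : (sqnorm v)%:C =
  sqabs v + \sum_(j < n | j != l) conjc (v ord0 j) * v ord0 j.
Proof.
have E (x : R[i]) : (normc x ^+ 2)%:C = conjc x * x.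
  apply: eq_complexP; rewrite normc_sqrE ?complex_ReM ?complex_ImM
    complex_ReJ complex_ImJ /=; ring.
rewrite /sqnorm rmorph_sum/= (bigD1 l)//= E; congr (_ + _).
by apply: eq_bigr => j _; rewrite E.
Qed.

(* Differentiating the relation in s brings down the factor -|v|^2, whose
   components off the coordinate l are absorbed by the monomial. *)
Lemma differentiate_relation d g h : subgaussian g -> subgaussian h ->
  (forall s q, 4^-1 < s -> mono q ->
    al s ^+ d * J s (fun v => q v * g v) +
    be s ^+ d * J s (fun v => q v * h v) = 0) ->
  forall s q, 4^-1 < s -> mono q ->
    al s ^+ d * J s (fun v => q v * (sqabs v * g v)) +
    be s ^+ d * J s (fun v => q v * (sqabs v * h v)) =
    d%:R * (al s ^+ d.-1 * J s (fun v => q v * g v) +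
            be s ^+ d.-1 * J s (fun v => q v * h v)).
Proof.
move=> sg sh rel s q s4 mq.
have s0 : 0 < s by apply: lt_trans s4; rewrite invr_gt0.
have sq := subgaussian_monomial mq.
have sqg : subgaussian (fun v => q v * g v) by exact: subgaussianM.
have sqh : subgaussian (fun v => q v * h v) by exact: subgaussianM.
have ex (x : R) (k : Cn -> R[i]) : subgaussian k ->
    expands1 (fun t => (x + t)%:C ^+ d * J (s + t) k) (x%:C ^+ d * J s k)
      (x%:C ^+ d * (- J s (fun v => (sqnorm v)%:C * k v)) +
       d%:R * x%:C ^+ d.-1 * 1 * J s k).
  move=> sk; apply: expands1M; first exact/expands1X/expands1_shift.
  exact: (weighted_integral_expands_param p1 fp).
have := expands1D (ex (s - 4^-1) _ sqg) (ex (s + 4^-1) _ sqh).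
rewrite [X in expands1 _ X]rel// => ex0.
have relt t : 0 < t <= 1 ->
    (s - 4^-1 + t)%:C ^+ d * J (s + t) (fun v => q v * g v) +
    (s + 4^-1 + t)%:C ^+ d * J (s + t) (fun v => q v * h v) = 0.
  move=> /andP[t0 _]; rewrite [s - _ + t]addrAC [s + _ + t]addrAC rel//.
  by rewrite ltr_wpDr// ltW.
have E := expands1_eq0 relt ex0.
have N (k : Cn -> R[i]) : subgaussian k ->
    J s (fun v => (sqnorm v)%:C * (q v * k v)) =
    J s (fun v => q v * (sqabs v * k v)) +
    \sum_(j < n | j != l)
       J s (fun v => q v * v ord0 j * conjc (v ord0 j) * k v).
  move=> sk.
  have sj j : subgaussian (fun v => q v * v ord0 j * conjc (v ord0 j) * k v).
    have s1 := subgaussianM sq (subgaussian_coord R j).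
    exact: subgaussianM (subgaussianM s1 (subgaussian_conj_coord R j)) sk.
  rewrite -[X in _ + X]big_filter -weighted_integral_sum//.
  rewrite -(weighted_integralD p1 fp)//; last 2 first.
  - by apply: subgaussianM => //; apply: subgaussianM => //; exact: subgaussian_sqabs.
  - by apply: subgaussian_sum => j _; exact: sj.
  congr (J _ _); apply/funext => v; rewrite sqnormE big_filter mulrDl.
  rewrite mulrCA; congr (_ + _); rewrite mulr_suml; apply: eq_bigr => j _.
  by move: (conjc _) => u; ring.
rewrite !N// !mulr1 in E.
move: E; set A := \sum_(j < n | _) _; set B := \sum_(j < n | _) _ => E.
(* Each term with [|v_j|^2], [j != l], is the relation itself for the monomial [q |v_j|^2]. *)
have AB : al s ^+ d * A + be s ^+ d * B = 0.
  rewrite /A /B !mulr_sumr -big_split/= big1// => j jl.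
  by apply: (rel s (fun v => q v * v ord0 j * conjc (v ord0 j))) => //;
    apply: MonomialXc => //; apply: MonomialX.
suff alg (a b a' b' e jg jh pg ph u w : R[i]) :
    a * - (pg + u) + e * a' * jg + (b * - (ph + w) + e * b' * jh) = 0 ->
    a * u + b * w = 0 -> a * pg + b * ph = e * (a' * jg + b' * jh).
  exact: alg E AB.
move=> E1 E2; apply/eqP; rewrite -subr_eq0.
have -> : a * pg + b * ph - e * (a' * jg + b' * jh) =
  - (a * - (pg + u) + e * a' * jg + (b * - (ph + w) + e * b' * jh)) -
  (a * u + b * w) by ring.
by rewrite E1 E2 subr0 oppr0.
Qed.

Hypothesis fock : forall s q d w, 4^-1 < s -> w = 1 \/ w = I -> mono q ->
  J s (fun v => q v * fock_form l (s - 4^-1) (s + 4^-1) w v ^+ d) = 0.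

Definition moment s q a b :=
  J s (fun v => q v * (conjc (v ord0 l) ^+ a * v ord0 l ^+ b)).

Lemma moment_relation s q d w : 4^-1 < s -> w = 1 \/ w = I -> mono q ->
  \sum_(k < d.+1) ((al s * w) ^+ (d - k) * (be s * conjc w) ^+ k *
    moment s q (d - k) k) *+ 'C(d, k) = 0.
Proof.
move=> s4 ww mq; rewrite -[RHS](fock d s4 ww mq).
have s0 : 0 < s by apply: lt_trans s4; rewrite invr_gt0.
have sq := subgaussian_monomial mq.
have sm a b : subgaussian (fun v => q v * (conjc (v ord0 l) ^+ a * v ord0 l ^+ b)).
  apply: subgaussianM => //; apply: subgaussianM; apply: subgaussianX.
    exact: subgaussian_conj_coord.
  exact: subgaussian_coord.
pose c (k : 'I_d.+1) := ((al s * w) ^+ (d - k) * (be s * conjc w) ^+ k) *+ 'C(d, k).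
transitivity (J s (fun v => \sum_(k < d.+1) (c k * (q v *
   (conjc (v ord0 l) ^+ (d - k) * v ord0 l ^+ k))))).
  rewrite weighted_integral_sum//; last first.
    by move=> i _; apply: subgaussianM => //; exact: subgaussian_cst.
  apply: eq_bigr => k _; rewrite (weighted_integralZ p1 fp)//.
  by rewrite /c mulrnAl.
congr (J _ _); apply/funext => v; rewrite /fock_form exprDn mulr_sumr.
apply: eq_bigr => k _; rewrite /c mulrnAl mulrnAr !exprMn.
congr (_ *+ _); have alg (a b c' e g h t : R[i]) :
  a * b * (e * g) * (t * (c' * h)) = t * (a * b * c' * (e * g * h)) by ring.
exact: alg.
Qed.

Lemma subgaussian_power a b :
  subgaussian (fun v : Cn => conjc (v ord0 l) ^+ a * v ord0 l ^+ b).
Proof.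
apply: subgaussianM; apply: subgaussianX; first exact: subgaussian_conj_coord.
exact: subgaussian_coord.
Qed.

Lemma sqabs_power v a b : sqabs v * (conjc (v ord0 l) ^+ a * v ord0 l ^+ b) =
  conjc (v ord0 l) ^+ a.+1 * v ord0 l ^+ b.+1.
Proof. by rewrite /sqabs !exprS; ring. Qed.

(** The case [d = 0], [h = 0] of the differentiated relation: a moment that is zero for all [s] and
    all [q] has zero derivative in [s]. *)
Lemma moment_lap a b : (forall s q, 4^-1 < s -> mono q -> moment s q a b = 0) ->
  forall s q, 4^-1 < s -> mono q -> moment s q a.+1 b.+1 = 0.
Proof.
move=> M0 s q s4 mq; have sp := subgaussian_power a b.
have := @differentiate_relation 0 _ _ sp (subgaussian_cst n 0) _ s q s4 mq.
rewrite !expr0 !mul1r mul0r.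
rewrite (_ : (fun v => q v * (sqabs v * 0)) = fun=> 0); last first.
  by apply/funext => v; rewrite !mulr0.
have s0 : 0 < s by apply: lt_trans s4; rewrite invr_gt0.
rewrite weighted_integral0// addr0 => <-; last first.
  move=> {s0 s4 mq} {}s {}q s4 mq.
  have s0 : 0 < s by apply: lt_trans s4; rewrite invr_gt0.
  have := M0 s q s4 mq; rewrite /moment !expr0 !mul1r => ->.
  rewrite (_ : (fun v => q v * 0) = fun=> 0) ?weighted_integral0 ?addr0//.
  by apply/funext => v; rewrite mulr0.
by congr (J _ _); apply/funext => v; rewrite sqabs_power.
Qed.

(** Strong induction on [a + b], with [s] and [q] quantified inside because the step differentiates
    in [s] and enlarges [q]. Mixed moments come from two degrees below by [moment_lap]; only the two
    pure moments need the pair of lines. *)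
Lemma moments_eq0 s q a b : 4^-1 < s -> mono q -> moment s q a b = 0.
Proof.
suff: forall d a b, (a + b = d)%N -> forall s q, 4^-1 < s -> mono q ->
  moment s q a b = 0 by move=> H; exact: (H (a + b)%N).
move=> {a b s q}; elim/ltn_ind => d ih.
have mid a b : (a.+1 + b.+1 = d)%N -> forall s q, 4^-1 < s -> mono q ->
    moment s q a.+1 b.+1 = 0.
  by move=> abd; apply: moment_lap; apply: (ih (a + b)%N) => //; lia.
have [d0|d0] := posnP d.
  move=> a b abd s q s4 mq; have := moment_relation 0 s4 (or_introl erefl) mq.
  rewrite big_ord1 !expr0 !mul1r mulr1n.
  by have [-> ->] : a = 0%N /\ b = 0%N by lia.
(* The interior terms of the binomial relation are mixed moments, already zero. *)
have rel w s q : 4^-1 < s -> w = 1 \/ w = I -> mono q ->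
    (al s * w) ^+ d * moment s q d 0 + (be s * conjc w) ^+ d * moment s q 0 d = 0.
  move=> s4 ww mq; rewrite -[RHS](moment_relation d s4 ww mq).
  case: d d0 {ih} mid => [//|d] _ mid.
  rewrite big_ord_recl big_ord_recr/= big1 ?add0r.
    rewrite /bump leq0n add1n !subn0 !subnn !expr0 mulr1 mul1r bin0 binn.
    by rewrite !mulr1n.
  move=> k _; rewrite /bump leq0n add1n subSS.
  rewrite (_ : (d - k = (d - k).-1.+1)%N); last by have := ltn_ord k; lia.
  by rewrite mid ?mulr0 ?mul0rn//; have := ltn_ord k; lia.
suff ends s q : 4^-1 < s -> mono q -> moment s q d 0 = 0 /\ moment s q 0 d = 0.
  move=> [|a] [|b] abd s q s4 mq.
  - by move: d0; rewrite -abd.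
  - by have [_] := ends s q s4 mq; rewrite -abd.
  - by have [+ _] := ends s q s4 mq; rewrite -abd addn0.
  - exact: mid.
move=> s4 mq.
have rel1 s' q' : 4^-1 < s' -> mono q' ->
    al s' ^+ d * moment s' q' d 0 + be s' ^+ d * moment s' q' 0 d = 0.
  move=> s4' mq'; rewrite -[RHS](rel 1 s' q' s4' (or_introl erefl) mq').
  by rewrite conjc1 !mulr1.
have R1 := rel1 s q s4 mq.
have RI := rel I s q s4 (or_intror erefl) mq.
have s0 : 0 < s by apply: lt_trans s4; rewrite invr_gt0.
have al0 : al s != 0 by rewrite (inj_eq (@complexI R)) subr_eq0 gt_eqF.
have be0 : be s != 0.
  by rewrite (inj_eq (@complexI R)) gt_eqF// addr_gt0// invr_gt0.
have ab0 : al s - be s != 0.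
  rewrite subr_eq0 (inj_eq (@complexI R)) lt_eqF//.
  have : 0 < 4^-1 :> R by rewrite invr_gt0.
  lra.
have E1 : J s (fun v => q v * (sqabs v * (conjc (v ord0 l) ^+ d * v ord0 l ^+ 0))) =
    moment s q d.+1 1.
  by congr (J _ _); apply/funext => v; rewrite sqabs_power.
have E2 : J s (fun v => q v * (sqabs v * (conjc (v ord0 l) ^+ 0 * v ord0 l ^+ d))) =
    moment s q 1 d.+1.
  by congr (J _ _); apply/funext => v; rewrite sqabs_power.
have := @differentiate_relation d _ _ (subgaussian_power d 0)
  (subgaussian_power 0 d) rel1 s q s4 mq.
rewrite E1 E2 -/(moment s q d 0) -/(moment s q 0 d) => D1.
(* In degree [d + 2] the terms with both exponents at least 2 vanish, being obtained by [moment_lap]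
   from mixed moments of degree [d]. The terms with an exponent 1 survive, with binomial coefficient
   [d + 2]. *)
have rel2 w : w = 1 \/ w = I ->
    (al s * w) ^+ d.+2 * moment s q d.+2 0 +
    ((al s * w) ^+ d.+1 * (be s * conjc w) * moment s q d.+1 1 +
     (al s * w) * (be s * conjc w) ^+ d.+1 * moment s q 1 d.+1) *+ d.+2 +
    (be s * conjc w) ^+ d.+2 * moment s q 0 d.+2 = 0.
  move=> ww; rewrite -[RHS](moment_relation d.+2 s4 ww mq).
  case: d d0 {ih rel rel1 R1 RI D1 E1 E2} mid => [//|d] _ mid.
  rewrite 2!big_ord_recl 2!big_ord_recr/= big1 ?add0r; last first.
    move=> k _; rewrite /bump !leq0n !add1n !subSS.
    rewrite (_ : (d.+1 - k = (d - k).+1)%N); last by have := ltn_ord k; lia.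
    rewrite moment_lap ?mulr0 ?mul0rn//.
    rewrite (_ : (d - k = (d - k).-1.+1)%N); last by have := ltn_ord k; lia.
    by apply: mid; have := ltn_ord k; lia.
  rewrite /bump !leq0n !add1n bin0 bin1 binSn binn !subn0 subnn subn1 subSnn /=.
  by rewrite !expr0 !expr1 mulr1 mul1r !mulr1n mulrnDl !addrA.
have P0 : al s ^+ d * moment s q d 0 = 0.
  have R3 := rel2 1 (or_introl erefl); have RI3 := rel2 I (or_intror erefl).
  rewrite conjI in RI RI3; rewrite conjc1 !mulr1 in R3.
  exact: (orthogonal_lines_elim d0 (mulII R) al0 be0 ab0 R1 RI D1 R3 RI3).
have Q0 : be s ^+ d * moment s q 0 d = 0 by move: R1; rewrite P0 add0r.
split; apply/eqP.
  by move/eqP : P0; rewrite mulf_eq0 expf_eq0 (negbTE al0) andbF.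
by move/eqP : Q0; rewrite mulf_eq0 expf_eq0 (negbTE be0) andbF.
Qed.

End moment_induction.

(** * Polynomial cutoffs *)

Section power_limits.
Variable R : realType.

Lemma Bernoulli_ge (y : R) k : 0 <= y -> 1 + k%:R * y <= (1 + y) ^+ k.
Proof.
move=> y0; elim: k => [|k ih]; first by rewrite mul0r addr0 expr0.
rewrite exprS; apply: le_trans (ler_wpM2l _ ih); last by rewrite addr_ge0.
have : 0 <= y * (k%:R * y) by rewrite !mulr_ge0.
by rewrite -natr1; lra.
Qed.

Lemma Bernoulli_le (y : R) k : 0 <= y <= 1 -> 1 - k%:R * y <= (1 - y) ^+ k.
Proof.
move=> /andP[y0 y1]; elim: k => [|k ih]; first by rewrite mul0r subr0 expr0.
rewrite exprS; apply: le_trans (ler_wpM2l _ ih); last by rewrite subr_ge0.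
have : 0 <= y * (k%:R * y) by rewrite !mulr_ge0.
by rewrite -natr1; lra.
Qed.

Lemma cvg_natr_expr (y : R) : 0 <= y -> y < 1 ->
  (fun k : nat => k%:R * y ^+ k) @ \oo --> 0.
Proof.
rewrite le_eqVlt => /orP[/eqP <- _|y0 y1].
  apply: cvg_near_cst; exists 1%N => // k /= k1.
  by rewrite expr0n gtn_eqF// mulr0.
(* Write [y^k = z^k z^k]: by Bernoulli [k z^k] is at most [1 / h], and the other factor [z^k] tends
   to 0. *)
pose z := Num.sqrt y.
have z0 : 0 < z by rewrite sqrtr_gt0.
have zz : z * z = y by rewrite -expr2 sqr_sqrtr// ltW.
have z1 : z < 1.
  by rewrite -(expr_lt1 (n := 2))// ?ltW// expr2 zz.
pose h := z^-1 - 1.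
have h0 : 0 < h by rewrite subr_gt0 invf_gt1.
apply: (@squeeze_cvgr _ _ _ _ (fun=> 0) (fun k => z ^+ k * h^-1)).
- apply: nearW => k; rewrite mulr_ge0 ?exprn_ge0 ?(ltW y0)//=.
  rewrite -zz exprMn mulrCA; apply: ler_wpM2l; first by rewrite exprn_ge0// ltW.
  have H := Bernoulli_ge k (ltW h0).
  have E : 1 + h = z^-1 by rewrite /h addrC subrK.
  rewrite E in H.
  rewrite -[leRHS]mul1r ler_pdivlMr// mulrAC.
  have zk : 0 < z ^+ k by rewrite exprn_gt0.
  have : (1 + k%:R * h) * z ^+ k <= 1.
    by rewrite -ler_pdivlMr// mul1r -exprVn.
  by move: (ltW zk); move: (z ^+ k) => w; lra.
- exact: cvg_cst.
- rewrite -(mul0r h^-1); apply: cvgMl; apply: cvg_expr.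
  by rewrite ger0_norm// ltW.
Qed.

(* A polynomial in x that tends pointwise on [0, 1] to the indicator of x < 1/2. *)
Definition cutoff (k : nat) (x : R) : R := (1 - x ^+ k) ^+ (k * 2 ^ k).

Lemma cutoff_ge0 k x : 0 <= x <= 1 -> 0 <= cutoff k x.
Proof.
by move=> /andP[x0 x1]; rewrite exprn_ge0// subr_ge0 exprn_ile1.
Qed.

Lemma cutoff_le1 k x : 0 <= x <= 1 -> cutoff k x <= 1.
Proof.
move=> /andP[x0 x1]; rewrite exprn_ile1 ?subr_ge0 ?exprn_ile1//.
by rewrite gerBl exprn_ge0.
Qed.

(** In the exponent [k 2^k] of the cutoff, [2^k] puts the threshold at 1/2 and the extra [k] forces
    the limit 0 at [x = 1/2] itself. Below the threshold Bernoulli gives [1 - k (2x)^k]; above it,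
    [(1 - y)(1 + y) <= 1] with [y = x^k] gives the bound [1 / (k + 1)]. *)
Lemma cvg_cutoff (x : R) : 0 <= x <= 1 ->
  (fun k => cutoff k x) @ \oo --> ((x < 2^-1)%R%:R : R).
Proof.
move=> x01; have [x0 x1] := andP x01.
have xk k : 0 <= x ^+ k <= 1 by rewrite exprn_ge0// exprn_ile1.
have [xh|xh] := ltP x 2^-1.
  apply: (@squeeze_cvgr _ _ _ _ (fun k => 1 - k%:R * (2 * x) ^+ k) (fun=> 1)).
  - apply: nearW => k; rewrite cutoff_le1// andbT.
    have := Bernoulli_le (k * 2 ^ k) (xk k).
    by rewrite natrM natrX -mulrA -exprMn.
  - rewrite -[X in _ --> X]subr0; apply: cvgB; first exact: cvg_cst.
    by apply: cvg_natr_expr; lra.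
  - exact: cvg_cst.
apply: (@squeeze_cvgr _ _ _ _ (fun=> 0) (fun k => (k.+1%:R)^-1)).
- apply: nearW => k; rewrite cutoff_ge0//=.
  have [y0 y1] := andP (xk k).
  have H1 : cutoff k x * (1 + x ^+ k) ^+ (k * 2 ^ k) <= 1.
    rewrite -exprMn; apply: exprn_ile1; first by rewrite mulr_ge0 ?subr_ge0 ?addr_ge0.
    have : 0 <= x ^+ k * x ^+ k by rewrite mulr_ge0.
    lra.
  have H2 := Bernoulli_ge (k * 2 ^ k) y0.
  have H3 : k.+1%:R <= 1 + (k * 2 ^ k)%:R * x ^+ k.
    rewrite -natr1 addrC lerD2l natrM natrX -mulrA -exprMn ler_peMr//.
    by rewrite exprn_ege1//; lra.
  rewrite -[leRHS]mul1r ler_pdivlMr ?ltr0n//.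
  apply: le_trans H1; apply: ler_wpM2l; first exact: cutoff_ge0.
  exact: le_trans H3 H2.
- exact: cvg_cst.
- exact: cvg_harmonic.
Qed.

End power_limits.

(** The sum [e^x + e^(-x)] replaces [e^|x|] as a majorant because, for [x = rho z v], it is visibly
    subgaussian in [v]. *)
Lemma normr_series_exp_coeff_le (R : realType) (x : R) k :
  `|series (exp_coeff x) k| <= expR x + expR (- x).
Proof.
apply: (@le_trans _ _ (expR `|x|)).
  apply: le_trans (ler_norm_sum _ _ _) _.
  have -> : \sum_(0 <= i < k) `|exp_coeff x i| = series (exp_coeff `|x|) k.
    by rewrite -normed_series_exp_coeff.
  apply: nondecreasing_cvgn_le (is_cvg_series_exp_coeff _) k.
  by apply: nondecreasing_series => i _ _; exact: exp_coeff_ge0.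
by have [x0|x0] := leP 0 x; [rewrite ger0_norm// lerDl|rewrite ltr0_norm// lerDr];
  exact: expR_ge0.
Qed.

Lemma cvg_normc_scaled (R : realType) (w : R[i]) (u : nat -> R) (x : R) :
  u @ \oo --> x -> (fun k => normc (w * (u k)%:C - w * x%:C)) @ \oo --> 0.
Proof.
move=> ux; rewrite (_ : (fun k => _) = (fun k => normc w * `|u k - x|)).
  rewrite -[X in _ --> X](mulr0 (normc w)).
  apply: cvgMr; rewrite -(normr0 R); apply: cvg_norm.
  by rewrite -(subrr x); apply: cvgB => //; exact: cvg_cst.
apply/funext => k; rewrite -mulrBr normcM -normc_real; congr (_ * normc _).
by rewrite rmorphB.
Qed.

(** * From polynomial to exponential moments *)

Section exponential_moments.
Variables (R : realType) (n : nat) (l : 'I_n).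
Local Notation Cn := 'rV[R[i]]_n.
Variables (p : R) (f : Cn -> R[i]).
Hypotheses (p1 : 1 <= p) (fp : in_Lp p f).
Local Notation J := (weighted_integral f).
Local Notation mono := (monomial_off l).

(** The cross term of [|v - a|^2], hence the factor 2. It is also [twisted_form 1 1 a v], so the
    bounds for twisted forms apply. *)
Definition rho (a v : Cn) : R := 2 * complex.Re (hermdot a v).

Lemma twisted_form_rho (c : R) a v : twisted_form c c a v = (c * rho a v)%:C.
Proof.
rewrite /twisted_form /rho; apply: eq_complexP.
  by rewrite complex_ReD !complex_ReZ complex_ReJ /=; ring.
by rewrite complex_ImD !complex_ImZ complex_ImJ /=; ring.
Qed.

Lemma subgaussian_expR_rho (c : R) a :
  subgaussian (fun v => (expR (c * rho a v))%:C).
Proof.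
have := subgaussian_cexp c c a.
by under [X in subgaussian X -> _]eq_fun do rewrite twisted_form_rho cexp_real.
Qed.

Lemma subgaussian_rho a : subgaussian (fun v => (rho a v)%:C).
Proof.
rewrite (_ : (fun v => _) = twisted_form 1 1 a); last first.
  by apply/funext => v; rewrite twisted_form_rho mul1r.
exact: subgaussian_twisted_form.
Qed.

Lemma rhoE a v : (rho a v)%:C =
  \sum_(j < n) (a ord0 j * conjc (v ord0 j) + conjc (a ord0 j) * v ord0 j).
Proof.
rewrite -(mul1r (rho a v)) -twisted_form_rho /twisted_form !mul1r /hermdot.
rewrite rmorph_sum -big_split/=; apply: eq_bigr => j _; congr (_ + _).
by apply: eq_complexP;
  rewrite !(complex_ReJ, complex_ImJ, complex_ReM, complex_ImM); ring.
Qed.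

Variable s : R.
Hypotheses (s0 : 0 < s).
Hypothesis M0 : forall q a b, mono q ->
  J s (fun v => q v * (conjc (v ord0 l) ^+ a * v ord0 l ^+ b)) = 0.

(** Expanding one factor [rho] in coordinates, each term either raises [a] or [b] (coordinate [l])
    or extends the monomial [q] (the others); so the induction on [k] keeps all three free. *)
Lemma rho_moment (z : Cn) k q a b : mono q ->
  J s (fun v => q v * (conjc (v ord0 l) ^+ a * v ord0 l ^+ b) *
    (rho z v)%:C ^+ k) = 0.
Proof.
elim: k q a b => [|k ih] q a b mq.
  by under [X in J _ X]eq_fun do rewrite expr0 mulr1; exact: M0.
have sq := subgaussian_monomial mq; have sp := subgaussian_power R l a b.
have sr := subgaussianX k (subgaussian_rho z).
have sm := subgaussianM (subgaussianM sq sp) sr.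
have sc (j : 'I_n) := subgaussian_coord R j.
have scc (j : 'I_n) := subgaussian_conj_coord R j.
pose m v := q v * (conjc (v ord0 l) ^+ a * v ord0 l ^+ b) * (rho z v)%:C ^+ k.
have sj j : subgaussian (fun v => m v * (z ord0 j * conjc (v ord0 j) +
    conjc (z ord0 j) * v ord0 j)).
  apply: subgaussianM => //.
  by apply: subgaussianD; apply: subgaussianM => //; exact: subgaussian_cst.
transitivity (J s (fun v => \sum_(j < n) (m v * (z ord0 j * conjc (v ord0 j) +
    conjc (z ord0 j) * v ord0 j)))).
  congr (J _ _); apply/funext => v; rewrite exprSr mulrA -/(m v) rhoE.
  by rewrite mulr_sumr.
rewrite (weighted_integral_sum p1 fp)//; apply: big1 => j _.
transitivity (J s (fun v => z ord0 j * (m v * conjc (v ord0 j)) +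
    conjc (z ord0 j) * (m v * v ord0 j))).
  congr (J _ _); apply/funext => v; rewrite mulrDr.
  by congr (_ + _); rewrite mulrCA.
have sm1 : subgaussian (fun v => m v * conjc (v ord0 j)) by exact: subgaussianM.
have sm2 : subgaussian (fun v => m v * v ord0 j) by exact: subgaussianM.
rewrite (weighted_integralD p1 fp)//; last 2 first.
- by apply: subgaussianM => //; exact: subgaussian_cst.
- by apply: subgaussianM => //; exact: subgaussian_cst.
rewrite !(weighted_integralZ p1 fp)//.
suff [-> ->] : J s (fun v => m v * conjc (v ord0 j)) = 0 /\
    J s (fun v => m v * v ord0 j) = 0 by rewrite !mulr0 addr0.
have [->|jl] := eqVneq j l.
  split.
    rewrite -[RHS](ih q a.+1 b mq); congr (J _ _); apply/funext => v.
    by rewrite /m exprS; move: (_ ^+ k) (_ ^+ a) (_ ^+ b) => *; ring.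
  rewrite -[RHS](ih q a b.+1 mq); congr (J _ _); apply/funext => v.
  by rewrite /m exprS; move: (_ ^+ k) (_ ^+ a) (_ ^+ b) => *; ring.
split.
  rewrite -[RHS](ih _ a b (MonomialXc jl mq)); congr (J _ _); apply/funext => v.
  by rewrite /m; move: (_ ^+ k) (_ ^+ a) (_ ^+ b) => *; ring.
rewrite -[RHS](ih _ a b (MonomialX jl mq)); congr (J _ _); apply/funext => v.
by rewrite /m; move: (_ ^+ k) (_ ^+ a) (_ ^+ b) => *; ring.
Qed.

Lemma expR_rho_moment (z : Cn) : J s (fun v => (expR (rho z v))%:C) = 0.
Proof.
pose q v : R[i] := (expR (1 * rho z v) + expR (- 1 * rho z v))%:C.
have sq : subgaussian q.
  rewrite /q; under eq_fun do rewrite rmorphD /=.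
  by apply: subgaussianD; exact: subgaussian_expR_rho.
have [mWq Wqoo] := cintegrable_weight p1 fp s0 sq.
have mW := measurable_gauss_weight fp s.
have [mr _] := subgaussian_rho z.
have mrho : measurable_fun setT (rho z) by exact: (measurable_fun_Re mr).
have [me _] := subgaussian_expR_rho 1 z.
have srho k : subgaussian (fun v => (series (exp_coeff (rho z v)) k)%:C).
  rewrite /series /=; under eq_fun do rewrite rmorph_sum/=.
  apply: subgaussian_sum => i _; rewrite /exp_coeff.
  under eq_fun do rewrite rmorphM rmorphXn/=.
  apply: subgaussianM; last exact: subgaussian_cst.
  by apply: subgaussianX; exact: subgaussian_rho.
apply: (@cintegral_lim_eq0 _ _ _ _
  (fun k v => gauss_weight f s v * (series (exp_coeff (rho z v)) k)%:C) _
  (fun v => normc (gauss_weight f s v * q v))) => //.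
- by move=> k; apply: measurable_funMC => //; have [] := srho k.
- apply: measurable_funMC => //; under eq_fun do rewrite -[rho z _]mul1r.
  exact: me.
- exact: measurable_fun_normc.
- move=> k v; rewrite !(normcM (gauss_weight f s v)) ler_wpM2l ?normc_ge0//.
  rewrite !normc_real.
  rewrite mul1r mulN1r [leRHS]ger0_norm ?addr_ge0 ?expR_ge0//.
  exact: normr_series_exp_coeff_le.
- move=> v; apply: cvg_normc_scaled.
  exact: is_cvg_series_exp_coeff.
move=> k.
transitivity (J s (fun v => \sum_(0 <= i < k) ((i`!%:R^-1)%:C *
   (1 * (conjc (v ord0 l) ^+ 0 * v ord0 l ^+ 0) * (rho z v)%:C ^+ i)))).
  congr (J _ _); apply/funext => v; rewrite /series /= rmorph_sum /=.
  apply: eq_bigr => i _; rewrite /exp_coeff rmorphM rmorphXn /= !expr0 !mul1r.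
  by rewrite mulrC.
have smi i : subgaussian (fun v =>
    1 * (conjc (v ord0 l) ^+ 0 * v ord0 l ^+ 0) * (rho z v)%:C ^+ i).
  apply: subgaussianM; last by apply: subgaussianX; exact: subgaussian_rho.
  by apply: subgaussianM; [exact: subgaussian_cst|exact: subgaussian_power].
rewrite (weighted_integral_sum p1 fp)//.
  apply: big1 => i _; rewrite (weighted_integralZ p1 fp)//.
  by rewrite rho_moment ?mulr0//; exact: Monomial1.
by move=> i _; apply: subgaussianM => //; exact: subgaussian_cst.
Qed.

End exponential_moments.

(** * From moments to null sets *)

Section annihilated_sets.
Variables (R : realType) (n : nat).
Local Notation Cn := 'rV[R[i]]_n.
Variables (p : R) (f : Cn -> R[i]).
Hypotheses (p1 : 1 <= p) (fp : in_Lp p f).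
Local Notation J := (weighted_integral f).
Local Notation lam := (lebesgue_Cn R n).

(* All s and a are needed to make the class stable under multiplication by the
   Gaussians e^(-u|v-c|^2), which shift s to s + u and a to a + u c. *)
Definition gauss_null (D : set Cn) := measurable D /\
  forall s a, 4^-1 < s -> J s (fun v => (\1_D v * expR (rho a v))%:C) = 0.

Lemma rhoDZ (a c v : Cn) (t : R) :
  rho (a + t%:C *: c) v = rho a v + t * rho c v.
Proof. by rewrite /rho hermdotDZ complex_ReD complex_ReZ; ring. Qed.

Lemma sqnormB (v c : Cn) : sqnorm (v - c) = sqnorm v - rho c v + sqnorm c.
Proof.
rewrite /sqnorm /rho /hermdot.
rewrite (raddf_sum (@complex.Re R)) mulr_sumr -sumrB -big_split/=.
apply: eq_bigr => j _; rewrite !mxE !normc_sqrE.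
rewrite complex_ReD complex_ImD complex_ReN complex_ImN complex_ReM.
by rewrite complex_ReJ complex_ImJ; ring.
Qed.

Lemma measurable_rho a : measurable_fun setT (@rho R n a).
Proof. by have [mr _] := subgaussian_rho a; exact: (measurable_fun_Re mr). Qed.

Lemma subgaussian_bounded_expR (phi : Cn -> R) a : measurable_fun setT phi ->
  (forall v, 0 <= phi v <= 1) ->
  subgaussian (fun v => (phi v * expR (rho a v))%:C).
Proof.
move=> mphi phi01; rewrite (_ : (fun v => _) =
    (fun v => (phi v)%:C * (expR (1 * rho a v))%:C)); last first.
  by apply/funext => v; rewrite mul1r rmorphM.
apply: subgaussianM; last exact: subgaussian_expR_rho.
apply: (@subgaussian_bounded _ _ _ 1); first exact: measurable_fun_real_complex.
by move=> v; have /andP[h0 h1] := phi01 v; rewrite normc_real ger0_norm.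
Qed.

Lemma indic_itv01 (D : set Cn) v : 0 <= (\1_D v : R) <= 1.
Proof. by rewrite indicE; case: (_ \in _); rewrite ?lexx ?ler01. Qed.

Lemma weighted_integral_lim (u : nat -> Cn -> R) (phi : Cn -> R) s a : 0 < s ->
  (forall k, measurable_fun setT (u k)) -> measurable_fun setT phi ->
  (forall k v, 0 <= u k v <= 1) ->
  (forall v, (fun k => u k v) @ \oo --> phi v) ->
  (forall k, J s (fun v => (u k v * expR (rho a v))%:C) = 0) ->
  J s (fun v => (phi v * expR (rho a v))%:C) = 0.
Proof.
move=> s0 mu mphi u01 uphi Ju.
have mW := measurable_gauss_weight fp s.
have me : measurable_fun setT (fun v => expR (rho a v)).
  by apply: measurableT_comp => //; exact: measurable_rho.
have s1 := subgaussian_expR_rho 1 a.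
have [mWe Weoo] := cintegrable_weight p1 fp s0 s1.
apply: (@cintegral_lim_eq0 _ _ _ _
  (fun k v => gauss_weight f s v * (u k v * expR (rho a v))%:C) _
  (fun v => normc (gauss_weight f s v * (expR (1 * rho a v))%:C))) => //.
- move=> k; apply: measurable_funMC => //; apply: measurable_fun_real_complex.
  exact: measurable_funM.
- apply: measurable_funMC => //; apply: measurable_fun_real_complex.
  exact: measurable_funM.
- exact: measurable_fun_normc.
- move=> k v; rewrite !(normcM (gauss_weight f s v)) ler_wpM2l ?normc_ge0//.
  have /andP[u0 u1] := u01 k v.
  rewrite !normc_real !ger0_norm ?expR_ge0 ?mulr_ge0 ?expR_ge0//.
  by rewrite mul1r ler_piMl ?expR_ge0.
- by move=> v; apply: cvg_normc_scaled; apply: cvgMl; exact: uphi.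
Qed.

Lemma gauss_nullE D (phi : Cn -> R) : (forall v, phi v = \1_D v) ->
  measurable D -> (forall s a, 4^-1 < s ->
    J s (fun v => (phi v * expR (rho a v))%:C) = 0) -> gauss_null D.
Proof.
move=> phiD mD H; split=> // s a s4; rewrite -[RHS](H s a s4).
by congr (J _ _); apply/funext => v; rewrite phiD.
Qed.

Lemma gauss_nullD D A : measurable A -> gauss_null D -> gauss_null (D `&` A) ->
  gauss_null (D `&` ~` A).
Proof.
move=> mA [mD KD] [mDA KDA].
apply: (@gauss_nullE _ (fun v => \1_D v - \1_(D `&` A) v)).
- move=> v; rewrite !indicE !in_setI in_setC.
  by case: (v \in D); case: (v \in A) => /=; rewrite ?subrr ?subr0.
- by apply: measurableI => //; exact: measurableC.
move=> s a s4; have s0 : 0 < s by apply: lt_trans s4; rewrite invr_gt0.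
rewrite (_ : (fun v => _) = (fun v => (\1_D v * expR (rho a v))%:C -
  (\1_(D `&` A) v * expR (rho a v))%:C)); last first.
  by apply/funext => v; rewrite mulrBl rmorphB.
rewrite (weighted_integralB p1 fp)//.
- by rewrite KD// KDA// subrr.
- by apply: subgaussian_bounded_expR => //; exact: indic_itv01.
- by apply: subgaussian_bounded_expR => //; exact: indic_itv01.
Qed.

Lemma gauss_null_bigcap (D : set Cn) (A : nat -> set Cn) :
  (forall k, gauss_null (D `&` \bigcap_(i < k) A i)) ->
  gauss_null (D `&` \bigcap_i A i).
Proof.
move=> H.
have mH : measurable (D `&` \bigcap_i A i).
  rewrite (_ : _ `&` _ = \bigcap_k (D `&` \bigcap_(i < k) A i)).
    by apply: bigcap_measurable => // k _; have [] := H k.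
  apply/seteqP; split => [v [Dv Av] k _|v H']; first by split => // i _; exact: Av.
  split; first by have [] := H' 0%N I.
  by move=> i _; have [_] := H' i.+1 I; apply; exact: ltnSn.
split => // s a s4; have s0 : 0 < s by apply: lt_trans s4; rewrite invr_gt0.
apply: (@weighted_integral_lim (fun k v => \1_(D `&` \bigcap_(i < k) A i) v)) => //.
- by move=> k; apply: measurable_indic; have [] := H k.
- by move=> k v; exact: indic_itv01.
- move=> v; have [Hv|Hv] := pselect ((D `&` \bigcap_i A i) v).
    apply: cvg_near_cst; apply: nearW => k; rewrite !indicE !mem_set//.
    by have [Dv Av] := Hv; split => // i _; exact: Av.
  apply: cvg_near_cst.
  have [Dv|Dv] := pselect (D v); last first.
    by apply: nearW => k; rewrite !indicE !memNset// => -[].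
  have [i nAi] : exists i, ~ A i v.
    apply: contrapT => /forallNP nA; apply: Hv; split => // i _.
    by apply: contrapT; exact: nA.
  exists i.+1 => // k /= ik; rewrite !indicE !memNset//.
  by move=> [_]; apply: contra_not nAi; apply.
- by move=> k; have [_] := H k; apply.
Qed.

Lemma gauss_null_far D (c : Cn) (r : R) : 0 < r -> gauss_null D ->
  gauss_null (D `&` [set v | r < sqnorm (v - c)]).
Proof.
(* This [t] makes [x v < 1/2] equivalent to [r < sqnorm (v - c)], matching the threshold of
   [cutoff]; [r] is a squared radius. *)
move=> r0 [mD KD]; pose t := ln 2 / r.
have t0 : 0 < t by rewrite divr_gt0// ln_gt0// ltr1n.
pose x (v : Cn) := expR (- t * sqnorm (v - c)).
have x01 v : 0 <= x v <= 1.
  rewrite expR_ge0 -expR0 ler_expR mulNr oppr_le0 mulr_ge0 ?sqnorm_ge0//.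
  exact: ltW.
have mx : measurable_fun setT x.
  apply: measurableT_comp => //; apply: measurable_funM => //.
  under eq_fun do rewrite sqnormB; apply: measurable_funD => //.
  by apply: measurable_funB; [exact: measurable_sqnorm|exact: measurable_rho].
have xh v : (x v < 2^-1) = (r < sqnorm (v - c)).
  rewrite -[2^-1]lnK ?posrE ?invr_gt0// ltr_expR lnV ?posrE// mulNr ltrN2.
  by rewrite /t mulrAC ltr_pdivlMr// ltr_pM2l// ln_gt0// ltr1n.
have mfar : measurable (D `&` [set v | r < sqnorm (v - c)]).
  apply: measurableI => //; rewrite (_ : [set v | _] = x @^-1` `]-oo, 2^-1[).
    by rewrite -[X in measurable X]setTI; apply: mx.
  by apply/seteqP; split => v /=; rewrite in_itv/= xh.
have mcut k m : measurable_fun setT (fun v => (1 - x v ^+ k) ^+ m).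
  by apply: measurable_funX; apply: measurable_funB => //; exact: measurable_funX.
have cut01 k m v : 0 <= \1_D v * (1 - x v ^+ k) ^+ m <= 1.
  have /andP[d0 d1] := indic_itv01 D v; have /andP[x0 x1] := x01 v.
  have y0 : 0 <= 1 - x v ^+ k by rewrite subr_ge0 exprn_ile1.
  have y1 : 1 - x v ^+ k <= 1 by rewrite gerBl exprn_ge0.
  by rewrite mulr_ge0 ?exprn_ge0//= mulr_ile1 ?exprn_ge0 ?exprn_ile1.
(* Each factor [1 - x^k] splits the integral in two: the first is the induction hypothesis at [s],
   [a], the second a multiple of it at [s + k t], [a + k t c]. *)
have cut k m s a : 4^-1 < s ->
    J s (fun v => (\1_D v * (1 - x v ^+ k) ^+ m * expR (rho a v))%:C) = 0.
  elim: m s a => [|m ih] s a s4.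
    rewrite -[RHS](KD s a s4); congr (J _ _); apply/funext => v.
    by rewrite expr0 mulr1.
  have s0 : 0 < s by apply: lt_trans s4; rewrite invr_gt0.
  have sc : subgaussian (fun v => (\1_D v * (1 - x v ^+ k) ^+ m * expR (rho a v))%:C).
    by apply: subgaussian_bounded_expR => //; exact: measurable_funM.
  have sx : subgaussian (fun v => (x v ^+ k)%:C).
    apply: (@subgaussian_bounded _ _ _ 1).
      by apply: measurable_fun_real_complex; exact: measurable_funX.
    move=> v; have /andP[x0 x1] := x01 v.
    by rewrite normc_real ger0_norm ?exprn_ge0// exprn_ile1.
  rewrite (_ : (fun v => _) = (fun v =>
      (\1_D v * (1 - x v ^+ k) ^+ m * expR (rho a v))%:C -
      (x v ^+ k)%:C * (\1_D v * (1 - x v ^+ k) ^+ m * expR (rho a v))%:C)); last first.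
    apply/funext => v; rewrite -rmorphM -rmorphB; congr (_%:C).
    by rewrite exprSr; move: (_ ^+ m) => ?; ring.
  rewrite (weighted_integralB p1 fp)//; last exact: subgaussianM.
  rewrite ih// sub0r; apply/eqP; rewrite oppr_eq0; apply/eqP.
  pose u := k%:R * t; have u0 : 0 <= u by rewrite mulr_ge0// ltW.
  have su : 4^-1 < s + u by rewrite ltr_wpDr.
  have su0 : 0 < s + u by apply: lt_trans su; rewrite invr_gt0.
  transitivity ((expR (- u * sqnorm c))%:C * J (s + u)
     (fun v => (\1_D v * (1 - x v ^+ k) ^+ m * expR (rho (a + u%:C *: c) v))%:C)).
    have sc' : subgaussian (fun v => (\1_D v * (1 - x v ^+ k) ^+ m *
        expR (rho (a + u%:C *: c) v))%:C).
      by apply: subgaussian_bounded_expR => //; exact: measurable_funM.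
    apply: etrans (weighted_integralZ p1 fp _ su0 sc').
    congr cintegral; apply/funext => v; rewrite gauss_weightD -[RHS]mulrA.
    suff H : x v ^+ k * (\1_D v * (1 - x v ^+ k) ^+ m * expR (rho a v)) =
        expR (- u * sqnorm v) * (expR (- u * sqnorm c) *
        (\1_D v * (1 - x v ^+ k) ^+ m * expR (rho (a + u%:C *: c) v))).
      by congr (_ * _); rewrite -[LHS]rmorphM H 2!rmorphM.
    rewrite /x -expRM_natl rhoDZ sqnormB.
    have -> : k%:R * (- t * (sqnorm v - rho c v + sqnorm c)) =
      - u * sqnorm v + (- u * sqnorm c) + u * rho c v by rewrite /u; ring.
    rewrite !expRD; move: (\1_D v) (_ ^+ m) => ? ?; ring.
  by rewrite ih// mulr0.
have phiE v : \1_D v * (x v < 2^-1)%R%:R =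
    \1_(D `&` [set v | r < sqnorm (v - c)]) v :> R.
  rewrite !indicE in_setI -natrM mulnb; congr (_ && _)%:R.
  by rewrite xh; apply/idP/idP; rewrite inE.
apply: (gauss_nullE phiE) => // s a s4.
have s0 : 0 < s by apply: lt_trans s4; rewrite invr_gt0.
apply: (@weighted_integral_lim (fun k v => \1_D v * cutoff k (x v))) => //.
- by move=> k; apply: measurable_funM => //; exact: mcut.
- rewrite (_ : (fun v => _) = \1_(D `&` [set v | r < sqnorm (v - c)])) //.
  exact/funext.
- by move=> k v; exact: cut01.
- by move=> v; apply: cvgMr; exact: cvg_cutoff.
- by move=> k; exact: cut.
Qed.

(** The sets with [gauss_null A] are not visibly closed under intersection. Stability relative to
    every [gauss_null] set [D] is, so these [A] form a sigma-algebra and no pi-system argument is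
    required. *)
Definition null_stable (A : set Cn) :=
  measurable A /\ forall D, gauss_null D -> gauss_null (D `&` A).

Lemma null_stableC A : null_stable A -> null_stable (~` A).
Proof.
move=> [mA NA]; split; first exact: measurableC.
by move=> D nD; apply: gauss_nullD => //; exact: NA.
Qed.

Lemma gauss_null_set0 : gauss_null set0.
Proof.
split => // s a s4; have s0 : 0 < s by apply: lt_trans s4; rewrite invr_gt0.
rewrite -[RHS](weighted_integral0 p1 fp s0); congr (J _ _).
by apply/funext => v; rewrite indic0 mul0r.
Qed.

Lemma null_stable0 : null_stable set0.
Proof. by split => // D _; rewrite setI0; exact: gauss_null_set0. Qed.

Lemma null_stable_bigcap (A : nat -> set Cn) :
  (forall k, null_stable (A k)) -> null_stable (\bigcap_k A k).
Proof.
move=> NA; split; first by apply: bigcap_measurable => // k _; have [] := NA k.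
move=> D nD; apply: gauss_null_bigcap; elim => [|k ih].
  by rewrite bigcap_mkord big_ord0 setIT.
rewrite bigcap_mkord big_ord_recr/= setIA -bigcap_mkord.
by have [_] := NA k; apply.
Qed.

Lemma null_stable_bigcup (A : nat -> set Cn) :
  (forall k, null_stable (A k)) -> null_stable (\bigcup_k A k).
Proof.
move=> NA; rewrite -[X in null_stable X]setCK setC_bigcup.
by apply/null_stableC/null_stable_bigcap => k; apply/null_stableC.
Qed.

Lemma measurable_sqnorm_le (c : Cn) (r : R) : measurable [set v | sqnorm (v - c) <= r].
Proof.
rewrite (_ : [set v | _] = (fun v => sqnorm v - rho c v + sqnorm c) @^-1` `]-oo, r]).
  rewrite -[X in measurable X]setTI; apply: (_ : measurable_fun setT _) => //.
  apply: measurable_funD => //; apply: measurable_funB.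
    exact: measurable_sqnorm.
  exact: measurable_rho.
by apply/seteqP; split => v /=; rewrite in_itv/= sqnormB.
Qed.

Lemma null_stable_ball (c : Cn) (r : R) : 0 < r ->
  null_stable [set v | sqnorm (v - c) <= r].
Proof.
move=> r0; rewrite -[X in null_stable X]setCK; apply: null_stableC.
rewrite (_ : ~` _ = [set v | r < sqnorm (v - c)]); last first.
  apply/seteqP; split => v /=; first by move/negP; rewrite -ltNge.
  by move=> h; apply/negP; rewrite -ltNge.
split; last by move=> D; exact: gauss_null_far.
rewrite (_ : [set v | _] = ~` [set v | sqnorm (v - c) <= r]).
  by apply: measurableC; exact: measurable_sqnorm_le.
apply/seteqP; split => v /=; last by move/negP; rewrite -ltNge.
by move=> h; apply/negP; rewrite -ltNge.
Qed.

(* The half-space [{b < 2 Re<v, e>}] is exhausted by the balls of radius about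
   [m] centred at [(b / 2 + m) e]. *)
Lemma null_stable_halfspace (e : Cn) (b : R) : sqnorm e = 1 ->
  null_stable [set v | b < rho e v].
Proof.
move=> e1.
have eE (x : R) : sqnorm (x%:C *: e) = x ^+ 2.
  rewrite -[RHS]mulr1 -e1 mulr_sumr; apply: eq_bigr => j _.
  by rewrite mxE normcM exprMn normc_real real_normK ?num_real.
have rhoE0 (x : R) v : rho (x%:C *: e) v = x * rho e v.
  rewrite -[_ *: e]add0r rhoDZ /rho /hermdot big1 ?mulr0 ?add0r// => j _.
  by rewrite mxE mul0r.
(* The squared radius is [m^2 - 1] because a closed ball of radius [m] would touch the bounding
   hyperplane at [(b / 2) e], outside the open half-space. The union below uses [m.+2] to keep it
   positive. *)
have key m v : (sqnorm (v - ((b / 2 + m%:R)%:C *: e)) <= m%:R ^+ 2 - 1) =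
   (sqnorm (v - (b / 2)%:C *: e) + 1 <= m%:R * (rho e v - b)).
  rewrite !sqnormB !eE !rhoE0 -[LHS]subr_ge0 -[RHS]subr_ge0; congr (0 <= _).
  by field.
rewrite (_ : [set v | _] = \bigcup_m [set v |
   sqnorm (v - ((b / 2 + m.+2%:R)%:C *: e)) <= m.+2%:R ^+ 2 - 1]).
  apply: null_stable_bigcup => m; apply: null_stable_ball.
  by rewrite subr_gt0 -[X in X < _](expr1n _ 2%N) ltrXn2r// ltr1n.
apply/seteqP; split => v /=.
  move=> h; have h' : 0 < rho e v - b by rewrite subr_gt0.
  pose q := (sqnorm (v - (b / 2)%:C *: e) + 1) / (rho e v - b).
  exists (Num.bound q) => //=; rewrite key -ler_pdivrMr//.
  apply: le_trans (ltW (archi_boundP _)) _; last by rewrite ler_nat ltnW// ltnW.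
  by rewrite divr_ge0 ?(ltW h')// addr_ge0 ?sqnorm_ge0.
move=> [m _ /=]; rewrite key => h.
rewrite -subr_gt0 -(@pmulr_rgt0 _ m.+2%:R) ?ltr0n//.
by apply: lt_le_trans h; rewrite ltr_wpDl ?sqnorm_ge0.
Qed.

(** For [c = 1] and [c = i] the function is the real and the imaginary part of [v_j]. Open
    half-lines pull back to half-spaces, and they generate the Borel sets of the line. *)
Lemma null_stable_preimage (j : 'I_n) (c : R[i]) (B : set R) :
  normc c = 1 -> measurable B ->
  null_stable ((fun v : Cn => complex.Re (c * conjc (v ord0 j))) @^-1` B).
Proof.
move=> c1; pose g (v : Cn) := complex.Re (c * conjc (v ord0 j)).
suff H : <<s @RGenOInfty.G R >> `<=` [set B | null_stable (g @^-1` B)].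
  move=> mB; apply: H; change ((@RGenOInfty.G R).-sigma.-measurable B).
  by rewrite -RGenOInfty.measurableE.
apply: smallest_sub.
  split => /=; first by rewrite preimage_set0; exact: null_stable0.
    by move=> A NA; rewrite setTD preimage_setC; exact: null_stableC.
  by move=> A NA; rewrite preimage_bigcup; exact: null_stable_bigcup.
move=> _ [b ->] /=.
rewrite (_ : _ @^-1` _ = [set v | 2 * b < rho (unit_vec j c) v]).
  apply: null_stable_halfspace.
  rewrite /sqnorm (bigD1 j)//= big1 => [|i ij].
    by rewrite mxE eqxx c1 expr1n addr0.
  by rewrite mxE (negbTE ij) normc_real normr0 expr0n.
by apply/seteqP; split => v /=; rewrite in_itv/= andbT /rho hermdot_unit_vec ltr_pM2l.
Qed.

Lemma null_stable_measurable (A : set Cn) : measurable A -> null_stable A.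
Proof.
suff : measurable `<=` null_stable by apply.
apply: smallest_sub.
  split; first exact: null_stable0.
    by move=> B NB; rewrite setTD; exact: null_stableC.
  exact: null_stable_bigcup.
move=> B; rewrite -bigcup_seq => -[j _ [C mC <-]]; rewrite setTI.
suff : measurable `<=` [set C | null_stable ((fun v : Cn => v ord0 j) @^-1` C)].
  exact.
apply: smallest_sub.
  split => /=; first by rewrite preimage_set0; exact: null_stable0.
    by move=> E NE; rewrite setTD preimage_setC; exact: null_stableC.
  by move=> E NE; rewrite preimage_bigcup; exact: null_stable_bigcup.
move=> _ [[E mE <-]|[E mE <-]] /=; rewrite setTI.
  rewrite (_ : _ @^-1` _ = (fun v : Cn => complex.Re (1 * conjc (v ord0 j))) @^-1` E).
    by apply: null_stable_preimage => //; rewrite normc_real normr1.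
  by apply/funext => v; rewrite /= mul1r; case: (v ord0 j).
rewrite (_ : _ @^-1` _ =
    (fun v : Cn => complex.Re ((0 +i* 1)%C * conjc (v ord0 j))) @^-1` E).
  by apply: null_stable_preimage => //=; rewrite expr0n expr1n add0r sqrtr1.
by apply/funext => v; rewrite /=; case: (v ord0 j) => a b /=; congr E; ring.
Qed.

End annihilated_sets.

(** * Functions whose integrals over all measurable sets vanish *)

Section zero_integrals.
Context d (T : measurableType d) (R : realType).
Variable mu : {sigma_finite_measure set T -> \bar R}.

(** A zero [cintegral] could also result from the convention for infinite integrals; integrability
    excludes that. *)
Lemma cintegral_eq0 (g : T -> R[i]) : cintegrable mu g ->
  cintegral mu setT g = 0 ->
  (\int[mu]_x (complex.Re (g x))%:E = 0 /\ \int[mu]_x (complex.Im (g x))%:E = 0)%E.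
Proof.
move=> gi /eqP; rewrite eq_complex/= => /andP[/eqP g1 /eqP g2].
have e0 : (0 : \bar R) = 0%:E by [].
split; rewrite [RHS]e0.
  rewrite -[X in X%:E]g1 fineK//; apply: integrable_fin_num => //.
  exact: cintegrable_Re.
rewrite -[X in X%:E]g2 fineK//; apply: integrable_fin_num => //.
exact: cintegrable_Im.
Qed.

Lemma cintegrable_indic (g : T -> R[i]) (E : set T) : measurable E ->
  cintegrable mu g -> cintegrable mu (fun x => g x * (\1_E x)%:C).
Proof.
move=> mE [mg goo]; apply: (@cintegrable_le _ _ _ _ _ (fun x => normc (g x))) => //.
- apply: measurable_funMC => //; apply: measurable_fun_real_complex.
  exact: measurable_indic.
- exact: measurable_fun_normc.
- move=> x; rewrite normcM ler_piMr ?normc_ge0// normc_real indicE normr_nat.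
  by rewrite lern1; case: (_ \in _).
Qed.

Lemma cintegral_ae_eq0 (g : T -> R[i]) : cintegrable mu g ->
  (forall E, measurable E -> cintegral mu setT (fun x => g x * (\1_E x)%:C) = 0) ->
  {ae mu, forall x, g x = 0}.
Proof.
move=> gi g0.
have H (h : T -> R) : mu.-integrable setT (EFin \o h) ->
    (forall E, measurable E -> \int[mu]_x (h x * \1_E x)%:E = 0)%E ->
    {ae mu, forall x, h x = 0}.
  move=> hi h0.
  have : ae_eq mu setT (EFin \o h) (cst 0%E).
    apply: integral_ae_eq => // E _ mE; rewrite [RHS]integral_cst// mul0e.
    rewrite -[RHS](h0 E mE) integral_mkcond; apply: eq_integral => x _.
    by rewrite patchE indicE; case: (_ \in _); rewrite ?mulr1 ?mulr0.
  by apply: filterS => x /(_ I) /= [].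
have HR := H _ (cintegrable_Re gi); have HI := H _ (cintegrable_Im gi).
have {}HR : {ae mu, forall x, complex.Re (g x) = 0}.
  apply: HR => E mE; have [<- _] := cintegral_eq0 (cintegrable_indic mE gi) (g0 E mE).
  by apply: eq_integral => x _; rewrite mulrC [in RHS]mulrC complex_ReZ.
have {}HI : {ae mu, forall x, complex.Im (g x) = 0}.
  apply: HI => E mE; have [_ <-] := cintegral_eq0 (cintegrable_indic mE gi) (g0 E mE).
  by apply: eq_integral => x _; rewrite mulrC [in RHS]mulrC complex_ImZ.
by apply: filterS2 HR HI => x xr xi; apply: eq_complexP.
Qed.

End zero_integrals.

Lemma gauss_null_ae_eq0 (R : realType) (n : nat) (p : R) (f : 'rV[R[i]]_n -> R[i]) :
  1 <= p -> in_Lp p f ->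
  (forall A : set 'rV[R[i]]_n, measurable A -> gauss_null f A) ->
  {ae lebesgue_Cn R n, forall z, f z = 0}.
Proof.
move=> p1 fp H; have s1 := subgaussian_cst n (1 : R[i]).
have fi := cintegrable_weight p1 fp ltr01 s1.
suff : {ae lebesgue_Cn R n, forall z, gauss_weight f 1 z * 1 = 0}.
  apply: filterS => z /eqP; rewrite mulr1 mulf_eq0 => /orP[/eqP//|].
  by rewrite eq_complex/= gt_eqF ?expR_gt0.
(* Take [a = 0] and [s = 1], a convenient value above 1/4; the weight never vanishes, so [f] itself
   does. *)
apply: cintegral_ae_eq0 => // E mE; have [_ /(_ 1 0)] := H E mE.
move=> <-; last by rewrite invf_lt1// ltr1n.
congr cintegral; apply/funext => v; rewrite mulr1; congr (_ * _%:C).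
by rewrite /rho /hermdot big1 ?mulr0 ?expR0 ?mulr1// => j _; rewrite mxE mul0r.
Qed.

(** * The twisted spherical means *)

Section spherical_means.
Variables (R : realType) (n : nat).
Local Notation Cn := 'rV[R[i]]_n.
Local Notation lam := (lebesgue_Cn R n).

Lemma measurable_Cn_reflect (z : Cn) : measurable_fun setT (fun v : Cn => z - v).
Proof.
rewrite (_ : (fun v => _) = fun v => z + (-1)%:C *: v).
  exact: measurable_Cn_affine.
by apply/funext => v; rewrite rmorphN rmorph1 scaleN1r.
Qed.

Lemma integral_Cn_reflect (z : Cn) (F : Cn -> \bar R) : measurable_fun setT F ->
  (\int[lam]_x F x = \int[lam]_x F (z - x)%R)%E.
Proof.
have ge0 (G : Cn -> \bar R) : measurable_fun setT G -> (forall x, 0 <= G x)%E ->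
    (\int[lam]_x G x = \int[lam]_x G (z - x)%R)%E.
  move=> mG G0; rewrite (@ge0_integral_Cn_affine _ _ z (-1))//.
  rewrite normrN1 expr1n mul1e; apply: eq_integral => x _.
  by rewrite rmorphN rmorph1 scaleN1r.
move=> mF; rewrite integralE [RHS]integralE; congr (_ - _)%E.
  rewrite [LHS]ge0//; last exact: measurable_funepos.
  by apply: eq_integral => x _; rewrite !funeposE.
rewrite [LHS]ge0//; last exact: measurable_funeneg.
by apply: eq_integral => x _; rewrite !funenegE.
Qed.

Lemma measurable_hermdot (z : Cn) : measurable_fun setT (hermdot z).
Proof. by have [] := subgaussian_hermdot z. Qed.

Lemma measurable_expi d (T : measurableType d) (g : T -> R) :
  measurable_fun setT g -> measurable_fun setT (fun x => expi (g x)).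
Proof.
move=> mg; apply/measurable_fun_complexP; split => /=.
  apply: (measurableT_comp _ mg); apply: continuous_measurable_fun.
  exact: continuous_cos.
apply: (measurableT_comp _ mg); apply: continuous_measurable_fun.
exact: continuous_sin.
Qed.

Variables (p : R) (f : Cn -> R[i]).
Hypotheses (p1 : 1 <= p) (fp : in_Lp p f) (n0 : (0 < n)%N).
Local Notation J := (weighted_integral f).

(** As [<z, z>] is real, the twist at [w = z - v] is [-(i/2) Im h] with [h = <z, v>], that is
    [-h/4 + conj(h)/4]; the Gaussian contributes [s h + s conj(h)]. This gives the coefficients
    [s - 1/4] and [s + 1/4]. *)
Lemma gauss_twisted_form (s : R) (z v : Cn) :
  f (z - (z - v)) * expi (complex.Im (hermdot z (z - v)) / 2) *
    (expR (- s * sqnorm (z - v)))%:C =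
  (expR (- s * sqnorm z))%:C * (gauss_weight f s v *
    cexp (twisted_form (s - 4^-1) (s + 4^-1) z v)).
Proof.
pose h := hermdot z v.
have hB : complex.Im (hermdot z (z - v)) = - complex.Im h.
  rewrite /h /hermdot !(raddf_sum (@complex.Im R)) -sumrN; apply: eq_bigr => j _.
  by rewrite !mxE; case: (z ord0 j) (v ord0 j) => a b [a' b'] /=; ring.
have sB : sqnorm (z - v) = sqnorm v - 2 * complex.Re h + sqnorm z.
  by rewrite -sqnormB; apply: eq_bigr => j _; rewrite !mxE -normc_opp opprB.
have tr : complex.Re (twisted_form (s - 4^-1) (s + 4^-1) z v) = 2 * s * complex.Re h.
  by rewrite /twisted_form complex_ReD !complex_ReZ complex_ReJ -/h; ring.
have ti : complex.Im (twisted_form (s - 4^-1) (s + 4^-1) z v) = - complex.Im h / 2.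
  by rewrite /twisted_form complex_ImD !complex_ImZ complex_ImJ -/h; field.
rewrite subKr hB /cexp tr ti /gauss_weight.
have -> : - s * sqnorm (z - v) =
    - s * sqnorm z + (- s * sqnorm v + 2 * s * complex.Re h) by rewrite sB; ring.
by rewrite !expRD !rmorphM /=; ring.
Qed.

Lemma spherical_mean_annihilates (s : R) (z : Cn) : 0 < s ->
  (forall r, 0 < r -> twisted_spherical_mean f r z = 0) ->
  J s (fun v => cexp (twisted_form (s - 4^-1) (s + 4^-1) z v)) = 0.
Proof.
move=> s0 f0.
pose G (w : Cn) := f (z - w) * expi (complex.Im (hermdot z w) / 2).
pose e (w : Cn) : R := expR (- s * sqnorm w).
have mG : measurable_fun setT G.
  apply: measurable_funMC.
    by apply: measurableT_comp; [have [] := fp|exact: measurable_Cn_reflect].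
  apply: measurable_expi; apply: measurable_funM => //.
  by apply: measurable_fun_Im; exact: measurable_hermdot.
have me : measurable_fun setT e by exact: measurable_gauss_Cn.
have sc : subgaussian (fun v => cexp (twisted_form (s - 4^-1) (s + 4^-1) z v)).
  exact: subgaussian_cexp.
have Ji := cintegrable_weight p1 fp s0 sc.
have GE : (fun v => G (z - v) * (e (z - v))%:C) = fun v => (expR (- s * sqnorm z))%:C *
    (gauss_weight f s v * cexp (twisted_form (s - 4^-1) (s + 4^-1) z v)).
  by apply/funext => v; exact: gauss_twisted_form.
have Hi : cintegrable lam (fun v => G (z - v) * (e (z - v))%:C).
  by rewrite GE; exact: cintegrableZ.
(* [k] stands for the real and the imaginary part: the passage from spheres to space is made for
   real functions, in the variable [w = z - v]. *)
have part (k : R[i] -> R) : measurable_fun setT k ->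
    (forall x, `|k x| <= normc x) -> (forall x a, k (x * a%:C) = k x * a) ->
    (forall r, 0 < r -> \int[sphere_measure n r]_(w in sphere r) k (G w) = 0) ->
    (\int[lam]_v (k (G (z - v) * (e (z - v))%:C))%:E = 0)%E.
  move=> mk kle kM k0.
  have mkG : measurable_fun setT (k \o G) by exact: measurableT_comp.
  have mF : measurable_fun setT (fun w => `|k (G w)| * e w).
    by apply: measurable_funM => //; exact: measurableT_comp.
  transitivity (\int[lam]_w (k (G w) * e w)%:E)%E.
    rewrite [RHS](integral_Cn_reflect z).
      by apply: eq_integral => v _; rewrite kM.
    by apply/measurable_EFinP; exact: measurable_funM.
  apply: (@gauss_integral_eq0 _ _ s (k \o G)) => //.
  rewrite (integral_Cn_reflect z); last exact/measurable_EFinP.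
  have [_ Hoo] := Hi; apply: le_lt_trans Hoo; apply: ge0_le_integral => //.
  - apply/measurable_EFinP; apply: (measurableT_comp mF).
    exact: measurable_Cn_reflect.
  - by apply/measurable_EFinP; apply: measurable_fun_normc; have [] := Hi.
  - move=> v _; rewrite lee_fin (normcM (G _)) normc_real.
    rewrite [X in _ <= _ * X]ger0_norm ?expR_ge0//.
    by rewrite ler_wpM2r ?expR_ge0//; exact: kle.
suff : cintegral lam setT (fun v => G (z - v) * (e (z - v))%:C) = 0.
  rewrite GE cintegralZ// => /eqP; rewrite mulf_eq0 => /orP[|/eqP//].
  by rewrite eq_complex/= gt_eqF ?expR_gt0.
have Gr r : 0 < r -> \int[sphere_measure n r]_(w in sphere r) complex.Re (G w) = 0 /\
    \int[sphere_measure n r]_(w in sphere r) complex.Im (G w) = 0.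
  by move=> /f0/eqP; rewrite eq_complex/= => /andP[/eqP ? /eqP ?].
apply: eq_complexP; rewrite /= /Rintegral.
  rewrite (part (@complex.Re R)) //.
  - exact: measurable_Re.
  - exact: normc_Re.
  - by move=> x a; rewrite mulrC complex_ReZ mulrC.
  - by move=> r /Gr[].
rewrite (part (@complex.Im R)) //.
- exact: measurable_Im.
- exact: normc_Im.
- by move=> x a; rewrite mulrC complex_ImZ mulrC.
- by move=> r /Gr[].
Qed.

End spherical_means.

Section coxeter_lines.
Variables (R : realType) (n N : nat).
Hypothesis N1 : (1 <= N)%N.

Lemma line_space_Coxeter (l : 'I_n) (w : R[i]) (z : 'rV[R[i]]_n) : l.+1 = n ->
  w = 1 \/ w = (0 +i* 1)%C -> line_space l w z ->
  last_coord_in (Coxeter_lines (2 * N)) z.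
Proof.
move=> ln ww [t zt] j jn.
have -> : j = l by apply: val_inj; have [] := etrans jn (esym ln).
rewrite zt; case: ww => ->.
  exists 0%N; first by rewrite /=; lia.
  by exists t => //; rewrite mulr0 mul0r /expi cos0 sin0.
exists N; first by rewrite /=; lia.
exists t => //; congr (_ * _).
rewrite natrM -[X in pi * X / _]mul1r invfM.
have -> : pi * (1 * N%:R) * (2^-1 * N%:R^-1) = pi / 2 :> R.
  by field; rewrite pnatr_eq0; lia.
by rewrite /expi cos_pihalf sin_pihalf.
Qed.

End coxeter_lines.

Theorem theorem3p4 (R : realType) (n N : nat) (p : R) (f : 'rV[R[i]]_n -> R[i]) :
  (2 <= n)%N -> (1 <= N)%N ->
  1 <= p <= 2 ->
  in_Lp p f ->
  (forall (r : R) (z : 'rV[R[i]]_n), 0 < r ->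
    last_coord_in (Coxeter_lines (2 * N)) z ->
    twisted_spherical_mean f r z = 0) ->
  {ae lebesgue_Cn R n, forall z, f z = 0}.
Proof.
move=> n2 N1 /andP[p1 _] fp f0.
have n0 : (0 < n)%N by lia.
have ln : (n.-1 < n)%N by lia.
pose l := Ordinal ln; have l1 : l.+1 = n by rewrite /=; lia.
have fock (s : R) q d w : 4^-1 < s -> w = 1 \/ w = (0 +i* 1)%C -> monomial_off l q ->
    weighted_integral f s (fun v =>
      q v * fock_form l (s - 4^-1) (s + 4^-1) w v ^+ d) = 0.
  move=> s4 ww mq; have s0 : 0 < s by apply: lt_trans s4; rewrite invr_gt0.
  apply: (fock_form_integral p1 fp s0) => //.
  - by rewrite subr_eq0 gt_eqF.
  - by rewrite gt_eqF// addr_gt0 ?invr_gt0.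
  move=> z zl; under eq_fun do rewrite mul1r.
  apply: (spherical_mean_annihilates p1 fp n0 s0) => r r0.
  by apply: f0 => //; exact: line_space_Coxeter zl.
(* The starting point for stability: intersecting the whole space with any measurable set stays in
   the class. *)
have nT : gauss_null f setT.
  split => // s a s4; have s0 : 0 < s by apply: lt_trans s4; rewrite invr_gt0.
  rewrite -[RHS](expR_rho_moment (l := l) p1 fp s0 _ a).
    by congr weighted_integral; apply/funext => v; rewrite indicT mul1r.
  by move=> q b c mq; exact: (moments_eq0 p1 fp fock).
apply: (gauss_null_ae_eq0 p1 fp) => A mA.
by have [_ /(_ _ nT)] := null_stable_measurable p1 fp mA; rewrite setTI.
Qed.
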